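(* There exist two slowly varying functions $\varphi,\Phi$ such that for all $k\ge1$, $$q(k)=k^{-\frac1{2\alpha}-1}\varphi(k)\qquad\text{and}\qquad Q(k)=k^{-\frac1{2\alpha}}\Phi(k).$$
   Context: A sign-decorated binary tree is a finite planar rooted tree in which every internal vertex (node) has exactly two ordered children and carries a sign $\oplus$ or $\ominus$; $\mathrm{LIS}(t)$ is the maximal number of leaves in a set of leaves whose pairwise highest common ancestors all carry $\oplus$. Fix $p\in(0,1)$. $T$ is a critical binary Bienaymé–Galton–Watson tree with i.i.d. node signs, $\mathbb P(\oplus)=p$; $q(k)=\mathbb P(\mathrm{LIS}(T)=k)$, $Q(k)=\mathbb P(\mathrm{LIS}(T)\ge k)$. $\alpha=\alpha(p)$ is the unique solution in $(1/2,1)$ of $\frac{1}{4^{1/(2\alpha)}\sqrt\pi}\frac{\Gamma(1/2-1/(2\alpha))}{\Gamma(1-1/(2\alpha))}=\frac{p}{p-1}$. A measurable $\varphi:(0,\infty)\to(0,\infty)$ is slowly varying if $\varphi(xz)/\varphi(z)\to1$ as $z\to\infty$ for every $x>0$. *)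

(* Defs.v *)
From HB Require Import structures.
From mathcomp Require Import all_boot all_order all_algebra.
From mathcomp Require Import all_classical all_reals all_analysis.
Set Implicit Arguments. Unset Strict Implicit. Unset Printing Implicit Defensive.
Import Order.TTheory GRing.Theory Num.Theory.
Import numFieldNormedType.Exports.
Local Open Scope classical_set_scope.
Local Open Scope ring_scope.

(* Node s l r : internal node with sign s (true = plus, false = minus). *)
Inductive stree := Leaf | Node of bool & stree & stree.

(* Vertices are addressed by paths from the root: false = left, true = right. *)
Fixpoint leaves (t : stree) : seq (seq bool) :=
  match t with
  | Leaf => [:: [::]]
  | Node _ l r => map (cons false) (leaves l) ++ map (cons true) (leaves r)
  end.

Fixpoint sign_at (t : stree) (a : seq bool) : option bool :=
  match t, a with
  | Node s _ _, [::] => Some s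
  | Node _ l _, false :: a' => sign_at l a'
  | Node _ _ r, true :: a' => sign_at r a'
  | Leaf, _ => None
  end.

(* longest common prefix = address of the highest common ancestor *)
Fixpoint lcp (u v : seq bool) : seq bool :=
  match u, v with
  | x :: u', y :: v' => if x == y then x :: lcp u' v' else [::]
  | _, _ => [::]
  end.

Definition hca_plus (t : stree) (u v : seq bool) : bool :=
  sign_at t (lcp u v) == Some true.

Fixpoint pairwise_plus (t : stree) (S : seq (seq bool)) : bool :=
  match S with
  | [::] => true
  | u :: S' => all (hca_plus t u) S' && pairwise_plus t S'
  end.

Fixpoint subsets (T : Type) (s : seq T) : seq (seq T) :=
  match s with
  | [::] => [:: [::]]
  | x :: s' => let r := subsets s' in map (cons x) r ++ r
  end.

Definition LIS (t : stree) : nat :=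
  \max_(S <- subsets (leaves t) | pairwise_plus t S) size S.

Fixpoint trees_upto (h : nat) : seq stree :=
  match h with
  | 0 => [:: Leaf]
  | h'.+1 =>
      let T := trees_upto h' in
      Leaf :: flatten [seq [seq Node s lr.1 lr.2 | lr <- [seq (l, r) | l <- T, r <- T]]
                      | s <- [:: true; false]]
  end.

Section Prob.
Variable R : realType.

(* P(T = t) for T a critical binary BGW tree (0 or 2 children w.p. 1/2 each)
   with i.i.d. signs, P(plus) = p *)
Fixpoint tree_prob (p : R) (t : stree) : R :=
  match t with
  | Leaf => 2^-1
  | Node s l r => 2^-1 * (if s then p else 1 - p) * tree_prob p l * tree_prob p r
  end.

(* q(k) = P(LIS(T) = k) : the sum of P(T = t) over all (finite) trees t with
   LIS(t) = k, computed as the limit of the sums over trees of height <= h *)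
Definition q_LIS (p : R) (k : nat) : R :=
  limn (fun h => \sum_(t <- trees_upto h | LIS t == k) tree_prob p t).

Definition Q_LIS (p : R) (k : nat) : R :=
  limn (fun h => \sum_(t <- trees_upto h | (k <= LIS t)%N) tree_prob p t).

(* Euler Gamma function: integral for x > 0, extended to the other
   non-pole reals by Gamma(x) = Gamma(x + N) / (x (x+1) ... (x+N-1)) *)
Definition Gamma_pos (x : R) : R :=
  fine (\int[lebesgue_measure]_(t in [set t : R | 0 < t])
          ((t `^ (x - 1)) * expR (- t))%:E).

Definition Gamma (x : R) : R :=
  let N := (Num.truncn (- x)).+1 in
  Gamma_pos (x + N%:R) / \prod_(i < N) (x + i%:R).

Definition slowly_varying (phi : R -> R) : Prop :=
  measurable_fun [set z : R | 0 < z] phi /\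
  (forall z : R, 0 < z -> 0 < phi z) /\
  (forall x : R, 0 < x -> (phi (x * z) / phi z) @[z --> +oo] --> (1 : R)).

End Prob.

(* Main.v *)
Require Import Defs.
From HB Require Import structures.
From mathcomp Require Import all_boot all_order all_algebra.
From mathcomp Require Import all_classical all_reals all_analysis.
From mathcomp Require Import measurable_realfun ring lra zify.
Set Implicit Arguments. Unset Strict Implicit. Unset Printing Implicit Defensive.
Import Order.TTheory GRing.Theory Num.Theory.
Import numFieldNormedType.Exports.
Local Open Scope classical_set_scope.
Local Open Scope ring_scope.

(* Write q k = P(LIS = k), Q k = P(LIS > k), rho = (1 - p) / p and
   g = 1 / (2 alpha).  Conditioning on the root gives quadratic recursions,
   which amount to q * q = q (2 + rho (Q k + Q (k-1))), q * Q = Q + rho Q^2 and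
   2 (k q) * Q = (Q * Q)(k-1) + k rho Q^2, where * is convolution.
   For H fixed, D j = H Q j - j q j satisfies
   (D * q) k = D k (1 + rho Q k) - rho k (q k)^2 / 2, so a maximum principle
   bounds the hazard index H_k = k q k / Q k between positive constants, whence
   Q 0 + ... + Q (k-1) = O(k Q k).
   Take H = H_k with k an extremum of H_j, up to a small multiple of log (k/j),
   over j <= k.  Then D has almost constant sign on [1, k], and the same identity
   forces its l^1 norm there to be o(k Q k).  This has two consequences: D is
   negligible in the identity for (k q) * Q, so
   (2 H_k - 1) (Q * Q) k = (rho + o(1)) k (Q k)^2; and H_j is close to H_k on
   average, so Q j / Q k is close to (k/j)^H_k and can be compared with the
   coefficients m_k of (1 - x)^(g-1).  The latter satisfy
   (m * m) k ~ B(1-g, 1-g) k (m_k)^2, and by the duplication formula the equation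
   defining alpha says exactly that (2 g - 1) B(1-g, 1-g) = rho.  If H_k >= g, the
   comparison shows that (Q * Q) k / (k (Q k)^2) is at least B(1-g, 1-g) - o(1), so
   2 H_k - 1 <= 2 g - 1 + o(1); symmetrically if H_k <= g.  So near-maxima and
   near-minima of H tend to g, hence so does H, which gives the regular variation
   of Q and of q k = H_k Q k / k. *)

(** * Discrete convolution and tail systems *)

(** The recursions mix Cauchy products with the pointwise square of Q, so the generating function
    satisfies no evident closed equation whose singularity could be read off; this is why the
    argument compares coefficients directly. The identities evaluate only signed sums of D, and
    near-extremality of k is what turns such a value into a bound on the sum of |D|. The logarithmic
    penalty is there because a plain maximum of H over [1, n] may sit at a bounded index, where
    nothing is asymptotic. As H is bounded and the harmonic sum h is not, the maximiser k of H_j +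
    eta h_j over j <= n tends to infinity with n and still satisfies H_k >= H_n, so a bound at
    near-maxima controls every H_n. The penalty is cheap: it is summable against Q, and it vanishes
    at j = k, where the weight q (k - j) concentrates. The comparison uses the fixed exponent g
    rather than H_k. A larger index makes (Q * Q) k / (k (Q k)^2) larger, while the balance identity
    makes this ratio inversely proportional to 2 H_k - 1; these opposite monotonicities pin the
    index to g. *)

Section Convolution.
Variable R : realFieldType.
Implicit Types a b : nat -> R.

Definition conv a b (k : nat) : R := \sum_(i < k.+1) a i * b (k - i)%N.

Lemma convC a b k : conv a b k = conv b a k.
Proof.
rewrite /conv (reindex_inj rev_ord_inj) /=; apply: eq_bigr => i _.
by rewrite subSS subKn 1?mulrC // -ltnS.
Qed.

Lemma conv_split a b k :
  conv a b k.+1 = a 0%N * b k.+1 + \sum_(1 <= i < k.+1) a i * b (k.+1 - i)%N +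
                  a k.+1 * b 0%N.
Proof.
rewrite /conv -(big_mkord xpredT (fun i => a i * b (k.+1 - i)%N)).
by rewrite big_nat_recr //= big_ltn // subnn subn0.
Qed.

(** Pairing i with k - i replaces the weight i by its mean k / 2. *)
Lemma conv_weight a k :
  2 * conv (fun i => i%:R * a i) a k = k%:R * conv a a k.
Proof.
have -> : 2 * conv (fun i => i%:R * a i) a k =
    conv (fun i => i%:R * a i) a k + conv a (fun i => i%:R * a i) k.
  by rewrite -convC; ring.
rewrite /conv -big_split mulr_sumr; apply: eq_bigr => i _ /=.
have ik : (i <= k)%N by rewrite -ltnS.
by rewrite [in RHS](_ : k%:R = i%:R + (k - i)%:R) ?natrB //; ring.
Qed.

Lemma conv_lincomb x a b c k :
  conv (fun i => x * a i - b i) c k = x * conv a c k - conv b c k.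
Proof.
rewrite /conv mulr_sumr -sumrB; apply: eq_bigr => i _; ring.
Qed.

End Convolution.

Section TailSystem.
Variable R : realType.

(* Normalised as for the law of LIS: [Q k] stands for P(LIS > k), not P(LIS >= k). *)
Record tail_system (rho : R) (q Q : nat -> R) : Prop := TailSystem {
  ts_rho : 0 < rho;
  ts_q0 : q 0%N = 0;
  ts_Q0 : Q 0%N = 1;
  ts_QS : forall k, Q k = Q k.+1 + q k.+1;
  ts_q : forall k, 0 < q k.+1;
  ts_Q : forall k, 0 < Q k;
  ts_qq : forall k, (1 < k)%N -> conv q q k = q k * (2 + rho * (Q k + Q k.-1));
  ts_qQ : forall k, (0 < k)%N -> conv q Q k = Q k + rho * Q k ^+ 2 }.

Variables (rho : R) (q Q : nat -> R).
Hypothesis S : tail_system rho q Q.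

Let w k := k%:R * q k.
Let rho0 : 0 < rho := ts_rho S.
Let q0 : q 0%N = 0 := ts_q0 S.
Let Q0 : Q 0%N = 1 := ts_Q0 S.

Lemma q_ge0 k : 0 <= q k.
Proof. case: k => [|k]; rewrite ?q0 // ltW //; exact: ts_q S k. Qed.

Lemma q_gt0 k : (0 < k)%N -> 0 < q k.
Proof. by case: k => // k _; exact: ts_q S k. Qed.

Let Qp k : 0 < Q k := ts_Q S k.

Lemma Q_nonincr j k : (j <= k)%N -> Q k <= Q j.
Proof.
move=> /subnK <-; elim: (k - j)%N => [|n IH] //.
by apply: le_trans IH; rewrite (ts_QS S (n + j)) lerDl q_ge0.
Qed.

Lemma Q_le1 k : Q k <= 1.
Proof. by rewrite -Q0 Q_nonincr. Qed.

Lemma kq_ge0 k : 0 <= w k.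
Proof. by rewrite mulr_ge0 ?q_ge0. Qed.

(** Summation by parts: termwise Q (k + 1 - i) = Q (k - i) - q (k + 1 - i) for i <= k, and the last
    term is a (k + 1) because Q 0 = 1. *)
Lemma conv_QS (a : nat -> R) k :
  conv a Q k.+1 = conv a Q k + a k.+1 - conv a q k.+1.
Proof.
rewrite {1 3}/conv !(big_ord_recr k.+1) /= subnn q0 Q0 mulr0 mulr1 addr0.
rewrite addrAC; congr (_ + _); apply/eqP; rewrite eq_sym subr_eq; apply/eqP.
rewrite /conv -big_split; apply: eq_bigr => i _ /=.
have ik : (i <= k)%N by rewrite -ltnS.
by rewrite -mulrDr subSn // (ts_QS S (k - i)).
Qed.

Lemma conv_kq_q k : (1 < k)%N ->
  conv w q k = w k * (1 + rho * (Q k + Q k.-1) / 2).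
Proof.
move=> k1; have := conv_weight q k; rewrite (ts_qq S k1) -/w => h.
apply: (@mulfI _ 2); first by rewrite pnatr_eq0.
by rewrite h /w; field.
Qed.

(** Induction on k: [conv_QS] gives the increments, and [conv_kq_q] and [ts_qQ] evaluate the
    convolutions with q that it produces. *)
Lemma conv_kq_Q k : (0 < k)%N ->
  2 * conv w Q k = conv Q Q k.-1 + k%:R * rho * Q k ^+ 2.
Proof.
case: k => // k _; elim: k => [|k IH].
  have := ts_qQ S (ltnSn 0); rewrite /conv !big_ord_recl !big_ord0 /w /bump /=.
  rewrite !(subnn, subn0, addn0) q0 Q0.
  have -> : bump 0 0 = 1%N by [].
  by have := ts_QS S 0; rewrite Q0; lra.
rewrite [conv w Q _]conv_QS mulrBr mulrDr IH conv_kq_q // [k.+2.-1]/= [k.+1.-1]/=.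
rewrite [conv Q Q k.+1]conv_QS [conv Q q _]convC (ts_qQ S) //.
have -> : w k.+2 = k.+2%:R * (Q k.+1 - Q k.+2).
  by rewrite /w (ts_QS S k.+1); ring.
rewrite -[k.+2%:R]natr1; by field.
Qed.

Lemma conv_defect_q H k : (1 < k)%N -> let D j := H * Q j - w j in
  conv D q k = D k * (1 + rho * Q k) - rho * w k * q k / 2.
Proof.
move=> k1 /=; rewrite conv_lincomb conv_kq_q // convC (ts_qQ S) 1?ltnW //.
have -> : Q k.-1 = Q k + q k by case: k k1 => // k _; exact: (ts_QS S).
by field.
Qed.

(** Maximum principle at the first failure k: D j >= 0 for j < k and D k < 0. As q 0 = 0, the sum D
    * q does not see D k and is nonnegative, while [conv_defect_q] makes it negative. The constant
    is the hazard index at 1, so that D 1 = 0. *)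
Lemma kq_ub k : w k <= q 1%N / Q 1%N * Q k.
Proof.
set K := q 1%N / Q 1%N.
have K0 : 0 < K by rewrite divr_gt0 // q_gt0.
elim/ltn_ind: k => k IH; case: k IH => [|[|k]] IH.
- by rewrite /w mul0r mulr_ge0 // ltW.
- by rewrite /w mul1r divfK // gt_eqF.
rewrite leNgt; apply/negP => h.
have := @conv_defect_q K k.+2 isT; rewrite /=.
set e := (X in _ = X); have e0 : e < 0.
  rewrite /e; have := kq_ge0 k.+2; have := q_ge0 k.+2; have := Qp k.+2 => Qk qk wk.
  have ? : 0 <= rho * w k.+2 * q k.+2 / 2.
    by rewrite divr_ge0 // !mulr_ge0 // ltW.
  have ? : (K * Q k.+2 - w k.+2) * (1 + rho * Q k.+2) < 0.
    by rewrite nmulr_rlt0 ?subr_lt0 // addr_gt0 // mulr_gt0.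
  lra.
move=> h2; move: e0; rewrite -h2 ltNge => /negP; apply.
apply: sumr_ge0 => i _.
have [ik|ik] := ltnP i k.+2; first by rewrite mulr_ge0 ?q_ge0 // subr_ge0 IH.
have -> : (i = k.+2 :> nat) by apply/eqP; rewrite eqn_leq ik -ltnS ltn_ord.
by rewrite subnn q0 mulr0.
Qed.

End TailSystem.

(** * Sequences with regular partial sums *)

Section ConvExtra.
Variable R : realFieldType.
Implicit Types a b : nat -> R.

Lemma conv_ge_term a b k i : (forall j, 0 <= a j) -> (forall j, 0 <= b j) ->
  (i <= k)%N -> a i * b (k - i)%N <= conv a b k.
Proof.
move=> a0 b0 ik; have ik' : (i < k.+1)%N by [].
rewrite /conv (bigD1 (Ordinal ik')) //= lerDl.
by apply: sumr_ge0 => j _; rewrite mulr_ge0.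
Qed.

Lemma conv_ends a b k m : (m.*2 <= k)%N ->
  conv a a k = 2 * \sum_(0 <= j < m) a j * a (k - j)%N +
               \sum_(m <= j < (k - m).+1) a j * a (k - j)%N.
Proof.
move=> mk; rewrite /conv -(big_mkord xpredT (fun i => a i * a (k - i)%N)).
rewrite (@big_cat_nat _ _ _ m) //=; last by lia.
rewrite (@big_cat_nat _ _ _ (k - m).+1 m) /=; [|lia|lia].
have -> : \sum_((k - m).+1 <= i < k.+1) a i * a (k - i)%N =
          \sum_(0 <= j < m) a j * a (k - j)%N.
  rewrite big_nat_rev /= -{1}[(k - m).+1]add0n big_addn.
  rewrite (_ : (k.+1 - (k - m).+1 = m)%N); last by lia.
  apply: eq_big_nat => i /andP[_ im]; rewrite mulrC; congr (a _ * a _); lia.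
by ring.
Qed.

End ConvExtra.

Section RegularTail.
Variables (R : realType) (a : nat -> R) (C : R).
Hypothesis a_gt0 : forall k, 0 < a k.
Hypothesis a_nonincr : forall j k, (j <= k)%N -> a k <= a j.

Definition psum (k : nat) : R := \sum_(0 <= j < k) a j.

Hypothesis psum_ub : forall k, (0 < k)%N -> psum k <= C * (k%:R * a k).

Lemma psumS k : psum k.+1 = psum k + a k.
Proof. by rewrite /psum big_nat_recr. Qed.

Lemma psum_lb k : k%:R * a k <= psum k.
Proof.
have -> : k%:R * a k = \sum_(0 <= j < k) a k.
  by rewrite sumr_const_nat subn0 mulr_natl.
by rewrite /psum !big_nat ler_sum // => i /andP[_ /ltnW ik]; exact: a_nonincr.
Qed.

Lemma psum_le j k : (j <= k)%N -> psum j <= psum k.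
Proof.
move=> /subnK <-; elim: (k - j)%N => [|n IH] //.
by rewrite addSn psumS (le_trans IH) // lerDl ltW.
Qed.

Lemma psum_ge0 k : 0 <= psum k.
Proof. by rewrite sumr_ge0 // => i _; exact: ltW. Qed.

Lemma psum_const_ge1 : 1 <= C.
Proof.
have := le_trans (psum_lb 1) (psum_ub (ltnSn 0)).
by rewrite mul1r ler_pMl.
Qed.

Lemma regular_ratio j k : (j <= k)%N -> (0 < k)%N ->
  j%:R * a j <= C * (k%:R * a k).
Proof.
by move=> jk k0; apply: le_trans (psum_ub k0); apply: le_trans (psum_le jk); exact: psum_lb.
Qed.

Lemma regular_half j k : (k <= j.*2)%N -> (j <= k)%N -> (0 < k)%N ->
  a j <= 2 * C * a k.
Proof.
move=> kj jk k0; have k0' : 0 < k%:R :> R by rewrite ltr0n.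
have := regular_ratio jk k0; have := psum_const_ge1; have aj := a_gt0 j; have ak := a_gt0 k.
move=> C1 h; rewrite -(ler_pM2l k0'); apply: le_trans (_ : 2 * (j%:R * a j) <= _).
  rewrite mulrA ler_pM2r // -natrM ler_nat; lia.
by apply: le_trans (ler_wpM2l _ h) _ => //; rewrite le_eqVlt; apply/orP; left; apply/eqP; ring.
Qed.

(** For l >= m the increment a l is at least psum l / (C l) >= psum m / (C l), so the partial sums
    grow at least logarithmically. *)
Lemma psum_harmonic m k : (0 < m)%N -> (m <= k)%N ->
  psum m * \sum_(m <= l < k) l%:R^-1 <= C * psum k.
Proof.
move=> m0 /subnK <-; have C0 : 0 < C by exact: lt_le_trans psum_const_ge1.
elim: (k - m)%N => [|n IH].
  by rewrite add0n big_geq // mulr0 mulr_ge0 ?psum_ge0 // ltW.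
rewrite addSn big_nat_recr ?leq_addl //= psumS !mulrDr lerD //.
have nm0 : (0 < n + m)%N by rewrite addn_gt0 m0 orbT.
rewrite ler_pdivrMr ?ltr0n //.
apply: le_trans (psum_le (leq_addl n m)) _.
by apply: le_trans (psum_ub nm0) _; rewrite (mulrC _ (a _)) mulrA.
Qed.

End RegularTail.

(** Each of the n dyadic blocks [M, 2M) contributes at least M / (2M). *)
Lemma harmonic_dyadic (R : realType) n m k : (0 < m)%N -> (m * 2 ^ n <= k)%N ->
  n%:R / 2 <= \sum_(m <= l < k) l%:R^-1 :> R.
Proof.
move=> m0; elim: n k => [|n IH] k.
  by move=> _; rewrite mul0r sumr_ge0.
move=> mk; have p0 : (0 < 2 ^ n)%N by rewrite expn_gt0.
have hk : ((m * 2 ^ n).*2 <= k)%N by move: mk; rewrite expnS; lia.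
rewrite (@big_cat_nat _ _ _ (m * 2 ^ n)) /=; [|nia|lia].
have -> : n.+1%:R / 2 = n%:R / 2 + 2^-1 :> R by rewrite -natr1 mulrDl mul1r.
rewrite lerD ?IH //.
set M := (m * 2 ^ n)%N in hk *; have M0 : (0 < M)%N by rewrite muln_gt0 m0.
rewrite (@big_cat_nat _ _ _ M.*2) /=; [|lia|lia].
apply: le_trans (_ : \sum_(M <= i < M.*2) (M.*2)%:R^-1 <= _).
  rewrite sumr_const_nat (_ : (M.*2 - M = M)%N); last by lia.
  rewrite -[leRHS]mulr_natl -muln2 natrM.
  by rewrite invfM mulrA mulfV ?mul1r // pnatr_eq0 -lt0n.
rewrite -[leLHS]addr0 lerD //; last by rewrite sumr_ge0.
rewrite !big_nat ler_sum // => i /andP[Mi iM].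
by rewrite lef_pV2 ?posrE ?ltr0n ?ler_nat; lia.
Qed.

Section RegularTail2.
Variables (R : realType) (a : nat -> R) (C : R).
Hypothesis a_gt0 : forall k, 0 < a k.
Hypothesis a_nonincr : forall j k, (j <= k)%N -> a k <= a j.
Hypothesis psum_ub : forall k, (0 < k)%N -> psum a k <= C * (k%:R * a k).

(** Logarithmic growth yields only a factor 1 / n for a ratio 2^n of indices; this suffices because
    n is fixed, as large as desired, before k. *)
Lemma psum_dyadic n m k : (0 < m)%N -> (0 < n)%N -> (m * 2 ^ n <= k)%N ->
  psum a m <= 2 * C ^+ 2 / n%:R * (k%:R * a k).
Proof.
move=> m0 n0 mk; have p0 : (0 < 2 ^ n)%N by rewrite expn_gt0.
have mk' : (m <= k)%N by nia.
have k0 : (0 < k)%N by lia.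
have n0' : 0 < n%:R :> R by rewrite ltr0n.
have C1 := psum_const_ge1 a_gt0 a_nonincr psum_ub.
have := psum_harmonic a_gt0 a_nonincr psum_ub m0 mk'.
move/(le_trans (ler_wpM2l (psum_ge0 a_gt0 m) (harmonic_dyadic R m0 mk))) => h1.
have h2 : C * psum a k <= C * (C * (k%:R * a k)).
  by rewrite ler_pM2l ?psum_ub // (lt_le_trans _ C1).
have -> : 2 * C ^+ 2 / n%:R * (k%:R * a k) = C * (C * (k%:R * a k)) * (2 / n%:R) by ring.
have h3 := le_trans h1 h2.
rewrite -ler_pdivrMr ?divr_gt0 //; apply: le_trans h3.
by rewrite invf_div.
Qed.

Lemma regular_ends n m k : (0 < m)%N -> (0 < n)%N -> (m * 2 ^ n <= k)%N ->
  \sum_(0 <= j < m) a j * a (k - j)%N <= 4 * C ^+ 3 / n%:R * (k%:R * a k ^+ 2).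
Proof.
move=> m0 n0 mk; have p0 : (2 <= 2 ^ n)%N by rewrite -{1}(expn1 2) leq_exp2l.
have C1 := psum_const_ge1 a_gt0 a_nonincr psum_ub.
have C0 : 0 < C by exact: lt_le_trans C1.
apply: le_trans (_ : psum a m * (2 * C * a k) <= _).
  rewrite /psum big_distrl /= !big_nat ler_sum // => j /andP[_ jm].
  by rewrite ler_pM2l // (regular_half a_gt0 a_nonincr psum_ub); nia.
apply: le_trans (ler_wpM2r _ (psum_dyadic m0 n0 mk)) _.
  by rewrite !mulr_ge0 // ltW.
by rewrite le_eqVlt; apply/orP; left; apply/eqP; ring.
Qed.

End RegularTail2.

(** * Lower bound on the hazard index and regular partial sums of the tail *)

Section TailBounds.
Variables (R : realType) (rho : R) (q Q : nat -> R).
Hypothesis S : tail_system rho q Q.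
Let w k := k%:R * q k.
Let rho0 : 0 < rho. Proof. exact: ts_rho S. Qed.
Let q0 : q 0%N = 0 := ts_q0 S.
Let Q0 : Q 0%N = 1 := ts_Q0 S.
Let Qp k : 0 < Q k := ts_Q S k.
Let qp k : 0 <= q k := q_ge0 S k.
Let wp k : 0 <= w k := kq_ge0 S k.
Let Qle j k : (j <= k)%N -> Q k <= Q j := @Q_nonincr _ _ _ _ S j k.

Lemma q1_ge_half : 2^-1 <= q 1%N.
Proof.
have h1 := ts_QS S 0; have h2 := ts_qQ S (ltnSn 0).
have h3 : conv q Q 1 = q 1%N.
  by rewrite /conv !big_ord_recl big_ord0 /= q0 Q0 mul0r add0r addr0 mulr1.
have : 0 <= rho * Q 1%N ^+ 2 by rewrite mulr_ge0 ?sqr_ge0 // ltW.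
by rewrite Q0 in h1; lra.
Qed.

Lemma conv_QQ_S k : conv Q Q k.+1 = conv Q Q k - rho * Q k.+1 ^+ 2.
Proof. by rewrite (conv_QS S) [conv Q q _]convC (ts_qQ S) //; ring. Qed.

(* At the first failure of the bound, [w i - c * Q i] is nonnegative on [1, k), and
   the identities for [conv w q] and [conv w Q] make its sums against [q] and [Q] too
   small, contradicting the term [q 1 * Q (k - 1)] of [conv w Q]. *)
Lemma kq_lb : exists2 c, 0 < c & forall k, (0 < k)%N -> c * Q k <= w k.
Proof.
(* The first bound settles k = 1. The second gives c (1 + rho) <= 1/8, so that at a failure conv w Q
   <= Q k / 8 + conv w Q / 4, against conv w Q >= Q k / 2. *)
pose c := Num.min (q 1%N / Q 1%N) (8 * (1 + rho))^-1.
have r0 := rho0.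
have r2 : 0 < 1 + rho by lra.
have r1 : 0 < 8 * (1 + rho) by lra.
have c0 : 0 < c by rewrite lt_min divr_gt0 ?invr_gt0 //; exact: ts_q S 0.
have c8 : c * (1 + rho) <= 8^-1.
  have : c <= (8 * (1 + rho))^-1 by rewrite ge_min lexx orbT.
  rewrite -(ler_pM2r r2 c).
  by move=> /le_trans; apply; rewrite le_eqVlt; apply/orP; left; apply/eqP; field; rewrite gt_eqF.
have c8' : c <= 8^-1.
  apply: le_trans c8; rewrite ler_peMr ?ltW //; lra.
exists c => // k; elim/ltn_ind: k => k IH k0.
have [k1|k1] := leqP k 1.
  have -> : k = 1%N by lia.
  have : c <= q 1%N / Q 1%N by rewrite ge_min lexx.
  by rewrite ler_pdivlMr // /w mul1r.
rewrite leNgt; apply/negP => wk.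
have kp : 0 < k%:R :> R by rewrite ltr0n.
have Qk1 : Q k <= 1 by exact: Q_le1 S k.
pose E := \sum_(1 <= i < k) (w i - c * Q i) * q (k - i)%N.
pose F := \sum_(1 <= i < k) (w i - c * Q i) * Q (k - i)%N.
have wi i : (1 <= i < k)%N -> 0 <= w i - c * Q i.
  by move=> /andP[i0 ik]; rewrite subr_ge0 IH.
have hE : E <= c * (1 + rho) * q k.
  have := conv_defect_q S c k1; rewrite /=.
  case: k {IH} k1 k0 wk kp Qk1 @E @F wi => // k k1 _ wk kp Qk1 E F wi.
  rewrite conv_split /= q0 Q0 !(mulr0, mul0r, subr0, addr0, mulr1).
  have -> : \sum_(1 <= i < k.+1) (c * Q i - i%:R * q i) * q (k.+1 - i)%N = - E.
    by rewrite /E -sumrN; apply: eq_bigr => i _; rewrite /w; ring.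
  rewrite -/(w k.+1) => h.
  have h1 : 0 <= (c * Q k.+1 - w k.+1) * (1 + rho * Q k.+1).
    rewrite mulr_ge0 //; first by rewrite subr_ge0 ltW.
    by rewrite addr_ge0 // mulr_ge0 // ltW.
  have h2 : rho * w k.+1 * q k.+1 / 2 <= c * rho * q k.+1.
    have : w k.+1 <= c.
      apply: le_trans (ltW wk) _; rewrite -{2}(mulr1 c) ler_pM2l //.
    move=> h3; have : rho * q k.+1 * w k.+1 <= rho * q k.+1 * c.
      by rewrite ler_wpM2l // mulr_ge0 // ltW.
    have : 0 <= rho * q k.+1 * w k.+1 by rewrite !mulr_ge0 // ltW.
    lra.
  move: h h1 h2; rewrite !mulrDr !mulrDl; lra.
have hF : F <= c * (1 + rho) * Q k.
  (* For 1 <= i < k the claim already holds at k - i, so c Q (k - i) <= w (k - i) <= k q (k - i):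
     the weight Q is traded for q. *)
  have : c * F <= k%:R * E.
    rewrite /E /F !mulr_sumr !big_nat ler_sum // => i ik.
    rewrite mulrCA [leRHS]mulrCA ler_wpM2l ?wi //.
    have /andP[i0 ik'] := ik; have ki : (0 < k - i)%N by rewrite subn_gt0.
    apply: le_trans (IH (k - i)%N _ ki) _; first by rewrite ltn_subrL i0 k0.
    by rewrite ler_wpM2r // ler_nat leq_subr.
  have h1 : k%:R * E <= k%:R * (c * (1 + rho) * q k) by rewrite ler_pM2l.
  move=> h; rewrite -(ler_pM2l c0); apply: le_trans h _.
  apply: le_trans h1 _; have -> : k%:R * (c * (1 + rho) * q k) = c * (1 + rho) * w k.
    by rewrite /w; ring.
  have -> : c * (c * (1 + rho) * Q k) = c * (1 + rho) * (c * Q k) by ring.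
  rewrite ler_wpM2l ?(ltW wk) // mulr_ge0 ?ltW //; lra.
have hwQ : conv w Q k <= c * (1 + rho) * Q k + c * conv Q Q k.
  case: k {IH hE E} k1 k0 wk kp Qk1 @F wi hF => // k k1 _ wk kp Qk1 F wi hF.
  rewrite !conv_split Q0 !mulr1 mul1r /w mul0r mul0r add0r.
  have -> : \sum_(1 <= i < k.+1) i%:R * q i * Q (k.+1 - i)%N =
      F + c * \sum_(1 <= i < k.+1) Q i * Q (k.+1 - i)%N.
    by rewrite /F mulr_sumr -big_split; apply: eq_bigr => i _; rewrite /w /=; ring.
  have := wk; rewrite /w; have : 0 < c * Q k.+1 by rewrite mulr_gt0.
  rewrite !mulrDr; lra.
have hQQ : conv Q Q k <= 2 * conv w Q k.
  rewrite (conv_kq_Q S) //.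
  have -> : conv Q Q k = conv Q Q k.-1 - rho * Q k ^+ 2.
    by case: k {IH hE E hwQ wk kp Qk1 F wi hF} k1 k0 => // k _ _; exact: conv_QQ_S.
  have ? : 0 <= rho * Q k ^+ 2 by rewrite mulr_ge0 ?sqr_ge0 // ltW.
  have ? : 0 <= k%:R * rho * Q k ^+ 2 by rewrite -mulrA mulr_ge0.
  lra.
have h1 : 2^-1 * Q k <= conv w Q k.
  apply: le_trans (conv_ge_term wp (fun j => ltW (Qp j)) (ltnW k1)).
  rewrite /w mul1r; apply: ler_pM; rewrite ?invr_ge0 ?q1_ge_half //; first exact: ltW.
  by rewrite Qle // leq_subr.
have Qk := Qp k.
have : c * conv Q Q k <= 8^-1 * (2 * conv w Q k).
  apply: le_trans (_ : c * (2 * conv w Q k) <= _); first by rewrite ler_pM2l.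
  rewrite ler_wpM2r // mulr_ge0 //; apply: le_trans h1; rewrite mulr_ge0 ?ltW //.
have : c * (1 + rho) * Q k <= 8^-1 * Q k by rewrite ler_wpM2r // ltW.
lra.
Qed.

Lemma sum_q k : \sum_(i < k.+1) q i = 1 - Q k.
Proof.
elim: k => [|k IH]; first by rewrite big_ord1 q0 Q0 subrr.
by rewrite big_ord_recr IH /= (ts_QS S k); ring.
Qed.

(* [q] has total mass [1 - Q k] on [0, k], so [q * Q = Q + rho * Q^2] evaluates
   the sum of [q i * (Q (k - i) - Q k)]; then [q i >= c * Q k / k]. *)
Lemma psum_Q_ub : exists C, forall k, (0 < k)%N -> psum Q k <= C * (k%:R * Q k).
Proof.
have [c c0 wc] := kq_lb; exists (1 + (1 + rho) / c) => k k0.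
have kp : 0 < k%:R :> R by rewrite ltr0n.
have Qk := Qp k.
have e1 : \sum_(i < k.+1) q i * (Q (k - i)%N - Q k) = (1 + rho) * Q k ^+ 2.
  have -> : \sum_(i < k.+1) q i * (Q (k - i)%N - Q k) =
    conv q Q k - (\sum_(i < k.+1) q i) * Q k.
    by rewrite /conv big_distrl /= -sumrB; apply: eq_bigr => i _; ring.
  by rewrite sum_q (ts_qQ S) //; ring.
have e2 : \sum_(i < k.+1) (Q (k - i)%N - Q k) = psum Q k - k%:R * Q k.
  rewrite (reindex_inj rev_ord_inj) /= -(big_mkord xpredT (fun i => Q (k - (k.+1 - i.+1))%N - Q k)).
  rewrite big_nat_recr //= subSS subnn subn0 subrr addr0.
  rewrite sumrB sumr_const_nat subn0 mulr_natl /psum; congr (_ - _).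
  by apply: eq_big_nat => i /andP[_ ik]; congr Q; lia.
have : c * Q k * (psum Q k - k%:R * Q k) <= k%:R * ((1 + rho) * Q k ^+ 2).
  rewrite -e1 -e2 !mulr_sumr ler_sum // => -[i /= ik] _.
  rewrite mulrA; case: i ik => [|i] ik; first by rewrite subn0 subrr !mulr0.
  rewrite ler_wpM2r ?subr_ge0 ?Qle ?leq_subr //.
  apply: le_trans (_ : c * Q i.+1 <= _); first by rewrite ler_pM2l // Qle.
  by apply: le_trans (wc _ _) _ => //; rewrite ler_wpM2r // ler_nat.
have -> : k%:R * ((1 + rho) * Q k ^+ 2) = c * Q k * ((1 + rho) / c * (k%:R * Q k)).
  by field; rewrite gt_eqF.
rewrite ler_pM2l ?mulr_gt0 //; lra.
Qed.

End TailBounds.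

(** * Near-extremal points of the hazard index *)

Definition harmonic_sum (R : realType) (k : nat) : R :=
  \sum_(0 <= l < k) l.+1%:R^-1.

Section Extremal.
Variables (R : realType) (rho c K C : R) (q Q : nat -> R).
Hypothesis S : tail_system rho q Q.
Let w k := k%:R * q k.
Let rho0 : 0 < rho := ts_rho S.
Let q0 : q 0%N = 0 := ts_q0 S.
Let Q0 : Q 0%N = 1 := ts_Q0 S.
Let Qp k : 0 < Q k := ts_Q S k.
Let qp k : 0 <= q k := q_ge0 S k.
Let Qle j k : (j <= k)%N -> Q k <= Q j := @Q_nonincr _ _ _ _ S j k.
Hypothesis c0 : 0 < c.
Hypothesis K0 : 0 < K.
Hypothesis w_ge : forall k, (0 < k)%N -> c * Q k <= w k.
Hypothesis w_le : forall k, w k <= K * Q k.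
Hypothesis psum_ub : forall k, (0 < k)%N -> psum Q k <= C * (k%:R * Q k).

Definition hazard k : R := k%:R * q k / Q k.
Definition defect k j : R := hazard k * Q j - j%:R * q j.
Local Notation h := (@harmonic_sum R).

(* [sg = 1] makes [k] a near-maximum of the hazard index over [1..k],
   [sg = -1] a near-minimum. *)
Definition extremal (sg eta : R) k := forall j, (0 < j <= k)%N ->
  sg * (hazard j - hazard k) <= eta * (h k - h j).

Let C1 : 1 <= C := psum_const_ge1 Qp Qle psum_ub.
Let C0 : 0 < C := lt_le_trans ltr01 C1.

Lemma harmonic_sumS k : h k.+1 = h k + k.+1%:R^-1.
Proof. by rewrite /harmonic_sum big_nat_recr. Qed.

Lemma harmonic_sum_diff j k : (j <= k)%N -> 0 <= h k - h j <= (k - j)%:R / j.+1%:R.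
Proof.
move=> /subnK <-; elim: (k - j)%N => [|n IH].
  by rewrite !add0n subnn mul0r subrr lexx.
rewrite addSn harmonic_sumS subSn ?leq_addl //= -[(n + j - j).+1%:R]natr1 mulrDl mul1r.
have e0 : 0 <= (n + j).+1%:R^-1 :> R by rewrite invr_ge0.
have e1 : (n + j).+1%:R^-1 <= j.+1%:R^-1 :> R.
  by rewrite lef_pV2 ?posrE ?ltr0n // ler_nat ltnS leq_addl.
by move: IH => /andP[? ?]; rewrite addrAC addr_ge0 //= lerD.
Qed.

(** Passing from k to k + 1 raises every gap by 1 / (k + 1), which adds psum Q (k + 1) / (k + 1) <=
    C Q k. *)
Lemma sum_harmonic_gap k : \sum_(0 <= j < k) Q j * (h k - h j) <= C * psum Q k.
Proof.
elim: k => [|k IH]; first by rewrite /psum !big_geq // mulr0.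
rewrite big_nat_recr //= harmonic_sumS.
have -> : \sum_(0 <= i < k) Q i * (h k + k.+1%:R^-1 - h i) =
   \sum_(0 <= i < k) Q i * (h k - h i) + psum Q k / k.+1%:R.
  by rewrite /psum big_distrl -big_split /=; apply: eq_bigr => i _; ring.
have h1 : psum Q k.+1 / k.+1%:R <= C * Q k.
  rewrite ler_pdivrMr ?ltr0n //; apply: le_trans (psum_ub _) _ => //.
  by rewrite -mulrA ler_pM2l // mulrC ler_wpM2r // Qle.
rewrite (addrC (h k)) addrK -addrA -mulrDl -psumS.
by rewrite [in leRHS]psumS mulrDr lerD.
Qed.

Lemma hazard_ub k : hazard k <= K.
Proof. by rewrite /hazard ler_pdivrMr // w_le. Qed.

Lemma hazard_ge0 k : 0 <= hazard k.
Proof. by rewrite /hazard divr_ge0 ?mulr_ge0 // ltW. Qed.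

Lemma hazardE k : hazard k * Q k = k%:R * q k.
Proof. by rewrite /hazard divfK // gt_eqF. Qed.

Lemma hazard_tail_ratio k : Q k = Q k.+1 * (1 + hazard k.+1 / k.+1%:R).
Proof.
rewrite (ts_QS S k) mulrDr mulr1; congr (_ + _).
by rewrite mulrA [Q _ * _]mulrC hazardE mulrAC mulfV ?mul1r // pnatr_eq0.
Qed.

Lemma defect_hazard k j : defect k j = Q j * (hazard k - hazard j).
Proof. by rewrite /defect -(hazardE j); ring. Qed.

Lemma defect_ub k j : `|defect k j| <= K * Q j.
Proof.
have := hazard_ub k; have := hazard_ub j; have := hazard_ge0 k; have := hazard_ge0 j.
move=> ? ? ? ?; rewrite defect_hazard normrM gtr0_norm // mulrC ler_wpM2r //.
  exact: ltW.
rewrite ler_norml; apply/andP; split; lra.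
Qed.

Let B := 4 * K * C ^+ 2 * (1 + C).

(** For 2 j >= k the gap is at most (k - j) / (j + 1), and its factor k - j turns q (k - j) into w
    (k - j) <= K Q (k - j). For 2 j < k one has q (k - j) = O(Q k / k), and [sum_harmonic_gap] sums
    the gaps. The order Q k ^ 2 is that of the least weight Q k / k times k Q k. *)
Lemma sum_penalty k : (0 < k)%N ->
  \sum_(1 <= j < k) Q j * (h k - h j) * q (k - j)%N <= B * Q k ^+ 2.
Proof.
move=> k0; have kp : 0 < k%:R :> R by rewrite ltr0n.
have Qk := Qp k.
have step j : (1 <= j < k)%N -> Q j * (h k - h j) * q (k - j)%N <=
    4 * K * C / k%:R * Q k * (Q (k - j)%N + Q j * (h k - h j)).
  move=> /andP[j1 jk]; have kj0 : (0 < k - j)%N by rewrite subn_gt0.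
  have kjp : 0 < (k - j)%:R :> R by rewrite ltr0n.
  have /andP[hd0 hd1] := harmonic_sum_diff (ltnW jk).
  have Qj := Qp j; have Qkj := Qp (k - j)%N.
  have wkj := w_le (k - j)%N; rewrite /w in wkj.
  have X0 : 0 <= 4 * K * C / k%:R * Q k by rewrite !mulr_ge0 ?invr_ge0 // ltW.
  have [kj|kj] := leqP k j.*2.
    have Qjk : Q j <= 2 * C * Q k.
      by apply: (regular_half Qp Qle psum_ub) => //; exact: ltnW.
    apply: le_trans (_ : 4 * K * C / k%:R * Q k * Q (k - j)%N <= _); last first.
      by rewrite ler_wpM2l // lerDl mulr_ge0 // ltW.
    apply: le_trans (_ : Q j * ((k - j)%:R / j.+1%:R) * q (k - j)%N <= _).
      by rewrite ler_wpM2r // ler_wpM2l // ltW.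
    have -> : Q j * ((k - j)%:R / j.+1%:R) * q (k - j)%N =
       j.+1%:R^-1 * (Q j * ((k - j)%:R * q (k - j)%N)) by ring.
    have -> : 4 * K * C / k%:R * Q k * Q (k - j)%N =
       (2 / k%:R) * (2 * C * Q k * (K * Q (k - j)%N)) by ring.
    apply: ler_pM; first by rewrite invr_ge0.
    - by rewrite mulr_ge0 ?(ltW Qj) // mulr_ge0.
    - rewrite -[leLHS]mul1r ler_pdivrMr ?ltr0n // mulrAC ler_pdivlMr // mul1r.
      rewrite -natrM ler_nat; by move: kj; clear; lia.
    - by apply: ler_pM => //; [exact: ltW | rewrite mulr_ge0].
  have kj' : (k <= (k - j).*2)%N by move: kj; clear; lia.
  have Qjk : Q (k - j)%N <= 2 * C * Q k.
    by apply: (regular_half Qp Qle psum_ub) => //; exact: leq_subr.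
  apply: le_trans (_ : 4 * K * C / k%:R * Q k * (Q j * (h k - h j)) <= _); last first.
    by rewrite ler_wpM2l // lerDr ltW.
  rewrite mulrC ler_wpM2r ?mulr_ge0 ?(ltW Qj) //.
  have -> : 4 * K * C / k%:R * Q k = (2 / k%:R) * (K * (2 * C * Q k)) by ring.
  have -> : q (k - j)%N = (k - j)%:R^-1 * ((k - j)%:R * q (k - j)%N).
    by rewrite mulKf // gt_eqF.
  apply: ler_pM; rewrite ?invr_ge0 ?mulr_ge0 //.
    rewrite -[leLHS]mul1r ler_pdivrMr // mulrAC ler_pdivlMr // mul1r.
    rewrite -natrM ler_nat; by move: kj'; clear; lia.
  by apply: le_trans wkj _; rewrite ler_pM2l.
apply: le_trans (_ : \sum_(1 <= j < k)
    4 * K * C / k%:R * Q k * (Q (k - j)%N + Q j * (h k - h j)) <= _).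
  by rewrite !big_nat ler_sum // => j; exact: step.
rewrite -mulr_sumr big_split /=.
have e1 : \sum_(1 <= i < k) Q (k - i)%N <= psum Q k.
  rewrite big_nat_rev /= /psum (big_ltn k0).
  have -> : \sum_(1 <= i < k) Q (k - (1 + k - i.+1))%N = \sum_(1 <= i < k) Q i.
    by apply: eq_big_nat => i /andP[i0 ik]; congr Q; move: i0 ik; clear; lia.
  by rewrite lerDr ltW.
have e2 : \sum_(1 <= i < k) Q i * (h k - h i) <= C * psum Q k.
  apply: le_trans (sum_harmonic_gap k); rewrite [leRHS](big_ltn k0) lerDr.
  by rewrite mulr_ge0 ?(ltW (Qp _)) //; have /andP[] := harmonic_sum_diff (leq0n k).
have e3 : (1 + C) * psum Q k <= (1 + C) * (C * (k%:R * Q k)).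
  by rewrite ler_wpM2l ?psum_ub //; have := C0; lra.
apply: le_trans (_ : 4 * K * C / k%:R * Q k * ((1 + C) * (C * (k%:R * Q k))) <= _).
  rewrite ler_wpM2l //; first by rewrite !mulr_ge0 ?invr_ge0 // ltW.
  by apply: le_trans e3; rewrite mulrDl mul1r lerD.
rewrite le_eqVlt; apply/orP; left; apply/eqP; rewrite /B; field; exact: lt0r_neq0.
Qed.

(* Near-extremality makes [defect k] one-signed up to the penalty, so its [l^1] norm
   against [q] is nearly its sum against [q], which [conv_defect_q] evaluates. *)
Lemma extremal_sum_defect sg eta k : sg = 1 \/ sg = -1 -> 0 <= eta -> (1 < k)%N ->
  extremal sg eta k ->
  \sum_(1 <= j < k) `|defect k j| <=
    ((1 + rho) * K ^+ 2 / c) + (2 * B / c) * (eta * (k%:R * Q k)).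
Proof.
move=> sgE eta0 k1 ext; have k0 := ltnW k1.
have kp : 0 < k%:R :> R by rewrite ltr0n.
have Qk := Qp k; have rp := rho0.
have e1 : \sum_(1 <= j < k) `|defect k j| * q (k - j)%N <=
   sg * (\sum_(1 <= j < k) defect k j * q (k - j)%N) +
   2 * eta * (\sum_(1 <= j < k) Q j * (h k - h j) * q (k - j)%N).
  rewrite !mulr_sumr -big_split /= !big_nat ler_sum // => j /andP[j1 jk].
  have := ext j; rewrite j1 ltnW // => /(_ isT) => hj.
  have /andP[hd0 _] := harmonic_sum_diff (ltnW jk).
  rewrite [leRHS](_ : _ = (sg * defect k j + 2 * (eta * (Q j * (h k - h j)))) * q (k - j)%N); last by ring.
  rewrite ler_wpM2r //.
  have h1 : - (sg * defect k j) <= eta * (Q j * (h k - h j)).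
    rewrite defect_hazard.
    have -> : - (sg * (Q j * (hazard k - hazard j))) = Q j * (sg * (hazard j - hazard k)) by ring.
    have -> : eta * (Q j * (h k - h j)) = Q j * (eta * (h k - h j)) by ring.
    by rewrite ler_pM2l.
  have h2 : 0 <= eta * (Q j * (h k - h j)) by rewrite mulr_ge0 // mulr_ge0 // ltW.
  case: sgE h1 => -> h1; rewrite ler_norml; apply/andP; split; lra.
(* Since [defect k k] vanishes, [conv_defect_q] leaves only its quadratic term, which is O(q k); the
   j = 0 term of the convolution is [hazard k * q k]. *)
have e2 : `|\sum_(1 <= j < k) defect k j * q (k - j)%N| <= (1 + rho) * K * q k.
  have := conv_defect_q S (hazard k) k1; rewrite /= -/(defect k).
  have dkk : hazard k * Q k - k%:R * q k = 0 by rewrite hazardE subrr.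
  rewrite dkk mul0r sub0r.
  have -> : conv (defect k) q k =
      hazard k * q k + \sum_(1 <= j < k) defect k j * q (k - j)%N.
    case: (k) k0 => // m _; rewrite conv_split q0 mulr0 addr0.
    by rewrite /defect Q0 mul0r subr0 mulr1.
  have := hazard_ub k; have := hazard_ge0 k; have := qp k => qk hk0 hk1 e.
  have wk0 : 0 <= rho * (k%:R * q k) * q k by rewrite !mulr_ge0 // ltW.
  have wk1 : rho * (k%:R * q k) * q k <= rho * K * q k.
    rewrite ler_wpM2r // ler_wpM2l ?(ltW rho0) //; apply: le_trans (w_le k) _.
    by rewrite ger_pMr // (Q_le1 S).
  have hq0 : 0 <= hazard k * q k by rewrite mulr_ge0.
  have hq1 : hazard k * q k <= K * q k by rewrite ler_wpM2r.
  rewrite ler_norml !mulrDl mul1r; apply/andP; split; lra.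
have e3 := sum_penalty k0.
have e4 : k%:R * q k <= K * Q k by exact: w_le.
(* Every weight q (k - j) is at least c Q k / k, so the weighted sum controls the plain l^1 norm. *)
have e5 : (c / k%:R * Q k) * (\sum_(1 <= j < k) `|defect k j|) <=
    \sum_(1 <= j < k) `|defect k j| * q (k - j)%N.
  rewrite mulr_sumr !big_nat ler_sum // => j /andP[j1 jk].
  have kj0 : (0 < k - j)%N by rewrite subn_gt0.
  rewrite mulrC ler_wpM2l // mulrAC ler_pdivrMr //.
  apply: le_trans (_ : c * Q (k - j)%N <= _); first by rewrite ler_pM2l // Qle ?leq_subr.
  apply: le_trans (w_ge kj0) _; rewrite /w mulrC ler_wpM2l // ler_nat leq_subr //.
have e6 : sg * (\sum_(1 <= j < k) defect k j * q (k - j)%N) <= (1 + rho) * K * q k.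
  by case: sgE => ->; rewrite ?mul1r ?mulN1r; move: e2; rewrite ler_norml => /andP[]; lra.
have X0 : 0 < c / k%:R * Q k by rewrite mulr_gt0 // divr_gt0.
rewrite -(ler_pM2l X0); apply: le_trans e5 _; apply: le_trans e1 _.
rewrite mulrDr; apply: lerD.
  apply: le_trans e6 _.
  have -> : c / k%:R * Q k * ((1 + rho) * K ^+ 2 / c) =
     (1 + rho) * K * (K * Q k / k%:R) by field; rewrite !gt_eqF.
  rewrite ler_wpM2l //; first by rewrite mulr_ge0 ?ltW //; lra.
  by rewrite ler_pdivlMr // mulrC.
have -> : c / k%:R * Q k * (2 * B / c * (eta * (k%:R * Q k))) =
    2 * eta * (B * Q k ^+ 2) by field; rewrite !gt_eqF.
by rewrite ler_wpM2l // mulr_ge0.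
Qed.

End Extremal.

(** * Coefficients of a power of 1 - x *)

Section Model.
Variables (R : realType) (g : R).
Hypothesis g0 : 0 < g.
Hypothesis g1 : g < 1.

(* Coefficients of (1 - x)^(g - 1). *)
Definition model (k : nat) : R := \prod_(0 <= i < k) (1 - g / i.+1%:R).

Lemma modelS k : model k.+1 = model k * (1 - g / k.+1%:R).
Proof. by rewrite /model big_nat_recr. Qed.

Let factor_gt0 k : 0 < 1 - g / k.+1%:R.
Proof.
rewrite subr_gt0 ltr_pdivrMr ?ltr0n // mul1r (lt_le_trans g1) //.
by rewrite ler1n.
Qed.

Lemma model_gt0 k : 0 < model k.
Proof. by rewrite /model prodr_gt0 // => i _; exact: factor_gt0. Qed.

Lemma model_nonincr j k : (j <= k)%N -> model k <= model j.
Proof.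
move=> /subnK <-; elim: (k - j)%N => [|n IH] //.
rewrite addSn modelS; apply: le_trans IH; rewrite ger_pMr ?model_gt0 //.
by rewrite gerBl divr_ge0 // ltW.
Qed.

Lemma model_rec k : k.+1%:R * model k.+1 = (k.+1%:R - g) * model k.
Proof.
by rewrite modelS mulrCA mulrBr mulr1 mulrCA mulfV ?pnatr_eq0 // mulr1 mulrC.
Qed.

(** Summed form of [model_rec]; it gives the model the same regularity of partial sums as Q, with
    constant 1 / (1 - g). *)
Lemma psum_model k : (1 - g) * psum model k = k%:R * model k.
Proof.
elim: k => [|k IH]; first by rewrite /psum big_geq // mulr0 mul0r.
by rewrite psumS mulrDr IH model_rec -natr1; ring.
Qed.

Lemma psum_model_ub k : (0 < k)%N -> psum model k <= (1 - g)^-1 * (k%:R * model k).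
Proof. by rewrite -psum_model mulKf // gt_eqF // subr_gt0. Qed.

(** The square of (1 - x)^(g - 1) is (1 - x)^((2 g - 1) - 1), so its coefficients obey [model_rec]
    with 2 g - 1 in place of g. *)
Lemma conv_model_rec k :
  k.+1%:R * conv model model k.+1 = (k.+2%:R - 2 * g) * conv model model k.
Proof.
rewrite -conv_weight /conv big_ord_recl /= mul0r mul0r add0r.
have e (i : 'I_k.+1) :
  (bump 0 i)%:R * model (bump 0 i) * model (k.+1 - bump 0 i) =
  (1 - g) * (model i * model (k - i)%N) + i%:R * model i * model (k - i)%N.
  by rewrite /bump /= add1n model_rec subSS -[i.+1%:R]natr1; ring.
under eq_bigr do rewrite e.
rewrite big_split /= -mulr_sumr mulrDr.
have := conv_weight model k; rewrite /conv => ->.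
by rewrite -[k.+2%:R]natr1 -[k.+1%:R]natr1; ring.
Qed.

Lemma conv_modelE k :
  conv model model k = \prod_(0 <= i < k) (1 - (2 * g - 1) / i.+1%:R).
Proof.
elim: k => [|k IH].
  by rewrite /conv big_ord1 /= /model !big_geq // mulr1.
rewrite big_nat_recr //= -IH.
have k0 : k.+1%:R != 0 :> R by rewrite pnatr_eq0.
apply: (mulfI k0); rewrite conv_model_rec mulrCA mulrBr mulr1 mulrCA mulfV //.
by rewrite -[k.+2%:R]natr1; ring.
Qed.

End Model.

(** * Stepwise comparison of the tail with the model *)

Section Comparison.
Variables (R : realType) (rho g : R) (q Q : nat -> R).
Hypothesis S : tail_system rho q Q.
Let Qp k : 0 < Q k := ts_Q S k.
Hypothesis g0 : 2^-1 < g.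
Hypothesis g1 : g < 1.

Let gp : 0 < g. Proof. by apply: lt_trans g0; rewrite invr_gt0. Qed.
Local Notation hz := (hazard q Q).
Local Notation m_ := (model g).
Let mp k : 0 < m_ k := model_gt0 g1 k.

(** Logarithmic error of one step: the first term pays for replacing hz l by H, the second absorbs
    the quadratic loss in (1 - g / l) (1 + g / l). *)
Let err H l := `|H - hz l| / l%:R + 2 / l%:R ^+ 2.

Let hz0 k : 0 <= hz k := hazard_ge0 S k.

Let QS k : Q k = Q k.+1 * (1 + hz k.+1 / k.+1%:R) := hazard_tail_ratio S k.

(** Going from l - 1 to l multiplies m / Q by (1 - g / l) (1 + hz l / l), which is at least exp (-
    err H l); a gap between g and H only helps. Starting at j > 0 ensures l >= 2, which the
    quadratic term uses. *)
Lemma compare_lower H j k : g <= H -> (0 < j)%N -> (j <= k)%N ->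
  m_ j * Q k <= Q j * m_ k * expR (\sum_(j.+1 <= l < k.+1) err H l).
Proof.
move=> gH j0 /subnK <-; elim: (k - j)%N => [|n IH].
  by rewrite add0n big_geq // expR0 mulr1 mulrC.
rewrite addSn big_nat_recr //=; last by rewrite ltnS leq_addl.
set l := (n + j).+1 in IH *; set s := \sum_(_ <= _ < _) _ in IH *.
have l2 : (2 <= l)%N by rewrite /l ltnS addn_gt0 j0 orbT.
have lp : 0 < l%:R :> R by rewrite ltr0n.
have l2' : 2 <= l%:R :> R by rewrite ler_nat.
have gl : g < l%:R by rewrite (lt_trans g1) // ltr1n.
have hl : 0 < 1 + hz l / l%:R by rewrite ltr_pwDl // divr_ge0 // hz0.
rewrite -(ler_pM2r hl) -[leLHS]mulrA -QS expRD.
apply: le_trans IH _.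
rewrite modelS -/l.
set d := `|H - hz l| / l%:R.
have d0 : 0 <= d by rewrite divr_ge0.
have key : 1 <= (1 - g / l%:R) * ((1 + d) * (1 + 2 / l%:R ^+ 2)) * (1 + hz l / l%:R).
  have h1 : 1 + g / l%:R <= (1 + hz l / l%:R) * (1 + d).
    have : g / l%:R <= hz l / l%:R + d.
      rewrite /d -mulrDl ler_pM2r ?invr_gt0 //; have := ler_norm (H - hz l); lra.
    have : 0 <= hz l / l%:R * d by rewrite mulr_ge0 // divr_ge0 ?hz0.
    rewrite mulrDl mul1r mulrDr mulr1; lra.
  have h2 : 0 < 1 - g / l%:R by rewrite subr_gt0 ltr_pdivrMr // mul1r.
  have h3 : 0 < 1 + 2 / l%:R ^+ 2 :> R by rewrite addr_gt0 // divr_gt0 // exprn_gt0.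
  apply: le_trans (_ : (1 - g / l%:R) * (1 + 2 / l%:R ^+ 2) * (1 + g / l%:R) <= _).
    set y := l%:R^-1; have y0 : 0 < y by rewrite invr_gt0.
    have y1 : y <= 2^-1 by rewrite lef_pV2 ?posrE.
    rewrite -/y (_ : 2 / l%:R ^+ 2 = 2 * y ^+ 2); last by rewrite exprVn.
    have -> : (1 - g * y) * (1 + 2 * y ^+ 2) * (1 + g * y) =
       1 + y ^+ 2 * (2 - g ^+ 2 - 2 * (g * y) ^+ 2) by ring.
    rewrite lerDl mulr_ge0 ?sqr_ge0 //.
    have : g ^+ 2 <= 1 by rewrite expr_le1 // ltW.
    have : (g * y) ^+ 2 <= 2^-1.
      have : g * y <= 2^-1 by rewrite -[leRHS]mul1r ler_pM // ltW.
      have : 0 <= g * y by rewrite mulr_ge0 // ltW.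
      move=> ? ?; apply: le_trans (_ : 2^-1 ^+ 2 <= _); last by lra.
      by rewrite lerXn2r ?nnegrE // invr_ge0.
    lra.
  have -> : (1 - g / l%:R) * ((1 + d) * (1 + 2 / l%:R ^+ 2)) * (1 + hz l / l%:R) =
     (1 - g / l%:R) * (1 + 2 / l%:R ^+ 2) * ((1 + hz l / l%:R) * (1 + d)) by ring.
  by rewrite ler_wpM2l // mulr_ge0 // ltW.
have e1 : (1 + d) * (1 + 2 / l%:R ^+ 2) <= expR (err H l).
  by rewrite /err expRD ler_pM ?expR_ge1Dx // addr_ge0 // divr_ge0 // exprn_ge0.
have P0 : 0 <= Q j * m_ (n + j) * expR s by rewrite !mulr_ge0 ?expR_ge0 // ltW.
rewrite -[leLHS]mulr1.
have -> : Q j * (m_ (n + j) * (1 - g / l%:R)) * (expR s * expR (err H l)) * (1 + hz l / l%:R) =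
  Q j * m_ (n + j) * expR s * ((1 - g / l%:R) * expR (err H l) * (1 + hz l / l%:R)) by ring.
rewrite ler_wpM2l //; apply: le_trans key _.
by rewrite ler_wpM2r ?(ltW hl) // ler_wpM2l // subr_ge0 ler_pdivrMr // mul1r ltW.
Qed.

Lemma compare_upper H j k : H <= g -> (0 < j)%N -> (j <= k)%N ->
  Q j * m_ k <= m_ j * Q k * expR (\sum_(j.+1 <= l < k.+1) err H l).
Proof.
move=> gH j0 /subnK <-; elim: (k - j)%N => [|n IH].
  by rewrite add0n big_geq // expR0 mulr1 mulrC.
rewrite addSn big_nat_recr //=; last by rewrite ltnS leq_addl.
set l := (n + j).+1 in IH *; set s := \sum_(_ <= _ < _) _ in IH *.
have l2 : (2 <= l)%N by rewrite /l ltnS addn_gt0 j0 orbT.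
have lp : 0 < l%:R :> R by rewrite ltr0n.
have l2' : 2 <= l%:R :> R by rewrite ler_nat.
have gl : g < l%:R by rewrite (lt_trans g1) // ltr1n.
have h2 : 0 < 1 - g / l%:R by rewrite subr_gt0 ltr_pdivrMr // mul1r.
rewrite modelS -/l mulrA expRD.
apply: le_trans (_ : m_ j * Q (n + j) * expR s * (1 - g / l%:R) <= _).
  by rewrite ler_pM2r.
rewrite {1}QS -/l.
set d := `|H - hz l| / l%:R.
have key : (1 + hz l / l%:R) * (1 - g / l%:R) <= expR (err H l).
  have d0 : 0 <= 2 / l%:R ^+ 2 :> R by rewrite divr_ge0 // exprn_ge0.
  apply: le_trans (_ : 1 + d <= _); last first.
    by apply: le_trans (expR_ge1Dx _); rewrite /err -/d addrA lerDl.
  have h1 : hz l / l%:R <= g / l%:R + d.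
    rewrite /d -mulrDl ler_pM2r ?invr_gt0 //; have := ler_norm (- (H - hz l)).
    rewrite normrN; lra.
  apply: le_trans (_ : (1 + (g / l%:R + d)) * (1 - g / l%:R) <= _).
    by rewrite ler_pM2r // lerD2l.
  have : 0 <= (g / l%:R) ^+ 2 by rewrite sqr_ge0.
  have : 0 <= d * (g / l%:R) by rewrite mulr_ge0 // divr_ge0 // ltW.
  by rewrite expr2 !(mulrDl, mulrDr, mulrN); lra.
have -> : m_ j * (Q l * (1 + hz l / l%:R)) * expR s * (1 - g / l%:R) =
   m_ j * Q l * expR s * ((1 + hz l / l%:R) * (1 - g / l%:R)) by ring.
by rewrite [leRHS]mulrA ler_wpM2l // !mulr_ge0 ?expR_ge0 // ltW.
Qed.

End Comparison.

(** * Comparison at near-extremal points *)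

Section Comparison.
Variables (R : realType) (rho c K C g : R) (q Q : nat -> R).
Hypothesis S : tail_system rho q Q.
Let w k := k%:R * q k.
Let rho0 : 0 < rho := ts_rho S.
Let Q0 : Q 0%N = 1 := ts_Q0 S.
Let Qp k : 0 < Q k := ts_Q S k.
Let Qle j k : (j <= k)%N -> Q k <= Q j := @Q_nonincr _ _ _ _ S j k.
Hypothesis c0 : 0 < c.
Hypothesis K0 : 0 < K.
Hypothesis w_ge : forall k, (0 < k)%N -> c * Q k <= w k.
Hypothesis w_le : forall k, w k <= K * Q k.
Hypothesis psum_ub : forall k, (0 < k)%N -> psum Q k <= C * (k%:R * Q k).
Hypothesis g0 : 2^-1 < g.
Hypothesis g1 : g < 1.

Let gp : 0 < g. Proof. by apply: lt_trans g0; rewrite invr_gt0. Qed.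
Let C1 : 1 <= C := psum_const_ge1 Qp Qle psum_ub.
Let C0 : 0 < C := lt_le_trans ltr01 C1.
Local Notation hz := (hazard q Q).
Local Notation D := (defect q Q).
Local Notation m_ := (model g).
Let mp k : 0 < m_ k := model_gt0 g1 k.
Let mle j k : (j <= k)%N -> m_ k <= m_ j := @model_nonincr _ _ gp g1 j k.
Let Cm := (1 - g)^-1.
Let mub k : (0 < k)%N -> psum m_ k <= Cm * (k%:R * m_ k) := @psum_model_ub _ _ g1 k.

Let err H l := `|H - hz l| / l%:R + 2 / l%:R ^+ 2.
Let hz0 k : 0 <= hz k := hazard_ge0 S k.

(** By [psum_harmonic] from m = 1, C^2 k Q k dominates the harmonic sum. This makes the constant
    term of [extremal_sum_defect] negligible against k Q k, and boundary terms of order Q k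
    negligible against k Q k ^ 2. *)
Lemma kQ_unbounded (M : R) : exists k0, forall k, (k0 <= k)%N -> M <= k%:R * Q k.
Proof.
pose n := (Num.truncn (2 * C ^+ 2 * M)).+1.
have nM : 2 * C ^+ 2 * M < n%:R by exact: truncnS_gt.
exists (2 ^ n)%N => k nk.
have k0 : (0 < k)%N by apply: leq_trans nk; rewrite expn_gt0.
have h1 := psum_harmonic Qp Qle psum_ub (ltnSn 0) k0.
have h2 : n%:R / 2 <= \sum_(1 <= l < k) l%:R^-1 :> R by apply: harmonic_dyadic; rewrite ?mul1n.
have h3 : psum Q 1 = 1 by rewrite /psum big_nat1.
have h4 : C * psum Q k <= C * (C * (k%:R * Q k)) by rewrite ler_pM2l ?psum_ub.
rewrite h3 mul1r in h1.
have C2 : 0 < C ^+ 2 by rewrite exprn_gt0.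
rewrite -(ler_pM2l C2) expr2 -[leRHS]mulrA; apply: le_trans h4; apply: le_trans h1.
apply: le_trans h2; rewrite -expr2; lra.
Qed.

(** From k / 2^n to k, Q changes by at most the factor 2^(n + 1) C, and the l^1 norm of D has to
    stay small after multiplication by it. The second condition absorbs boundary terms of order Q k;
    the third makes the sum of 2 / l^2 over this block at most 1 / n. *)
Definition near_power n k :=
  [/\ (\sum_(1 <= j < k) `|D k j|) * (2 ^+ n.+1 * C) <= n%:R^-1 * (k%:R * Q k),
      n%:R <= k%:R * Q k & (2 ^ (n + n).+3 * n <= k)%N].

Lemma near_power_ex n : (0 < n)%N -> exists2 eta, 0 < eta &
  exists k0, forall k sg, (k0 <= k)%N -> sg = 1 \/ sg = -1 ->
    extremal q Q sg eta k -> near_power n k.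
Proof.
move=> n0; have np : 0 < n%:R :> R by rewrite ltr0n.
pose A := (1 + rho) * K ^+ 2 / c.
pose A' := 2 * (4 * K * C ^+ 2 * (1 + C)) / c.
pose P := 2 ^+ n.+1 * C.
have P0 : 0 < P by rewrite mulr_gt0 // exprn_gt0.
have A'0 : 0 < A'.
  by rewrite divr_gt0 // !mulr_gt0 ?exprn_gt0 // addr_gt0.
(* The penalty term then uses half of the allowance 1 / n; the constant A uses the other half once k
   Q k >= 2 n A P. *)
pose eta := (2 * n%:R * P * A')^-1.
have eta0 : 0 < eta by rewrite invr_gt0 mulr_gt0 // mulr_gt0 // mulr_gt0.
exists eta => //.
have [k1 hk1] := kQ_unbounded n%:R.
have [k2 hk2] := kQ_unbounded (2 * n%:R * A * P).
exists (2 + k1 + k2 + 2 ^ (n + n).+3 * n)%N => k sg kk sgE ext.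
have kk1 : (k1 <= k)%N by move: kk; clear; lia.
have kk2 : (k2 <= k)%N by move: kk; clear; lia.
have kk3 : (1 < k)%N by move: kk; clear; lia.
have kk4 : (2 ^ (n + n).+3 * n <= k)%N by move: kk; clear; lia.
split => //; last exact: hk1.
have := extremal_sum_defect S c0 K0 w_ge w_le psum_ub sgE (ltW eta0) kk3 ext.
rewrite -/A -/A' -/P => h; have x2 := hk2 _ kk2.
set x := k%:R * Q k in h x2 *.
apply: le_trans (ler_wpM2r (ltW P0) h) _.
have e1 : A' * (eta * x) * P = x / (2 * n%:R) by rewrite /eta; field; rewrite !gt_eqF.
have e2 : A * P <= x / (2 * n%:R) by rewrite ler_pdivlMr ?mulr_gt0 //; move: x2; lra.
rewrite mulrDl e1; apply: le_trans (lerD e2 (lexx _)) _.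
by rewrite le_eqVlt; apply/orP; left; apply/eqP; field; rewrite gt_eqF.
Qed.

Section NearPower.
Variables (n k : nat).
Hypothesis n0 : (0 < n)%N.
Hypothesis near_pow : near_power n k.

Let m := (k %/ 2 ^ n)%N.
Let SD := \sum_(1 <= j < k) `|D k j|.
Let x := k%:R * Q k.

Lemma near_power_facts :
  [/\ (0 < m)%N, (m * 2 ^ n <= k)%N, (k <= m * 2 ^ n.+1)%N, (m.*2 <= k)%N & (1 < k)%N].
Proof.
have [_ _ h] := near_pow.
have p0 : (0 < 2 ^ n)%N by rewrite expn_gt0.
have p1 : (2 <= 2 ^ n)%N by rewrite -{1}(expn1 2) leq_exp2l.
have kp : (2 ^ n <= k)%N.
  apply: leq_trans h; rewrite -[leqLHS]muln1 leq_mul // leq_exp2l //.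
  by clear; lia.
have m0 : (0 < m)%N by rewrite divn_gt0.
have mk : (m * 2 ^ n <= k)%N by exact: leq_divM.
have km : (k < m.+1 * 2 ^ n)%N by exact: ltn_ceil.
split=> //.
- rewrite expnS; move: m0 km; clear; nia.
- by move: m0 mk p1; clear; nia.
- by apply: leq_trans kp.
Qed.

Let kp : 0 < k%:R :> R.
Proof. by have [_ _ _ _ /ltnW] := near_power_facts; rewrite ltr0n. Qed.

Lemma Q_block : Q m <= C * 2 ^+ n.+1 * Q k.
Proof.
have [m0 mk km m2 k1] := near_power_facts.
have mk' : (m <= k)%N by rewrite (leq_trans _ m2) // -addnn leq_addr.
have := regular_ratio Qp Qle psum_ub mk' (ltnW k1) => h.
rewrite -(ler_pM2l kp).
apply: le_trans (_ : 2 ^+ n.+1 * (m%:R * Q m) <= _).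
  rewrite mulrA ler_pM2r // -natrX -natrM ler_nat mulnC //.
have -> : k%:R * (C * 2 ^+ n.+1 * Q k) = 2 ^+ n.+1 * (C * (k%:R * Q k)) by ring.
by rewrite ler_wpM2l // exprn_ge0.
Qed.

Lemma sum_Q_end : \sum_((k - m).+1 <= j < k) Q (k - j)%N <= psum Q m.
Proof.
have [m0 mk km m2 k1] := near_power_facts.
rewrite big_nat_rev /= -{1}[(k - m).+1]add0n big_addn.
have -> : (k - (k - m).+1 = m.-1)%N by move: m0 m2; clear; lia.
have -> : psum Q m = Q 0%N + \sum_(0 <= i < m.-1) Q i.+1.
  by rewrite -{1}(prednK m0) /psum big_nat_recl.
rewrite -[leLHS]add0r lerD ?(ltW (Qp _)) //.
rewrite !big_nat ler_sum // => i /andP[_ im]; rewrite le_eqVlt; apply/orP; left.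
by apply/eqP; congr Q; move: im m0 m2; clear; lia.
Qed.

(** For j <= k - m the factor Q (k - j) <= Q m comes out and leaves the l^1 norm of D. For later j,
    |D k j| <= 2 K C Q k, and the remaining mass [psum Q m] is small by [psum_dyadic]. *)
Lemma sum_defect_Q :
  \sum_(1 <= j < k) `|D k j| * Q (k - j)%N <= Q m * SD + 2 * K * C * Q k * psum Q m.
Proof.
have [m0 mk km m2 k1] := near_power_facts.
have m1 : (m < k)%N by move: m0 m2; clear; lia.
rewrite (@big_cat_nat _ _ _ (k - m).+1) //=; last first.
  by move: m0 m1; clear; lia.
apply: lerD.
  apply: le_trans (_ : \sum_(1 <= j < (k - m).+1) Q m * `|D k j| <= _).
    rewrite !big_nat ler_sum // => j /andP[_ jm]; rewrite mulrC ler_wpM2r //.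
    by rewrite Qle //; move: jm m1; clear; lia.
  rewrite -mulr_sumr ler_pM2l // /SD [leRHS](@big_cat_nat _ _ _ (k - m).+1) //=.
    by rewrite lerDl sumr_ge0.
  by move: m0 m1; clear; lia.
apply: le_trans (_ : \sum_((k - m).+1 <= j < k) 2 * K * C * Q k * Q (k - j)%N <= _).
  rewrite !big_nat ler_sum // => j /andP[mj jk]; rewrite ler_wpM2r ?(ltW (Qp _)) //.
  apply: le_trans (defect_ub S w_le k j) _.
  have : Q j <= 2 * C * Q k.
    apply: (regular_half Qp Qle psum_ub); [|exact: ltnW|exact: ltnW].
    by move: mj m2; clear; lia.
  by move=> h; apply: le_trans (ler_wpM2l (ltW K0) h) _; rewrite le_eqVlt; apply/orP; left; apply/eqP; ring.
rewrite -mulr_sumr ler_wpM2l ?sum_Q_end //.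
by rewrite !mulr_ge0 // ltW.
Qed.

Lemma near_power_hazard :
  `|(2 * hz k - 1) * conv Q Q k - rho * (k%:R * Q k ^+ 2)| <=
    (2 * K + 2 + 8 * K * C ^+ 3 + rho) / n%:R * (k%:R * Q k ^+ 2).
Proof.
have [m0 mk km m2 k1] := near_power_facts.
have [h1 h2 _] := near_pow.
have np : 0 < n%:R :> R by rewrite ltr0n.
have Qk := Qp k.
have e : (2 * hz k - 1) * conv Q Q k - rho * (k%:R * Q k ^+ 2) =
    2 * conv (D k) Q k + rho * Q k ^+ 2.
  have := conv_lincomb (hz k) Q (fun j => j%:R * q j) Q k.
  rewrite -/(D k) => ->; rewrite mulrBr (conv_kq_Q S) ?(ltnW k1) //.
  have -> : conv Q Q k = conv Q Q k.-1 - rho * Q k ^+ 2.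
    by case: (k) k1 => // j _; exact: (conv_QQ_S S).
  by ring.
have e2 : conv (D k) Q k = hz k * Q k + \sum_(1 <= j < k) D k j * Q (k - j)%N.
  have dkk : D k k = 0 by rewrite (defect_hazard S) subrr mulr0.
  case: (k) dkk k1 => // j dkk _; rewrite conv_split dkk mul0r addr0.
  by rewrite [D _ 0]/defect Q0 mul0r subr0 mulr1.
have e3 : `|\sum_(1 <= j < k) D k j * Q (k - j)%N| <=
    Q m * SD + 2 * K * C * Q k * psum Q m.
  apply: le_trans sum_defect_Q; apply: le_trans (ler_norm_sum _ _ _) _.
  by rewrite ler_sum // => j _; rewrite normrM (gtr0_norm (Qp _)).
have e4 : Q m * SD <= Q k * (n%:R^-1 * x).
  apply: le_trans (_ : C * 2 ^+ n.+1 * Q k * SD <= _).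
    by rewrite ler_wpM2r ?Q_block // sumr_ge0.
  have -> : C * 2 ^+ n.+1 * Q k * SD = Q k * (SD * (2 ^+ n.+1 * C)) by ring.
  by rewrite ler_pM2l.
have e5 : 2 * K * C * Q k * psum Q m <= 2 * K * C * Q k * (2 * C ^+ 2 / n%:R * x).
  rewrite ler_wpM2l ?(psum_dyadic Qp Qle psum_ub m0 n0 mk) //.
  by rewrite !mulr_ge0 // ltW.
have x1 : 1 <= n%:R^-1 * x by rewrite mulrC ler_pdivlMr // mul1r.
have hK := hazard_ub S w_le k.
have e6 : 0 <= hz k * Q k <= K * Q k * (n%:R^-1 * x).
  rewrite mulr_ge0 ?hz0 ?(ltW Qk) //=.
  apply: le_trans (_ : K * Q k <= _); first by rewrite ler_pM2r.
  by rewrite ler_peMr // mulr_ge0 // ltW.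
have e7 : 0 <= rho * Q k ^+ 2 <= rho * Q k * (n%:R^-1 * x).
  rewrite mulr_ge0 ?sqr_ge0 ?(ltW rho0) //= expr2 mulrA ler_wpM2l //.
    by rewrite mulr_ge0 // ltW.
  by apply: le_trans x1; exact: Q_le1 S k.
rewrite e e2.
have -> : (2 * K + 2 + 8 * K * C ^+ 3 + rho) / n%:R * (k%:R * Q k ^+ 2) =
   2 * (K * Q k * (n%:R^-1 * x)) + 2 * (Q k * (n%:R^-1 * x)) +
   2 * (2 * K * C * Q k * (2 * C ^+ 2 / n%:R * x)) + rho * Q k * (n%:R^-1 * x).
  by rewrite /x; field; rewrite gt_eqF.
move: e3 e6 e7; rewrite !ler_norml => /andP[? ?] /andP[? ?] /andP[? ?].
apply/andP; split; lra.
Qed.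

(** As |hz k - hz l| = |D k l| / Q l, the first part is at most SD / (m Q k). The second has at most
    k terms, each at most 2 / m^2, and k <= m 2^(n + 1) bounds 2 k / m^2 by 2^(2 n + 3) / k <= 1 /
    n. *)
Lemma sum_err j : (m <= j)%N -> (j <= k)%N ->
  \sum_(j.+1 <= l < k.+1) err (hz k) l <= 2 / n%:R.
Proof.
move=> mj jk; have [m0 mk km m2 k1] := near_power_facts.
have [h1 h2 h3] := near_pow.
have np : 0 < n%:R :> R by rewrite ltr0n.
have mp' : 0 < m%:R :> R by rewrite ltr0n.
have Qk := Qp k; have xp : 0 < x by rewrite mulr_gt0.
have dkk : D k k = 0 by rewrite (defect_hazard S) subrr mulr0.
apply: le_trans (_ : \sum_(j.+1 <= l < k.+1) ((m%:R * Q k)^-1 * `|D k l| + 2 / m%:R ^+ 2) <= _).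
  rewrite !big_nat ler_sum // => l /andP[jl lk].
  have ml : (m <= l)%N by rewrite (leq_trans mj) // ltnW.
  have lp : 0 < l%:R :> R by rewrite ltr0n (leq_trans m0).
  rewrite /err; apply: lerD.
    rewrite (defect_hazard S) normrM (gtr0_norm (Qp l)) ler_pdivrMr //.
    rewrite [leRHS](_ : _ = (m%:R * Q k)^-1 * (Q l * l%:R) * `|hz k - hz l|); last by ring.
    rewrite ler_peMl // mulrC ler_pdivlMr ?mulr_gt0 // mul1r mulrC.
    by apply: ler_pM; rewrite ?ler_nat ?ler0n ?Qle // ltW.
  rewrite ler_pM2l // lef_pV2 ?posrE ?exprn_gt0 //.
  by rewrite lerXn2r ?nnegrE ?ler_nat ?ltW.
rewrite big_split /= -mulr_sumr.
have -> : 2 / n%:R = n%:R^-1 + n%:R^-1 :> R by rewrite mulrDl mul1r.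
have kk : (k ^ 2 <= m ^ 2 * 2 ^ (n + n).+2)%N.
  have -> : (m ^ 2 * 2 ^ (n + n).+2 = (m * 2 ^ n.+1) ^ 2)%N.
    by rewrite expnMn -expnM; congr (_ * 2 ^ _)%N; clear; lia.
  by rewrite leq_sqr.
apply: lerD.
  apply: le_trans (_ : (m%:R * Q k)^-1 * SD <= _).
    rewrite ler_wpM2l ?invr_ge0 ?mulr_ge0 ?(ltW Qk) //.
    case: (leqP j.+1 k) => jk'; last by rewrite big_geq // sumr_ge0.
    rewrite big_nat_recr //= dkk normr0 addr0 /SD.
    rewrite [leRHS](@big_cat_nat _ _ _ j.+1) //=.
    by rewrite lerDr sumr_ge0.
  rewrite mulrC ler_pdivrMr ?mulr_gt0 //.
  have SD0 : 0 <= SD by rewrite sumr_ge0.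
  have p0 : 0 < 2 ^+ n.+1 :> R by rewrite exprn_gt0.
  rewrite -(ler_pM2r p0); apply: le_trans (_ : SD * (2 ^+ n.+1 * C) <= _).
    by rewrite ler_wpM2l // ler_peMr // ltW.
  apply: le_trans h1 _.
  have -> : n%:R^-1 * (m%:R * Q k) * 2 ^+ n.+1 = n%:R^-1 * ((m%:R * 2 ^+ n.+1) * Q k) by ring.
  rewrite ler_wpM2l ?invr_ge0 // ler_pM2r // -natrX -natrM ler_nat //.
rewrite sumr_const_nat -[leLHS]mulr_natl.
apply: le_trans (_ : k%:R * (2 / m%:R ^+ 2) <= _).
  rewrite ler_wpM2r ?divr_ge0 ?exprn_ge0 // ler_nat; move: jk; clear; lia.
rewrite mulrA ler_pdivrMr ?exprn_gt0 // mulrC -(ler_pM2r np) -[leRHS]mulrA.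
rewrite [_ * n%:R in leRHS]mulrC mulrA mulVf ?gt_eqF // mul1r.
rewrite -natrX -!natrM ler_nat.
have p0 : (0 < 2 ^ (n + n).+2)%N by rewrite expn_gt0.
rewrite -(leq_pmul2r p0); apply: leq_trans (_ : k ^ 2 <= _)%N; last by [].
have -> : (2 * k * n * 2 ^ (n + n).+2 = k * (2 ^ (n + n).+3 * n))%N.
  by rewrite [(2 ^ (n + n).+3)%N]expnS; ring.
by rewrite -mulnn leq_mul.
Qed.

Let E := expR (2 / n%:R) : R.

(** In the middle range j and k - j are both at least m, so the pointwise comparison applies to each
    factor, whence E ^ 2. The two ends of the model's square cost 8 Cm ^ 3 / n by [regular_ends];
    those of Q * Q are nonnegative and dropped. *)
Lemma conv_lower : g <= hz k ->
  Q k ^+ 2 * (conv m_ m_ k - 8 * Cm ^+ 3 / n%:R * (k%:R * m_ k ^+ 2)) <=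
  E ^+ 2 * m_ k ^+ 2 * conv Q Q k.
Proof.
move=> gH; have [m0 mk km m2 k1] := near_power_facts.
have step j : (m <= j)%N -> (j <= k)%N -> Q k * m_ j <= E * m_ k * Q j.
  move=> mj jk; rewrite mulrC.
  apply: le_trans (compare_lower S g0 g1 gH (leq_trans m0 mj) jk) _.
  rewrite -mulrA mulrC ler_pM2r // mulrC ler_pM2r //.
  by rewrite ler_expR; exact: sum_err.
apply: le_trans (_ : Q k ^+ 2 * \sum_(m <= j < (k - m).+1) m_ j * m_ (k - j)%N <= _).
  rewrite ler_pM2l ?exprn_gt0 // (conv_ends m_ m_ m2).
  have := regular_ends mp mle mub m0 n0 mk; rewrite -/Cm.
  have -> : 8 * Cm ^+ 3 / n%:R * (k%:R * m_ k ^+ 2) =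
     2 * (4 * Cm ^+ 3 / n%:R * (k%:R * m_ k ^+ 2)) by ring.
  lra.
rewrite (conv_ends Q Q m2) mulrDr -[leLHS]add0r; apply: lerD.
  rewrite mulr_ge0 ?mulr_ge0 ?exprn_ge0 ?expR_ge0 ?(ltW (mp k)) //.
  by rewrite sumr_ge0 // => j _; rewrite mulr_ge0 // ltW.
rewrite !mulr_sumr !big_nat ler_sum // => j /andP[mj jk].
have jk' : (j <= k)%N by move: jk; clear; lia.
have mkj : (m <= k - j)%N by move: jk mj m2; clear; lia.
rewrite [leLHS](_ : _ = (Q k * m_ j) * (Q k * m_ (k - j)%N)); last by ring.
rewrite [leRHS](_ : _ = (E * m_ k * Q j) * (E * m_ k * Q (k - j)%N)); last by ring.
by apply: ler_pM; rewrite ?step ?leq_subr // mulr_ge0 // ltW.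
Qed.

Lemma conv_upper : hz k <= g ->
  m_ k ^+ 2 * (conv Q Q k - 8 * C ^+ 3 / n%:R * (k%:R * Q k ^+ 2)) <=
  E ^+ 2 * Q k ^+ 2 * conv m_ m_ k.
Proof.
move=> gH; have [m0 mk km m2 k1] := near_power_facts.
have step j : (m <= j)%N -> (j <= k)%N -> m_ k * Q j <= E * Q k * m_ j.
  move=> mj jk; rewrite mulrC.
  apply: le_trans (compare_upper S g0 g1 gH (leq_trans m0 mj) jk) _.
  rewrite -mulrA mulrC ler_pM2r // mulrC ler_pM2r //.
  by rewrite ler_expR; exact: sum_err.
apply: le_trans (_ : m_ k ^+ 2 * \sum_(m <= j < (k - m).+1) Q j * Q (k - j)%N <= _).
  rewrite ler_pM2l ?exprn_gt0 // (conv_ends Q Q m2).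
  have := regular_ends Qp Qle psum_ub m0 n0 mk.
  have -> : 8 * C ^+ 3 / n%:R * (k%:R * Q k ^+ 2) =
     2 * (4 * C ^+ 3 / n%:R * (k%:R * Q k ^+ 2)) by ring.
  lra.
rewrite (conv_ends m_ m_ m2) mulrDr -[leLHS]add0r; apply: lerD.
  rewrite mulr_ge0 ?mulr_ge0 ?exprn_ge0 ?expR_ge0 ?(ltW (Qp k)) //.
  by rewrite sumr_ge0 // => j _; rewrite mulr_ge0 // ltW.
rewrite !mulr_sumr !big_nat ler_sum // => j /andP[mj jk].
have jk' : (j <= k)%N by move: jk; clear; lia.
have mkj : (m <= k - j)%N by move: jk mj m2; clear; lia.
rewrite [leLHS](_ : _ = (m_ k * Q j) * (m_ k * Q (k - j)%N)); last by ring.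
rewrite [leRHS](_ : _ = (E * Q k * m_ j) * (E * Q k * m_ (k - j)%N)); last by ring.
by apply: ler_pM; rewrite ?step ?leq_subr // mulr_ge0 // ltW.
Qed.

End NearPower.

End Comparison.

(** * Convergence of the hazard index *)

Lemma harmonic_sum_le (R : realType) j k : (j <= k)%N ->
  harmonic_sum R j <= harmonic_sum R k.
Proof.
move=> jk; rewrite /harmonic_sum [leRHS](@big_cat_nat _ _ _ j) //=.
by rewrite lerDl sumr_ge0.
Qed.

Lemma harmonic_sum_unbounded (R : realType) (M : R) : exists k, M < harmonic_sum R k.
Proof.
pose n := (Num.truncn (2 * M)).+1; exists (2 ^ n)%N.
have nM : 2 * M < n%:R by exact: truncnS_gt.
have h : n%:R / 2 <= \sum_(1 <= l < (2 ^ n).+1) l%:R^-1 :> R.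
  by apply: harmonic_dyadic => //; rewrite mul1n.
have e : harmonic_sum R (2 ^ n) = \sum_(1 <= l < (2 ^ n).+1) l%:R^-1.
  by rewrite /harmonic_sum big_add1.
rewrite e; apply: lt_le_trans h; lra.
Qed.

Section ExtremalExists.
Variables (R : realType) (q Q : nat -> R).
Local Notation hz := (hazard q Q).

(* Maximise [sg * hazard + eta * harmonic_sum]. *)
Lemma extremal_ex sg eta n : 0 <= eta -> (0 < n)%N ->
  exists k, [/\ (0 < k <= n)%N, extremal q Q sg eta k &
    sg * hz n + eta * harmonic_sum R n <= sg * hz k + eta * harmonic_sum R k].
Proof.
case: n => // n eta0 _.
pose F (i : 'I_n.+1) := sg * hz i.+1 + eta * harmonic_sum R i.+1.
have [i _ Fi] := @arg_maxP _ _ _ ord0 xpredT F isT.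
exists i.+1; split=> [|j /andP[j0 ji]|]; first by rewrite /= ltn_ord.
- have jn : (j.-1 < n.+1)%N by rewrite (leq_ltn_trans _ (ltn_ord i)) // -ltnS prednK.
  have := Fi (Ordinal jn) isT; rewrite /F /= prednK //.
  rewrite mulrBr [_ * (_ - _)]mulrBr /=; lra.
- exact: Fi ord_max isT.
Qed.

End ExtremalExists.

Lemma expR_le_linear (R : realType) (y : R) : 0 <= y -> y <= 2^-1 -> expR y <= 1 + 2 * y.
Proof.
move=> y0 y2; have h := expR_ge1Dx (- y).
have e : expR y * expR (- y) = 1 by rewrite -expRD subrr expR0.
have E0 := expR_gt0 y.
have : expR y * (1 - y) <= 1 by rewrite -[leRHS]e ler_pM2l.
have : 1 <= (1 + 2 * y) * (1 - y) by rewrite mulrDl mulrBr; nra.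
move=> h1 h2; have y1 : 0 < 1 - y by lra.
by rewrite -(ler_pM2r y1) (le_trans h2).
Qed.

(** * Elementary inequalities turning the comparison into a bound on the index *)

Section Arithmetic.
Variable R : realFieldType.
Implicit Types H g L rho K N M B c E x : R.

(** Here x is 1 / n, M and N are the normalised squares of the model and of Q, L is the limit of M,
    and E is the squared comparison factor. If N >= L + 1 the lower bound on N is trivial; otherwise
    the excess of E over 1 costs at most 8 x (L + 1). *)
Lemma index_upper H g L rho K N M B c E x :
  0 <= x -> 0 < L -> 2^-1 < g -> g <= H -> H <= K -> L * (2 * g - 1) = rho ->
  - x <= M - L -> (2 * H - 1) * N - rho <= B * x -> E <= 1 + 8 * x -> 0 <= c ->
  0 <= N -> M - c * x <= E * N ->
  L * (H - g) * 2 <= (B + 2 * K * (1 + 8 * (L + 1) + c)) * x.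
Proof.
move=> x0 L0 g2 gH HK LE ml hN Eb c0 N0 h.
have NL : L - (1 + 8 * (L + 1) + c) * x <= N.
  have [hn|hn] := leP (L + 1) N.
    have : 0 <= (1 + 8 * (L + 1) + c) * x by rewrite mulr_ge0 //; clear -L0 c0; lra.
    by move: hn; clear; lra.
  have h' : E * N <= (1 + 8 * x) * N by rewrite ler_wpM2r.
  have h2 : 8 * x * N <= 8 * x * (L + 1) by rewrite ler_wpM2l ?mulr_ge0 // ltW.
  move: h' h h2 ml; clear; rewrite !(mulrDl, mulrDr); lra.
have H1 : 0 <= 2 * H - 1 by move: gH g2; clear; lra.
have h3 : (2 * H - 1) * (L - (1 + 8 * (L + 1) + c) * x) <= rho + B * x.
  apply: le_trans (_ : (2 * H - 1) * N <= _); first by rewrite ler_wpM2l.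
  by move: hN; clear; lra.
have h4 : (2 * H - 1) * ((1 + 8 * (L + 1) + c) * x) <= 2 * K * ((1 + 8 * (L + 1) + c) * x).
  rewrite ler_wpM2r //; last by move: HK; clear; lra.
  by rewrite mulr_ge0 //; move: L0 c0; clear; lra.
move: h3 h4; rewrite -LE; clear; lra.
Qed.

Lemma index_lower H g L rho K N M B c E x :
  0 <= x -> 8 * x <= 1 -> 0 < L -> H <= K -> 0 <= K -> L * (2 * g - 1) = rho ->
  0 <= M -> M - L <= x -> - (B * x) <= (2 * H - 1) * N - rho -> B * x < rho ->
  0 <= E -> E <= 1 + 8 * x -> 0 <= c -> 0 <= N -> N - c * x <= E * M ->
  L * (g - H) * 2 <= (B + 2 * K * (1 + 8 * (L + 1) + c)) * x.
Proof.
move=> x0 x8 L0 HK K0 LE M0 ml hN Br E0 Eb c0 N0 h.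
have NL : N <= L + (1 + 8 * (L + 1) + c) * x.
  have h' : E * M <= (1 + 8 * x) * (L + x).
    by apply: ler_pM => //; move: ml; clear; lra.
  have h2 : 8 * x * x <= 8 * x by rewrite ler_piMr ?mulr_ge0 //; move: x0 x8; clear; lra.
  move: h' h h2; clear; rewrite !(mulrDl, mulrDr); lra.
(* A negative 2 H - 1 would give (2 H - 1) N <= 0, impossible because B x < rho. *)
have [h0|h0] := leP 0 (2 * H - 1); last first.
  have : (2 * H - 1) * N <= 0 by rewrite mulr_le0_ge0 // ltW.
  by move: hN Br; clear; lra.
have h3 : rho - B * x <= (2 * H - 1) * (L + (1 + 8 * (L + 1) + c) * x).
  apply: le_trans (_ : (2 * H - 1) * N <= _); last by rewrite ler_wpM2l.
  by move: hN; clear; lra.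
have h4 : (2 * H - 1) * ((1 + 8 * (L + 1) + c) * x) <= 2 * K * ((1 + 8 * (L + 1) + c) * x).
  rewrite ler_wpM2r //; last by move: HK; clear; lra.
  by rewrite mulr_ge0 //; move: L0 c0; clear; lra.
move: h3 h4; rewrite -LE; clear; lra.
Qed.

End Arithmetic.

Section HazardLimit.
Variables (R : realType) (rho g : R) (q Q : nat -> R).
Hypothesis S : tail_system rho q Q.
Hypothesis g0 : 2^-1 < g.
Hypothesis g1 : g < 1.
Local Notation hz := (hazard q Q).
Local Notation m_ := (model g).
Let L := rho / (2 * g - 1).

Hypothesis model_lim : forall e : R, 0 < e -> exists k0, forall k, (k0 <= k)%N ->
  `|conv m_ m_ k / (k%:R * m_ k ^+ 2) - L| <= e.

Lemma hazard_extremal_limit (e : R) : 0 < e -> exists2 eta, 0 < eta &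
  exists k0, forall k sg, (k0 <= k)%N -> sg = 1 \/ sg = -1 ->
    extremal q Q sg eta k -> `|hz k - g| <= e.
Proof.
move=> e0; have rho0 := ts_rho S; have g0' := g0; have g1' := g1.
have [c c0 w_ge] := kq_lb S; have [C psum_ub] := psum_Q_ub S.
pose K := q 1%N / Q 1%N.
have K0 : 0 < K by rewrite divr_gt0 ?(ts_Q S) //; exact: ts_q S 0.
have w_le k : k%:R * q k <= K * Q k := kq_ub S k.
have C1 : 1 <= C := psum_const_ge1 (ts_Q S) (@Q_nonincr _ _ _ _ S) psum_ub.
pose Cm := (1 - g)^-1.
have Cm0 : 0 < Cm by rewrite invr_gt0; lra.
have D0 : 0 < 2 * g - 1 by lra.
have L0 : 0 < L := divr_gt0 rho0 D0.
pose B1 := 2 * K + 2 + 8 * K * C ^+ 3 + rho.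
pose B2 := 1 + 8 * (L + 1) + 8 * Cm ^+ 3.
pose B3 := 1 + 8 * (L + 1) + 8 * C ^+ 3.
pose B4 := B1 + 2 * K * (B2 + B3).
have C30 : 0 < C ^+ 3 by rewrite exprn_gt0 //; lra.
have Cm30 : 0 < Cm ^+ 3 by rewrite exprn_gt0.
have B10 : 0 < B1.
  have : 0 < 8 * K * C ^+ 3 by rewrite mulr_gt0 // mulr_gt0.
  by rewrite /B1; lra.
have B20 : 0 < B2 by rewrite /B2; lra.
have B30 : 0 < B3 by rewrite /B3; lra.
have K2 : 0 < 2 * K by rewrite mulr_gt0.
have B40 : 0 < B4 by exact: addr_gt0 B10 (mulr_gt0 K2 (addr_gt0 B20 B30)).
(* With x = 1 / n, the three summands secure 8 x <= 1, B1 x < rho and B4 x <= L e respectively. *)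
pose M := 8 + B1 / rho + B4 / (L * e).
pose n := (Num.truncn M).+1.
have nM : M < n%:R by exact: truncnS_gt.
have n0 : (0 < n)%N by [].
have t1 : 0 < B1 / rho by rewrite divr_gt0.
have Le0 : 0 < L * e := mulr_gt0 L0 e0.
have t2 : 0 < B4 / (L * e) := divr_gt0 B40 Le0.
have np : 0 < n%:R :> R by rewrite ltr0n.
pose x := n%:R^-1 : R.
have x0 : 0 < x by rewrite invr_gt0.
have nx : n%:R * x = 1 by rewrite mulfV // gt_eqF.
have x8 : 8 * x <= 1 by rewrite -nx ler_pM2r //; move: nM; rewrite /M; lra.
have xB1 : B1 * x < rho.
  rewrite -(ltr_pM2r np) -mulrA [x * _]mulrC nx mulr1 mulrC -ltr_pdivrMr //.
  by move: nM; rewrite /M; lra.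
have xB4 : B4 * x <= L * e.
  rewrite -(ler_pM2r np) -mulrA [x * _]mulrC nx mulr1 mulrC -ler_pdivrMr //.
  by move: nM; rewrite /M; lra.
have [eta eta0 [k0 hk0]] := near_power_ex S c0 K0 w_ge w_le psum_ub n0.
have [k1 hk1] := model_lim x0.
exists eta => //; exists (k0 + k1)%N => k sg kk sgE ext.
have near := hk0 k sg (leq_trans (leq_addr _ _) kk) sgE ext.
have := hk1 k (leq_trans (leq_addl _ _) kk) => mlim.
have hb := near_power_hazard S K0 w_le psum_ub n0 near.
have [_ _ _ _ k2] := near_power_facts n0 near.
have kp : 0 < k%:R :> R by rewrite ltr0n ltnW.
have Qk := ts_Q S k; have mk := model_gt0 g1 k.
set y := k%:R * Q k ^+ 2 in hb *; have y0 : 0 < y by rewrite mulr_gt0 // exprn_gt0.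
set z := k%:R * m_ k ^+ 2 in mlim *; have z0 : 0 < z by rewrite mulr_gt0 // exprn_gt0.
set Mk := conv m_ m_ k / z in mlim.
pose N := conv Q Q k / y.
have H0 : 0 <= hz k := hazard_ge0 S k.
have HK : hz k <= K := hazard_ub S w_le k.
have hN : `|(2 * hz k - 1) * N - rho| <= B1 * x.
  rewrite -(ler_pM2r y0) -{1}(gtr0_norm y0) -normrM mulrBl -mulrA /N divfK ?gt_eqF //.
have MkE : conv m_ m_ k = Mk * z by rewrite /Mk divfK // gt_eqF.
have NE : conv Q Q k = N * y by rewrite /N divfK // gt_eqF.
have yz : 0 < Q k ^+ 2 * m_ k ^+ 2 * k%:R by rewrite !mulr_gt0 // exprn_gt0.
have N0 : 0 <= N.
  by rewrite divr_ge0 ?(ltW y0) // sumr_ge0 // => j _; rewrite mulr_ge0 // ltW // (ts_Q S).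
have Mk0 : 0 <= Mk.
  by rewrite divr_ge0 ?(ltW z0) // sumr_ge0 // => j _; rewrite mulr_ge0 // ltW // model_gt0.
set E := expR (2 / n%:R) : R.
have E0 : 0 < E by exact: expR_gt0.
have E2 : E ^+ 2 = expR (4 * x).
  by rewrite /E expr2 -expRD -/x; congr expR; rewrite /x; ring.
have E2b : E ^+ 2 <= 1 + 8 * x.
  have -> : 1 + 8 * x = 1 + 2 * (4 * x) by ring.
  by rewrite E2 expR_le_linear //; lra.
have LE : L * (2 * g - 1) = rho by rewrite /L divfK // gt_eqF.
move: mlim; rewrite ler_norml => /andP[ml1 ml2].
move: hN; rewrite ler_norml => /andP[hN1 hN2].
have [gH|Hg] := leP g (hz k).
  rewrite ger0_norm ?subr_ge0 //.
  have := conv_lower S psum_ub g0 g1 n0 near gH.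
  rewrite MkE NE -/E -/z -/Cm -/x.
  have -> : Q k ^+ 2 * (Mk * z - 8 * Cm ^+ 3 * x * z) =
     (Q k ^+ 2 * m_ k ^+ 2 * k%:R) * (Mk - 8 * Cm ^+ 3 * x) by rewrite /z; ring.
  have -> : E ^+ 2 * m_ k ^+ 2 * (N * y) =
     (Q k ^+ 2 * m_ k ^+ 2 * k%:R) * (E ^+ 2 * N) by rewrite /y; ring.
  rewrite ler_pM2l // => h.
  have c8 : 0 <= 8 * Cm ^+ 3 by rewrite mulr_ge0 ?ltW.
  have := index_upper (ltW x0) L0 g0 gH HK LE ml1 hN2 E2b c8 N0 h.
  rewrite -/B2 => h6.
  have h7 : L * (hz k - g) * 2 <= L * e.
    apply: le_trans xB4; apply: le_trans h6 _; rewrite ler_pM2r // lerD2l.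
    by rewrite ler_pM2l // lerDl ltW.
  have h8 : 0 <= L * (hz k - g) by rewrite mulr_ge0 ?(ltW L0) // subr_ge0.
  by rewrite -(ler_pM2l L0) (le_trans _ h7) // ler_peMr // ler1n.
rewrite ler0_norm ?subr_le0 ?(ltW Hg) // opprB.
have := conv_upper S psum_ub g0 g1 n0 near (ltW Hg).
rewrite MkE NE -/E -/y -/x.
have -> : m_ k ^+ 2 * (N * y - 8 * C ^+ 3 * x * y) =
   (Q k ^+ 2 * m_ k ^+ 2 * k%:R) * (N - 8 * C ^+ 3 * x) by rewrite /y; ring.
have -> : E ^+ 2 * Q k ^+ 2 * (Mk * z) =
   (Q k ^+ 2 * m_ k ^+ 2 * k%:R) * (E ^+ 2 * Mk) by rewrite /z; ring.
rewrite ler_pM2l // => h.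
have c8 : 0 <= 8 * C ^+ 3 by rewrite mulr_ge0 ?ltW.
have := index_lower (ltW x0) x8 L0 HK (ltW K0) LE Mk0 ml2 hN1 xB1 (sqr_ge0 _) E2b c8 N0 h.
rewrite -/B3 => h6.
have h7 : L * (g - hz k) * 2 <= L * e.
  apply: le_trans xB4; apply: le_trans h6 _; rewrite ler_pM2r // lerD2l.
  by rewrite ler_pM2l // lerDr ltW.
have h8 : 0 <= L * (g - hz k) by rewrite mulr_ge0 ?(ltW L0) // subr_ge0 ltW.
by rewrite -(ler_pM2l L0) (le_trans _ h7) // ler_peMr // ler1n.
Qed.

Theorem hazard_limit (e : R) : 0 < e -> exists k0, forall k, (k0 <= k)%N ->
  `|hz k - g| <= e.
Proof.
move=> e0; have [eta eta0 [k0 hk0]] := hazard_extremal_limit e0.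
pose K := q 1%N / Q 1%N.
have HK k : hz k <= K := hazard_ub S (kq_ub S) k.
have H0 k : 0 <= hz k := hazard_ge0 S k.
have [k1 hk1] := harmonic_sum_unbounded (harmonic_sum R k0 + K / eta).
exists k1.+1 => n kn; have n0 : (0 < n)%N by exact: leq_trans kn.
have side sg : sg = 1 \/ sg = -1 -> sg * (hz n - g) <= e.
  move=> sgE; have [k [/andP[kp kn'] ext hk]] := @extremal_ex _ q Q sg eta n (ltW eta0) n0.
  have hkn := harmonic_sum_le R kn'.
  have hle : eta * (harmonic_sum R n - harmonic_sum R k) <= sg * (hz k - hz n).
    by rewrite !mulrBr; lra.
  (* Below k0 the penalty eta (h n - h k) would exceed K, the largest possible gain in hazard. *)
  have kk : (k0 <= k)%N.
    rewrite leqNgt; apply/negP => /ltnW/(harmonic_sum_le R) hkk.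
    have hn := harmonic_sum_le R (ltnW kn).
    have : sg * (hz k - hz n) <= K.
      have := HK k; have := HK n; have := H0 k; have := H0 n.
      by case: sgE => ->; lra.
    have : K < eta * (harmonic_sum R n - harmonic_sum R k).
      by rewrite mulrC -ltr_pdivrMr //; lra.
    lra.
  have := hk0 k sg kk sgE ext.
  have : 0 <= eta * (harmonic_sum R n - harmonic_sum R k).
    by rewrite mulr_ge0 ?(ltW eta0) // subr_ge0.
  rewrite ler_norml => ? /andP[? ?].
  by move: hle; case: sgE => ->; lra.
have s1 := side 1 (or_introl erefl); have s2 := side (-1) (or_intror erefl).
rewrite ler_norml; apply/andP; split; lra.
Qed.

End HazardLimit.

(** * The law of LIS *)

Lemma mem_subsets (T : eqType) (s S : seq T) : (S \in subsets s) = subseq S s.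
Proof.
elim: s S => [|x s IH] S; first by rewrite inE; case: S.
rewrite /= mem_cat IH; case: S => [|y S].
  by rewrite sub0seq orbT.
have -> : (y :: S \in map (cons x) (subsets s)) = (y == x) && (subseq S s).
  apply/mapP/andP => [[S' hS' [-> ->]]|[/eqP -> harmonic_sumS]]; first by rewrite eqxx -IH.
  by exists S => //; rewrite IH.
rewrite /=; have [->|yx] := eqVneq y x => //=.
by apply/orb_idr => /cons_subseq.
Qed.

Lemma LIS_ub t S : subseq S (leaves t) -> pairwise_plus t S -> (size S <= LIS t)%N.
Proof.
rewrite -mem_subsets => harmonic_sumS pS.
by rewrite /LIS (big_rem S) //= pS leq_maxl.
Qed.

Lemma LIS_witness t : exists S, [/\ subseq S (leaves t), pairwise_plus t S & size S = LIS t].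
Proof.
rewrite /LIS big_seq_cond.
elim/big_ind: _ => [|m n [S [? ? <-]] [S' [? ? <-]]|S].
- by exists [::]; rewrite sub0seq.
- by have [?|?] := leqP (size S) (size S'); [exists S' | exists S].
- by rewrite mem_subsets => /andP[? ?]; exists S.
Qed.

Lemma LIS_eq t m : (forall S, subseq S (leaves t) -> pairwise_plus t S -> (size S <= m)%N) ->
  (exists S, [/\ subseq S (leaves t), pairwise_plus t S & (m <= size S)%N]) -> LIS t = m.
Proof.
move=> h [S [harmonic_sumS pS mS]]; apply/eqP; rewrite eqn_leq (leq_trans mS (LIS_ub harmonic_sumS pS)) andbT.
by have [S' [? ? <-]] := LIS_witness t; exact: h.
Qed.

(** A leaf on the left and a leaf on the right have the root as highest common ancestor, so a minus
    root forces one side to be empty. *)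
Lemma pairwise_plus_Node s l r (A B : seq (seq bool)) :
  pairwise_plus (Node s l r) (map (cons false) A ++ map (cons true) B) =
  [&& pairwise_plus l A, pairwise_plus r B & [|| s, A == [::] | B == [::]]].
Proof.
have hB : pairwise_plus (Node s l r) (map (cons true) B) = pairwise_plus r B.
  by elim: B => //= b B ->; rewrite all_map.
elim: A => [|a A IH] /=; first by rewrite hB orbT andbT.
rewrite IH all_cat !all_map.
have -> : all (preim (cons false) (hca_plus (Node s l r) (false :: a))) A =
    all (hca_plus l a) A by apply: eq_all.
have -> : all (preim (cons true) (hca_plus (Node s l r) (false :: a))) B =
    s || (B == [::]).
  by case: B {hB IH} => [|b B] /=; rewrite ?orbT // /hca_plus /=; case: s => //=; elim: B.
case: (all _ A); case: (pairwise_plus l A); case: (pairwise_plus r B); case: s {hB IH} => //=;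
  rewrite ?andbT ?andbF //=; by case: B => //=; rewrite ?orbT ?orbF ?andbF.
Qed.

Lemma subseq_leaves_Node s l r S : subseq S (leaves (Node s l r)) ->
  exists A B, [/\ S = map (cons false) A ++ map (cons true) B,
    subseq A (leaves l) & subseq B (leaves r)].
Proof.
move=> /subseqP[m sm ->] /=; rewrite -(cat_take_drop (size (leaves l)) m).
have sz : size (take (size (leaves l)) m) = size (leaves l).
  by rewrite size_takel // sm size_cat !size_map leq_addr.
rewrite mask_cat ?size_map //; exists (mask (take (size (leaves l)) m) (leaves l)).
exists (mask (drop (size (leaves l)) m) (leaves r)).
by rewrite !map_mask !mask_subseq.
Qed.

Lemma subseq_leaves_cat s l r A B : subseq A (leaves l) -> subseq B (leaves r) ->
  subseq (map (cons false) A ++ map (cons true) B) (leaves (Node s l r)).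
Proof. by move=> hA hB; rewrite /= cat_subseq // map_subseq. Qed.

Lemma LIS_Leaf : LIS Leaf = 1%N.
Proof. by rewrite /LIS /= !big_cons big_nil. Qed.

Lemma LIS_plus l r : LIS (Node true l r) = (LIS l + LIS r)%N.
Proof.
apply: LIS_eq => [S|].
  move=> /subseq_leaves_Node[A [B [-> hA hB]]]; rewrite pairwise_plus_Node => /and3P[pA pB _].
  by rewrite size_cat !size_map leq_add // LIS_ub.
have [A [hA pA <-]] := LIS_witness l; have [B [hB pB <-]] := LIS_witness r.
exists (map (cons false) A ++ map (cons true) B).
by rewrite subseq_leaves_cat // pairwise_plus_Node pA pB size_cat !size_map.
Qed.

Lemma LIS_minus l r : LIS (Node false l r) = maxn (LIS l) (LIS r).
Proof.
apply: LIS_eq => [S|].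
  move=> /subseq_leaves_Node[A [B [-> hA hB]]]; rewrite pairwise_plus_Node => /and3P[pA pB].
  rewrite size_cat !size_map leq_max /= => /orP[] /eqP ->.
    by rewrite add0n (LIS_ub hB pB) orbT.
  by rewrite addn0 (LIS_ub hA pA).
have [A [hA pA <-]] := LIS_witness l; have [B [hB pB <-]] := LIS_witness r.
have [AB|BA] := leqP (size A) (size B).
  exists (map (cons false) [::] ++ map (cons true) B).
  by rewrite subseq_leaves_cat ?sub0seq // pairwise_plus_Node pB /= size_map.
exists (map (cons false) A ++ map (cons true) [::]).
by rewrite subseq_leaves_cat ?sub0seq // pairwise_plus_Node pA /= size_cat size_map addn0 orbT.
Qed.

Lemma LIS_gt0 t : (0 < LIS t)%N.
Proof.
elim: t => [|s l hl r hr]; first by rewrite LIS_Leaf.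
by case: s; rewrite ?LIS_plus ?LIS_minus ?leq_max ?addn_gt0 hl.
Qed.

(** Criticality: the extinction equation is (y - 1)^2 = 0. Its single root 1 gives the finite trees
    total mass one. *)
Lemma quadratic_fixpoint (R : realFieldType) (y : R) : y = 2^-1 + 2^-1 * y ^+ 2 -> y = 1.
Proof.
move=> e; have : (y - 1) ^+ 2 = 0 by rewrite expr2 in e *; lra.
by move/eqP; rewrite expf_eq0 /= subr_eq0 => /eqP.
Qed.

Section TreeSums.
Variables (R : realType) (p : R).
Hypothesis p0 : 0 < p.
Hypothesis p1 : p < 1.
Local Notation prob := (tree_prob p).

Lemma sum_trees_S h (f : stree -> R) :
  \sum_(t <- trees_upto h.+1) f t = f Leaf +
    \sum_(l <- trees_upto h) \sum_(r <- trees_upto h) f (Node true l r) +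
    \sum_(l <- trees_upto h) \sum_(r <- trees_upto h) f (Node false l r).
Proof.
rewrite [trees_upto h.+1]/= cats0 big_cons big_cat !big_map !big_allpairs /=.
by rewrite addrA.
Qed.

Lemma prob_ge0 t : 0 <= prob t.
Proof.
elim: t => [|s l hl r hr] /=; first by rewrite invr_ge0.
rewrite !mulr_ge0 ?invr_ge0 //; case: s; rewrite ?subr_ge0 ltW //.
Qed.

(** The induction is over all nonnegative f, so that it applies to the right subtree and then to the
    left one, without comparing the two enumerations as lists. *)
Lemma sum_trees_nondecr (f : stree -> R) h : (forall t, 0 <= f t) ->
  \sum_(t <- trees_upto h) f t <= \sum_(t <- trees_upto h.+1) f t.
Proof.
elim: h f => [|h IH] f f0.
  rewrite sum_trees_S /= big_seq1 -addrA lerDl addr_ge0 //;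
  by apply: sumr_ge0 => l _; apply: sumr_ge0.
rewrite sum_trees_S [leRHS]sum_trees_S !lerD //.
  apply: le_trans (IH (fun l => \sum_(r <- trees_upto h.+1) f (Node true l r)) _).
    by apply: ler_sum => l _; exact: IH.
  by move=> l; apply: sumr_ge0.
apply: le_trans (IH (fun l => \sum_(r <- trees_upto h.+1) f (Node false l r)) _).
  by apply: ler_sum => l _; exact: IH.
by move=> l; apply: sumr_ge0.
Qed.

Definition tree_sum (h : nat) (f : nat -> R) : R := \sum_(t <- trees_upto h) prob t * f (LIS t).

Lemma tree_sum_S h f : tree_sum h.+1 f = 2^-1 * f 1%N +
  2^-1 * p * \sum_(l <- trees_upto h) \sum_(r <- trees_upto h)
     prob l * prob r * f (LIS l + LIS r)%N +
  2^-1 * (1 - p) * \sum_(l <- trees_upto h) \sum_(r <- trees_upto h)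
     prob l * prob r * f (maxn (LIS l) (LIS r)).
Proof.
rewrite /tree_sum sum_trees_S LIS_Leaf !mulr_sumr; congr (_ + _ + _).
  apply: eq_bigr => l _; rewrite mulr_sumr; apply: eq_bigr => r _.
  by rewrite LIS_plus /=; ring.
apply: eq_bigr => l _; rewrite mulr_sumr; apply: eq_bigr => r _.
by rewrite LIS_minus /=; ring.
Qed.

Lemma tree_sum_prod h f g : \sum_(l <- trees_upto h) \sum_(r <- trees_upto h)
     prob l * prob r * (f (LIS l) * g (LIS r)) = tree_sum h f * tree_sum h g.
Proof.
rewrite /tree_sum big_distrlr /=; apply: eq_bigr => l _; apply: eq_bigr => r _; ring.
Qed.

Lemma tree_sum_linear h f g : tree_sum h (fun i => f i + g i) = tree_sum h f + tree_sum h g.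
Proof. by rewrite /tree_sum -big_split; apply: eq_bigr => t _; rewrite mulrDr. Qed.

Lemma tree_sum_nondecr f : (forall i, 0 <= f i) -> nondecreasing_seq (fun h => tree_sum h f).
Proof.
move=> f0; apply/nondecreasing_seqP => h; apply: sum_trees_nondecr => t.
by rewrite mulr_ge0 ?prob_ge0.
Qed.

Lemma tree_sum_ge0 h f : (forall i, 0 <= f i) -> 0 <= tree_sum h f.
Proof. by move=> f0; apply: sumr_ge0 => t _; rewrite mulr_ge0 ?prob_ge0. Qed.

Let one (i : nat) : R := 1.

Lemma tree_sum_one_S h : tree_sum h.+1 one = 2^-1 + 2^-1 * tree_sum h one ^+ 2.
Proof.
rewrite tree_sum_S; have e : \sum_(l <- trees_upto h) \sum_(r <- trees_upto h)
   prob l * prob r * one 0 = tree_sum h one ^+ 2.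
  by rewrite expr2 -tree_sum_prod; apply: eq_bigr => l _; apply: eq_bigr => r _; rewrite /one; ring.
rewrite /one in e *; rewrite e; ring.
Qed.

Lemma tree_sum_one_le1 h : tree_sum h one <= 1.
Proof.
elim: h => [|h IH].
  by rewrite /tree_sum /= big_seq1 /= mulr1 invf_le1 // ler1n.
rewrite tree_sum_one_S; have h0 : 0 <= tree_sum h one by exact: tree_sum_ge0.
have : tree_sum h one ^+ 2 <= 1 by rewrite expr_le1.
lra.
Qed.

Definition tree_sum_lim f : R := limn (fun h => tree_sum h f).

Lemma tree_sum_cvg f : (forall i, 0 <= f i <= 1) -> (fun h => tree_sum h f) @ \oo --> tree_sum_lim f.
Proof.
move=> f01; apply: nondecreasing_is_cvgn.
  by apply: tree_sum_nondecr => i; have /andP[] := f01 i.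
exists 1 => _ [h _ <-]; apply: le_trans (tree_sum_one_le1 h).
apply: ler_sum => t _; rewrite ler_wpM2l ?prob_ge0 //.
by have /andP[] := f01 (LIS t).
Qed.

Lemma tree_sum_lim_ge0 f : (forall i, 0 <= f i <= 1) -> 0 <= tree_sum_lim f.
Proof.
move=> f01; apply: limr_ge; first exact: tree_sum_cvg.
by apply: nearW => h; apply: tree_sum_ge0 => i; have /andP[] := f01 i.
Qed.

Lemma tree_sum_lim_one : tree_sum_lim one = 1.
Proof.
have c : (fun h => tree_sum h one) @ \oo --> tree_sum_lim one.
  by apply: tree_sum_cvg => i; rewrite /one ler01 lexx.
have c1 : (fun h => tree_sum h.+1 one) @ \oo --> tree_sum_lim one by rewrite -cvg_shiftS in c.
have c2 : (fun h => tree_sum h.+1 one) @ \oo --> 2^-1 + 2^-1 * tree_sum_lim one ^+ 2.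
  under eq_fun do rewrite tree_sum_one_S.
  by apply: cvgD; [exact: cvg_cst | apply: cvgMr; rewrite expr2; under eq_fun do rewrite expr2; exact: cvgM].
by apply: quadratic_fixpoint; exact: cvg_unique _ c1 c2.
Qed.

Let ind (P : pred nat) (i : nat) : R := (P i)%:R.
Local Notation eqk k := (ind (pred1 k)).
Local Notation gtk k := (ind (fun i => k < i)%N).
Local Notation lek k := (ind (fun i => i <= k)%N).

Let ind01 P i : 0 <= ind P i <= 1.
Proof. by rewrite /ind; case: (P i); rewrite ?ler01 ?lexx. Qed.

Definition lis_pmf k := tree_sum_lim (eqk k).
Definition lis_tail k := tree_sum_lim (gtk k).

Lemma q_LISE k : q_LIS p k = lis_pmf k.
Proof.
rewrite /q_LIS /lis_pmf /tree_sum_lim; congr (limn _); apply/funext => h.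
rewrite /tree_sum big_mkcond; apply: eq_bigr => t _.
by rewrite /ind /=; case: eqP; rewrite ?mulr1 ?mulr0.
Qed.

Lemma Q_LIS_S k : Q_LIS p k.+1 = lis_tail k.
Proof.
rewrite /Q_LIS /lis_tail /tree_sum_lim; congr (limn _); apply/funext => h.
rewrite /tree_sum big_mkcond; apply: eq_bigr => t _.
by rewrite /ind /=; case: ltnP; rewrite ?mulr1 ?mulr0.
Qed.

Lemma lis_pmf0 : lis_pmf 0 = 0.
Proof.
rewrite /lis_pmf /tree_sum_lim (_ : (fun h => _) = (fun=> 0)) ?lim_cst //.
apply/funext => h; rewrite /tree_sum big1 // => t _.
by rewrite /ind /= (gtn_eqF (LIS_gt0 t)) mulr0.
Qed.

Lemma lis_tail0 : lis_tail 0 = 1.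
Proof.
rewrite -tree_sum_lim_one /lis_tail /tree_sum_lim; congr (limn _); apply/funext => h.
by apply: eq_bigr => t _; rewrite /ind LIS_gt0.
Qed.

Lemma lis_tailS k : lis_tail k = lis_tail k.+1 + lis_pmf k.+1.
Proof.
have c1 : (fun h => tree_sum h (gtk k)) @ \oo --> lis_tail k by apply: tree_sum_cvg.
have c2 : (fun h => tree_sum h (gtk k)) @ \oo --> lis_tail k.+1 + lis_pmf k.+1.
  rewrite (_ : (fun h => _) = (fun h => tree_sum h (gtk k.+1) + tree_sum h (eqk k.+1))).
    by apply: cvgD; apply: tree_sum_cvg.
  apply/funext => h; rewrite -tree_sum_linear; apply: eq_bigr => t _; congr (_ * _).
  rewrite /ind /= -natrD leq_eqVlt eq_sym; congr _%:R.
  by case: eqVneq => [->|_] /=; rewrite ?ltnn ?addn0.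
exact: cvg_unique _ c1 c2.
Qed.

Let tree_sum_lim_lek k : (fun h => tree_sum h (lek k)) @ \oo --> 1 - lis_tail k.
Proof.
rewrite (_ : (fun h => _) = (fun h => tree_sum h one - tree_sum h (gtk k))).
  apply: cvgB; last by apply: tree_sum_cvg.
  by rewrite -tree_sum_lim_one; apply: tree_sum_cvg => i; rewrite /one ler01 lexx.
apply/funext => h; apply/eqP; rewrite eq_sym subr_eq -tree_sum_linear.
apply/eqP/eq_bigr => t _; congr (_ * _); rewrite /ind /one -natrD.
by case: leqP.
Qed.

(** At a plus root the values add, giving the convolution. At a minus root the maximum is k when it
    is at most k but not at most k - 1, giving a difference of squared distribution functions. *)
Lemma tree_sum_eq_S h k : (0 < k)%N -> tree_sum h.+1 (eqk k) = 2^-1 * (k == 1%N)%:R +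
  2^-1 * p * conv (fun i => tree_sum h (eqk i)) (fun i => tree_sum h (eqk i)) k +
  2^-1 * (1 - p) * (tree_sum h (lek k) ^+ 2 - tree_sum h (lek k.-1) ^+ 2).
Proof.
move=> k0; rewrite tree_sum_S; congr (_ + _ + _).
- by rewrite /ind /= eq_sym.
- congr (_ * _); rewrite /conv.
  under [RHS]eq_bigr do rewrite -tree_sum_prod.
  rewrite [RHS]exchange_big /=; apply: eq_bigr => l _.
  rewrite [RHS]exchange_big /=; apply: eq_bigr => r _.
  rewrite -mulr_sumr; congr (_ * _).
  have [lk|kl] := leqP (LIS l) k.
    have lk' : (LIS l < k.+1)%N by [].
    rewrite (bigD1 (Ordinal lk')) //= big1 ?addr0 => [|i].
      rewrite /ind /= eqxx mul1r; congr _%:R; congr nat_of_bool.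
      by rewrite -{1}(subnKC lk) eqn_add2l.
    rewrite -val_eqE /= => il; rewrite /ind /= eq_sym (negbTE il) mul0r //.
  rewrite big1 => [|i _].
    by rewrite /ind /= gtn_eqF // ltn_addr.
  by rewrite /ind /= gtn_eqF ?mul0r // (leq_trans (ltn_ord i)).
congr (_ * _); rewrite !expr2 -!tree_sum_prod -sumrB; apply: eq_bigr => l _.
rewrite -sumrB; apply: eq_bigr => r _; rewrite -mulrBr; congr (_ * _).
rewrite /ind /= -!natrM !mulnb -!geq_max.
case: k k0 => // k _ /=; case: (ltngtP (maxn (LIS l) (LIS r)) k.+1).
- by rewrite ltnS => h1; rewrite h1 subrr.
- by move=> h1; rewrite leqNgt (ltnW h1) subrr.
- by move=> ->; rewrite ltnn subr0.
Qed.

Lemma lis_pmf_rec k : (0 < k)%N -> lis_pmf k = 2^-1 * (k == 1%N)%:R +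
  2^-1 * p * conv lis_pmf lis_pmf k +
  2^-1 * (1 - p) * ((1 - lis_tail k) ^+ 2 - (1 - lis_tail k.-1) ^+ 2).
Proof.
move=> k0.
have c1 : (fun h => tree_sum h.+1 (eqk k)) @ \oo --> lis_pmf k.
  by rewrite (cvg_shiftS (fun h => tree_sum h (eqk k))); apply: tree_sum_cvg.
have ce i : (fun h => tree_sum h (eqk i)) @ \oo --> lis_pmf i by apply: tree_sum_cvg.
have c2 : (fun h => tree_sum h.+1 (eqk k)) @ \oo --> 2^-1 * (k == 1%N)%:R +
  2^-1 * p * conv lis_pmf lis_pmf k +
  2^-1 * (1 - p) * ((1 - lis_tail k) ^+ 2 - (1 - lis_tail k.-1) ^+ 2).
  under eq_fun do rewrite tree_sum_eq_S // !expr2.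
  rewrite !expr2; apply: cvgD; first apply: cvgD; first exact: cvg_cst.
    apply: cvgMr; rewrite /conv; apply: cvg_big => [|i _]; last exact: cvgM.
    exact: add_continuous.
  by apply: cvgMr; apply: cvgB; apply: cvgM; exact: tree_sum_lim_lek.
exact: cvg_unique _ c1 c2.
Qed.

Lemma lis_pmf_ge0 k : 0 <= lis_pmf k.
Proof. exact: tree_sum_lim_ge0. Qed.

Lemma lis_tail_ge0 k : 0 <= lis_tail k.
Proof. exact: tree_sum_lim_ge0. Qed.

Lemma lis_conv_ge0 k : 0 <= conv lis_pmf lis_pmf k.
Proof. by apply: sumr_ge0 => i _; rewrite mulr_ge0 ?lis_pmf_ge0. Qed.

Lemma lis_tail_le1 k : lis_tail k <= 1.
Proof.
elim: k => [|k IH]; first by rewrite lis_tail0.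
by apply: le_trans IH; rewrite (lis_tailS k) lerDl lis_pmf_ge0.
Qed.

Lemma lis_sqr_diff_ge0 k :
  0 <= (1 - lis_tail k.+1) ^+ 2 - (1 - lis_tail k) ^+ 2.
Proof.
have := lis_tailS k; have := lis_pmf_ge0 k.+1; have := lis_tail_le1 k.+1; have := lis_tail_le1 k.
move=> ? ? ? ?; rewrite subr_ge0 lerXn2r ?nnegrE; lra.
Qed.

Lemma lis_pmf_gt0 k : 0 < lis_pmf k.+1.
Proof.
have p0' := p0; have p1' := p1.
have rest j : 0 <= 2^-1 * (1 - p) * ((1 - lis_tail j.+1) ^+ 2 - (1 - lis_tail j) ^+ 2).
  by rewrite mulr_ge0 ?lis_sqr_diff_ge0 // mulr_ge0 ?invr_ge0 // subr_ge0 ltW.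
have q1 : 0 < lis_pmf 1.
  rewrite lis_pmf_rec // eqxx; have := rest 0%N; rewrite /=.
  have : 0 <= 2^-1 * p * conv lis_pmf lis_pmf 1.
    by rewrite !mulr_ge0 ?invr_ge0 ?lis_conv_ge0 // ltW.
  lra.
elim: k => [|k IH] //; rewrite lis_pmf_rec //=.
have : 0 < 2^-1 * p * conv lis_pmf lis_pmf k.+2.
  rewrite !mulr_gt0 ?invr_gt0 //.
  have := @conv_ge_term _ lis_pmf lis_pmf k.+2 1 lis_pmf_ge0 lis_pmf_ge0 isT.
  by apply: lt_le_trans; rewrite subSS subn0 mulr_gt0.
by have := rest k.+1; rewrite mulr0 add0r => /=; lra.
Qed.

Lemma lis_tail_gt0 k : 0 < lis_tail k.
Proof. by rewrite lis_tailS ltr_wpDl ?lis_tail_ge0 ?lis_pmf_gt0. Qed.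

Lemma lis_conv k : (1 < k)%N -> conv lis_pmf lis_pmf k =
  lis_pmf k * (2 + (1 - p) / p * (lis_tail k + lis_tail k.-1)).
Proof.
case: k => [|[|k]] // _; have := lis_pmf_rec (ltn0Sn k.+1).
have -> : lis_tail k.+2.-1 = lis_tail k.+2 + lis_pmf k.+2 by exact: lis_tailS.
rewrite /= mulr0 add0r => h.
have pn : p != 0 by rewrite gt_eqF.
apply: (mulfI pn); apply: (mulfI (_ : 2^-1 != 0)); first by rewrite invr_eq0 pnatr_eq0.
rewrite mulrA; apply: (addIr (2^-1 * (1 - p) *
  ((1 - lis_tail k.+2) ^+ 2 - (1 - (lis_tail k.+2 + lis_pmf k.+2)) ^+ 2))).
by rewrite -h; field.
Qed.

(** Induction in which summation by parts reduces the step to [lis_conv]. At k = 1 the leaf term of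
    [lis_pmf_rec] intervenes, so that case is computed directly. *)
Lemma lis_tail_conv k : (0 < k)%N -> conv lis_pmf lis_tail k =
  lis_tail k + (1 - p) / p * lis_tail k ^+ 2.
Proof.
have pn : p != 0 by rewrite gt_eqF.
case: k => // k _; elim: k => [|k IH].
  rewrite /conv !big_ord_recl big_ord0 /= lis_pmf0 mul0r add0r addr0.
  rewrite subnn (_ : bump 0 0 = 1%N) // lis_tail0 mulr1.
  have := lis_pmf_rec (ltnSn 0); rewrite eqxx /=.
  rewrite /conv !big_ord_recl big_ord0 /= lis_pmf0 mul0r lis_tail0.
  rewrite mulr0 subrr.
  have -> : lis_pmf 1 = 1 - lis_tail 1 by rewrite -lis_tail0 lis_tailS addrC addKr.
  move=> h; apply/eqP; rewrite -subr_eq0; apply/eqP.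
  have -> : 1 - lis_tail 1 - (lis_tail 1 + (1 - p) / p * lis_tail 1 ^+ 2) =
    2 / p * ((1 - lis_tail 1) - (2^-1 * 1 + 2^-1 * p * (0 + (0 + 0)) +
      2^-1 * (1 - p) * ((1 - lis_tail 1) ^+ 2 - 0 ^+ 2)) - (1 - p) * 0).
    by field.
  by rewrite -h; ring.
have shift : conv lis_pmf lis_tail k.+2 =
    conv lis_pmf lis_tail k.+1 + lis_pmf k.+2 - conv lis_pmf lis_pmf k.+2.
  rewrite {1 3}/conv !(big_ord_recr k.+2) /= subnn lis_pmf0 lis_tail0 mulr0 mulr1 addr0.
  rewrite addrAC; congr (_ + _); apply/eqP; rewrite eq_sym subr_eq; apply/eqP.
  rewrite /conv -big_split; apply: eq_bigr => i _ /=.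
  have ik : (i <= k.+1)%N by rewrite -ltnS.
  by rewrite -mulrDr (subSn ik) (lis_tailS (k.+1 - i)).
rewrite shift IH lis_conv //=.
have -> : lis_tail k.+1 = lis_tail k.+2 + lis_pmf k.+2 by exact: lis_tailS.
by field.
Qed.

Lemma lis_tail_system : tail_system ((1 - p) / p) lis_pmf lis_tail.
Proof.
split.
- by rewrite divr_gt0 // subr_gt0.
- exact: lis_pmf0.
- exact: lis_tail0.
- exact: lis_tailS.
- exact: lis_pmf_gt0.
- exact: lis_tail_gt0.
- exact: lis_conv.
- exact: lis_tail_conv.
Qed.

End TreeSums.

(** * The Gamma integral *)

Section GammaIntegral.
Variable R : realType.
Local Notation mu := (@lebesgue_measure R).

Definition gamma_fun (x t : R) : R := t `^ (x - 1) * expR (- t).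

Definition gamma_int (x : R) : \bar R :=
  (\int[mu]_(t in [set t : R | 0 < t]%R) (gamma_fun x t)%:E)%E.

Lemma Gamma_posE x : Gamma_pos x = fine (gamma_int x).
Proof. by []. Qed.

Lemma gamma_fun_ge0 x t : 0 <= gamma_fun x t.
Proof. by rewrite mulr_ge0 ?powR_ge0 ?expR_ge0. Qed.

Lemma measurable_gamma_fun x (D : set R) : measurable D ->
  measurable_fun D (gamma_fun x).
Proof.
move=> mD; apply: measurable_funTS.
apply: measurable_funM; first exact: measurable_powR.
apply: measurableT_comp; first exact: measurable_expR.
exact: oppr_measurable.
Qed.

Lemma gamma_int_ge0 x : (0 <= gamma_int x)%E.
Proof. by apply: integral_ge0 => t _; rewrite lee_fin gamma_fun_ge0. Qed.

(* The exhaustion of the open half-line by compact intervals on which the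
   integrands are continuous. *)
Definition exhaustion (n : nat) : set R := `[(n.+2%:R : R)^-1, n.+2%:R].

Lemma exhaustion_gt0 n t : exhaustion n t -> 0 < t.
Proof.
by rewrite /exhaustion /= in_itv /= => /andP[h _]; apply: lt_le_trans h; rewrite invr_gt0.
Qed.

Lemma exhaustion_nondecr : nondecreasing_seq exhaustion.
Proof.
move=> m n mn; apply/subsetPset => t; rewrite /exhaustion /= !in_itv /= => /andP[h1 h2].
apply/andP; split.
  by apply: le_trans h1; rewrite lef_pV2 ?posrE ?ltr0n // ler_nat !ltnS.
by apply: le_trans h2 _; rewrite ler_nat !ltnS.
Qed.

Lemma exhaustion_bigcup : \bigcup_i exhaustion i = [set t : R | 0 < t].
Proof.
apply/seteqP; split=> [t [n _]|t /= t0]; first exact: exhaustion_gt0.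
pose n := Num.truncn (t + t^-1); exists n => //.
have tV : 0 < t^-1 by rewrite invr_gt0.
have h : t + t^-1 < n.+2%:R.
  by apply: lt_trans (truncnS_gt _) _; rewrite ltr_nat.
rewrite /exhaustion /= in_itv /=; apply/andP; split; last by apply: ltW; lra.
by rewrite -[leRHS]invrK lef_pV2 ?posrE ?ltr0n //; apply: ltW; lra.
Qed.

Lemma measurable_exhaustion n : measurable (exhaustion n).
Proof. exact: measurable_itv. Qed.

Lemma exhaustion_cvg (f : R -> \bar R) : (forall n, measurable_fun (exhaustion n) f) ->
  (forall t, 0 < t -> (0 <= f t)%E) ->
  (\int[mu]_(t in exhaustion n) f t)%E @[n --> \oo] --> (\int[mu]_(t in [set t : R | (0 < t)%R]) f t)%E.
Proof.
move=> mf f0; rewrite -exhaustion_bigcup; apply: ge0_nondecreasing_set_cvg_integral => //.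
- exact: exhaustion_nondecr.
- by move=> n; exact: measurable_exhaustion.
- by move=> n t /exhaustion_gt0; exact: f0.
Qed.

Lemma gamma_by_parts x n : 0 < x ->
  (\int[mu]_(t in exhaustion n) (gamma_fun (x + 1)%R t)%:E =
   (gamma_fun (x + 1) (n.+2%:R^-1) - gamma_fun (x + 1) n.+2%:R)%R%:E +
   x%:E * \int[mu]_(t in exhaustion n) (gamma_fun x t)%:E)%E.
Proof.
move=> x0; set b := n.+2%:R : R; set a := b^-1.
have a0 : 0 < a by rewrite invr_gt0.
have ab : a < b.
  apply: (@lt_le_trans _ _ 1); last by rewrite ler1n.
  by rewrite invf_lt1 // ltr1n.
have gt0 (t : R) : t \in `[a, b] -> 0 < t.
  by rewrite in_itv /= => /andP[at_ _]; exact: lt_le_trans at_.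
have dp (y t : R) : 0 < t -> derivable (@powR R ^~ y) t 1.
  by move=> t0; apply: derivable_powR; rewrite in_itv /= t0.
have cp (y t : R) : 0 < t -> {for t, continuous (@powR R ^~ y)}.
  by move=> t0; apply: differentiable_continuous; apply/derivable1_diffP/dp.
have de (t : R) : is_derive t 1 (fun t : R => - expR (- t)) (expR (- t)).
  by apply: is_derive_eq; rewrite mulrN1 opprK.
have dn (t : R) : derivable (fun t : R => expR (- t)) t 1 by [].
have ce (t : R) : {for t, continuous (fun t : R => - expR (- t))}.
  apply: differentiable_continuous; apply/derivable1_diffP.
  by have [] := de t.
have intg : mu.-integrable (exhaustion n) (fun t => (gamma_fun x t)%:E).
  apply: continuous_compact_integrable; first exact: segment_compact.
  apply: derivable_within_continuous => t /gt0 t0.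
  by apply: derivableM; [exact: dp | exact: dn].
have b0 := lt_trans a0 ab.
have := @integration_by_parts R (@powR R ^~ x) (fun t => - expR (- t))
  (fun t => x * t `^ (x - 1)) (fun t => expR (- t)) a b ab.
have -> : (\int[mu]_(t in exhaustion n) (gamma_fun (x + 1)%R t)%:E =
  \int[mu]_(t in `[a, b]) (t `^ x * expR (- t))%R%:E)%E.
  by apply: eq_integral => t _; rewrite /gamma_fun addrK.
move=> ->.
- have -> : (\int[mu]_(t in `[a, b]) (x * t `^ (x - 1) * - expR (- t))%R%:E =
     - (x%:E * \int[mu]_(t in exhaustion n) (gamma_fun x t)%:E))%E.
    rewrite -mulNe -EFinN -(integralZl _ intg) //.
      by apply: eq_integral => t _; rewrite -EFinM /gamma_fun; congr EFin; ring.
    exact: measurable_exhaustion.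
  rewrite oppeK /gamma_fun addrK; congr (_%:E + _)%E; ring.
- apply: derivable_within_continuous => t /gt0 t0.
  by apply: derivableM => //; exact: dp.
- split; first by move=> t; rewrite in_itv /= => /andP[at_ _]; apply: dp; exact: lt_trans at_.
  + by apply: cvg_at_right_filter; exact: cp.
  + by apply: cvg_at_left_filter; exact: cp.
- move=> t; rewrite in_itv /= => /andP[at_ _].
  by rewrite powR_derive1 // in_itv /= andbT; exact: lt_trans at_.
- apply: derivable_within_continuous => t _.
  exact: dn.
- split; first by move=> t _; have [] := de t.
  + by apply: cvg_at_right_filter; exact: ce.
  + by apply: cvg_at_left_filter; exact: ce.
- by move=> t _; rewrite derive1E; have [_ ->] := de t.
Qed.

Lemma gamma_funS x t : gamma_fun (x + 1) t = t `^ x * expR (- t).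
Proof. by rewrite /gamma_fun addrK. Qed.

Let inv_cvg0 : (fun n => (n.+2%:R : R)^-1) @ \oo --> (0 : R).
Proof. by have := @cvg_harmonic R; rewrite -cvg_shiftS. Qed.

Lemma gamma_fun_cvg0 x : 0 < x ->
  (fun n => gamma_fun (x + 1) ((n.+2%:R)^-1)) @ \oo --> (0 : R).
Proof.
move=> x0; apply: (@squeeze_cvgr _ _ _ _ (cst 0) (fun n => ((n.+2%:R : R)^-1) `^ x)).
- apply: nearW => n; rewrite gamma_fun_ge0 gamma_funS /=; apply: ler_piMr; first exact: powR_ge0.
  by rewrite -[leRHS]expR0 ler_expR oppr_le0 invr_ge0.
- exact: cvg_cst.
- have /cvg_at_rightP h := powR_cvg0 x0.
  by apply: h; split => // n; rewrite invr_gt0.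
Qed.

Lemma gamma_fun_cvgy x : 0 < x ->
  (fun n => gamma_fun (x + 1) n.+2%:R) @ \oo --> (0 : R).
Proof.
move=> x0; pose N := (Num.truncn x).+1.
have xN : x <= N%:R by apply: ltW; exact: truncnS_gt.
apply: (@squeeze_cvgr _ _ _ _ (cst 0) (fun n => (N.+1)`!%:R * (n.+2%:R : R)^-1)).
- apply: nearW => n; rewrite gamma_fun_ge0 gamma_funS /=.
  set t := n.+2%:R : R; have t0 : 0 < t by rewrite ltr0n.
  have t1 : 1 <= t by rewrite ler1n.
  have h1 : t `^ x <= t ^+ N by rewrite -powR_mulrn ?(ltW t0) // ler_powR.
  have f0 : 0 < (N.+1)`!%:R :> R by rewrite ltr0n fact_gt0.
  have h2 : t ^+ N.+1 / (N.+1)`!%:R <= expR t.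
    by apply: le_trans (expR_ge1Dxn N (ltW t0)); rewrite lerDr.
  apply: le_trans (ler_wpM2r (expR_ge0 _) h1) _.
  rewrite expRN ler_pdivrMr ?expR_gt0 // mulrAC ler_pdivlMr // -exprSr mulrC.
  by move: h2; rewrite ler_pdivrMr // mulrC.
- exact: cvg_cst.
- by rewrite -[X in _ --> X](mulr0 ((N.+1)`!%:R)); apply: cvgMr; exact: inv_cvg0.
Qed.

Lemma gamma_exh_cvg x :
  (\int[mu]_(t in exhaustion n) (gamma_fun x t)%:E)%E @[n --> \oo] --> gamma_int x.
Proof.
apply: exhaustion_cvg => [n|t _]; last by rewrite lee_fin gamma_fun_ge0.
by apply/measurable_EFinP; apply: measurable_gamma_fun; exact: measurable_exhaustion.
Qed.

Lemma gamma_int_rec x : 0 < x -> gamma_int (x + 1) = (x%:E * gamma_int x)%E.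
Proof.
move=> x0; have c1 := @gamma_exh_cvg (x + 1).
have c2 : (\int[mu]_(t in exhaustion n) (gamma_fun (x + 1)%R t)%:E)%E @[n --> \oo] -->
    (x%:E * gamma_int x)%E.
  under eq_fun do rewrite gamma_by_parts //.
  rewrite -(add0e (x%:E * gamma_int x)%E); apply: cvgeD => //.
    apply: cvg_EFin; first exact: nearW.
    rewrite -[X in _ --> X](subrr (0 : R)).
    by apply: cvgB; [exact: gamma_fun_cvg0 | exact: gamma_fun_cvgy].
  by apply: cvgeZl => //; exact: gamma_exh_cvg.
exact: cvg_unique _ c1 c2.
Qed.

Let pos_setE : [set t : R | 0 < t] = `]0, +oo[%classic.
Proof. by apply/seteqP; split=> t /=; rewrite in_itv /= andbT. Qed.

Lemma gamma_int1 : gamma_int 1 = 1%E.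
Proof.
have -> : gamma_int 1 = (\int[mu]_(t in `[0%R, +oo[) (expR (- t))%:E)%E.
  rewrite /gamma_int pos_setE integral_itv_obnd_cbnd; last first.
    by apply/measurable_EFinP; exact: measurable_gamma_fun.
  apply: eq_integral => t _; rewrite /gamma_fun subrr powRr0 mul1r //.
have de (t : R) : is_derive t 1 (fun t : R => - expR (- t)) (expR (- t)).
  by apply: is_derive_eq; rewrite mulrN1 opprK.
rewrite (@ge0_continuous_FTC2y _ _ (fun t => - expR (- t)) _ 0).
- by rewrite oppr0 expR0 EFinN oppeK add0e.
- by move=> t _; exact: expR_ge0.
- by apply: derivable_within_continuous => t _.
- by rewrite -oppr0; apply: cvgN; exact: cvgr_expR.
- by move=> t _; have [] := de t.
- apply: cvg_at_right_filter.
  have : {for 0, continuous (fun t : R => - expR (- t))}; last by [].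
  by apply: differentiable_continuous; apply/derivable1_diffP; have [] := de 0.
- by move=> t _; rewrite derive1E; have [_ ->] := de t.
Qed.

Lemma powRD_gt0 (a r s : R) : 0 < a -> a `^ (r + s) = a `^ r * a `^ s.
Proof. by move=> a0; rewrite powRD // (gt_eqF a0) implybT. Qed.

Lemma powRB1_gt0 (a s : R) : 0 < a -> a `^ (s - 1) * a = a `^ s.
Proof. by move=> a0; rewrite mulrC -{1}(powRr1 (ltW a0)) -powRD_gt0 // subrKC. Qed.

(** Tangent at l of a concave power. With t = l e^y it becomes e^(s y) <= (1 - s) + s e^y, obtained
    by averaging the tangent of exp at s y, evaluated at y and at 0. *)
Lemma powR_tangent (s l t : R) : 0 <= s <= 1 -> 0 < l -> 0 < t ->
  t `^ s <= (1 - s) * l `^ s + s * l `^ (s - 1) * t.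
Proof.
move=> /andP[s0 s1] l0 t0; set y := ln (t / l).
have tl : t / l = expR y by rewrite /y lnK // posrE divr_gt0.
have -> : t = l * expR y by rewrite -tl mulrCA mulfV ?mulr1 // gt_eqF.
rewrite powRM ?expR_ge0 ?(ltW l0) //.
have -> : expR y `^ s = expR (s * y).
  by rewrite /powR gt_eqF ?expR_gt0 // expRK.
have -> : (1 - s) * l `^ s + s * l `^ (s - 1) * (l * expR y) =
    l `^ s * ((1 - s) + s * expR y).
  rewrite -(powRB1_gt0 s l0).
  by ring.
rewrite ler_wpM2l ?powR_ge0 //; set u := s * y.
have h1 : expR u * (1 + (y - u)) <= expR y.
  rewrite [leRHS](_ : _ = expR u * expR (y - u)); last by rewrite -expRD subrKC.
  by rewrite ler_pM2l ?expR_gt0 // expR_ge1Dx.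
have h2 : expR u * (1 - u) <= 1.
  rewrite [leRHS](_ : _ = expR u * expR (- u)); last by rewrite -expRD subrr expR0.
  by rewrite ler_pM2l ?expR_gt0 // expR_ge1Dx.
have h3 := ler_wpM2l s0 h1.
have s1' : 0 <= 1 - s by rewrite subr_ge0.
have h4 := ler_wpM2l s1' h2.
have e : expR u = s * (expR u * (1 + (y - u))) + (1 - s) * (expR u * (1 - u)).
  by rewrite /u; ring.
rewrite {1}e; lra.
Qed.

(** A log-convexity bound: integrate the tangent inequality at l = x against the Gamma density.
    Since Gamma (x + 1) = x Gamma x, the two coefficients add up to x^s. *)
Lemma gamma_int_le x s : 0 < x -> 0 <= s <= 1 ->
  (gamma_int (x + s)%R <= (x `^ s)%:E * gamma_int x)%E.
Proof.
move=> x0 s01; have /andP[s0 s1] := s01.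
have mpos : measurable [set t : R | 0 < t] by rewrite pos_setE; exact: measurable_itv.
pose A := (1 - s) * x `^ s; pose B := s * x `^ (s - 1).
have A0 : 0 <= A by rewrite mulr_ge0 ?powR_ge0 // subr_ge0.
have B0 : 0 <= B by rewrite mulr_ge0 ?powR_ge0.
have mg y : measurable_fun [set t : R | 0 < t] (fun t => (gamma_fun y t)%:E).
  by apply/measurable_EFinP; exact: measurable_gamma_fun.
have g0 y t : (0 <= (gamma_fun y t)%:E)%E by rewrite lee_fin gamma_fun_ge0.
apply: (@le_trans _ _ (\int[mu]_(t in [set t : R | (0 < t)%R])
   (A%:E * (gamma_fun x t)%:E + B%:E * (gamma_fun (x + 1)%R t)%:E))%E).
  apply: ge0_le_integral => //.
  - exact: mg.
  - by apply: emeasurable_funD; apply: measurable_funeM; exact: mg.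
  - move=> t /= t0; rewrite -!EFinM -EFinD lee_fin /gamma_fun.
    have -> : x + s - 1 = (x - 1) + s by ring.
    have -> : x + 1 - 1 = (x - 1) + 1 by ring.
    rewrite (powRD_gt0 (x - 1) s t0) (powRD_gt0 (x - 1) 1 t0) (powRr1 (ltW t0)).
    have h := powR_tangent s01 x0 t0.
    have E0 : 0 <= t `^ (x - 1) * expR (- t) by rewrite mulr_ge0 ?powR_ge0 ?expR_ge0.
    rewrite [leLHS](_ : _ = t `^ (x - 1) * expR (- t) * t `^ s); last by ring.
    apply: le_trans (ler_wpM2l E0 h) _; rewrite le_eqVlt; apply/orP; left; apply/eqP.
    by rewrite /A /B; ring.
rewrite ge0_integralD //; last 4 first.
- by move=> t _; rewrite mule_ge0 // lee_fin.
- by apply: measurable_funeM; exact: mg.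
- by move=> t _; rewrite mule_ge0 // lee_fin.
- by apply: measurable_funeM; exact: mg.
rewrite !ge0_integralZl_EFin //; [|exact: mg..].
rewrite -/(gamma_int x) -/(gamma_int (x + 1)) gamma_int_rec // muleA -EFinM -ge0_muleDl.
- rewrite -EFinD (_ : A + B * x = x `^ s) //.
  rewrite /A /B -mulrA.
  rewrite (powRB1_gt0 s x0).
  by ring.
- by rewrite lee_fin.
- by rewrite lee_fin mulr_ge0 // ltW.
Qed.

End GammaIntegral.

Section GammaHalf.
Variable R : realType.
Local Notation mu := (@lebesgue_measure R).

(** Image of [exhaustion n] under squaring, so that the substitution t = u^2 matches the compact
    integrals exactly. *)
Definition exh2 (n : nat) : set R := `[(n.+2%:R^-1) ^+ 2, n.+2%:R ^+ 2].

Lemma exh_sqr_cvg (f : R -> R) : (forall n, measurable_fun (exh2 n) f) ->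
  (forall t, 0 < t -> 0 <= f t) ->
  (\int[mu]_(t in exh2 n) (f t)%:E)%E @[n --> \oo] -->
  (\int[mu]_(t in [set t : R | (0 < t)%R]) (f t)%:E)%E.
Proof.
move=> mf f0.
have -> : [set t : R | 0 < t] =
  \bigcup_n (exh2 n).
  apply/seteqP; split=> [t|t [n _]].
    rewrite -exhaustion_bigcup => -[n _]; rewrite /exhaustion /= in_itv /= => /andP[h1 h2].
    exists n => //; rewrite /exh2 /= in_itv /=; apply/andP; split.
      apply: le_trans h1; rewrite expr2 ger_pMl ?invr_gt0 //.
      by rewrite invf_le1 // ler1n.
    by apply: le_trans h2 _; rewrite expr2 ler_pMr // ler1n.
  rewrite /exh2 /= in_itv /= => /andP[h1 _]; apply: lt_le_trans h1.
  by rewrite exprn_gt0 // invr_gt0.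
apply: ge0_nondecreasing_set_cvg_integral => //.
- move=> m n mn; apply/subsetPset => t; rewrite /exh2 /= !in_itv /= => /andP[h1 h2].
  apply/andP; split.
    apply: le_trans h1; rewrite lerXn2r ?nnegrE ?invr_ge0 //.
    by rewrite lef_pV2 ?posrE ?ltr0n // ler_nat !ltnS.
  by apply: le_trans h2 _; rewrite lerXn2r ?nnegrE // ler_nat !ltnS.
- by move=> n; exact: measurable_itv.
- by move=> n; apply/measurable_EFinP; exact: mf.
- move=> n t; rewrite /exh2 /= in_itv /= => /andP[h1 _]; rewrite lee_fin f0 //.
  by apply: lt_le_trans h1; rewrite exprn_gt0 // invr_gt0.
Qed.

Lemma gamma_half_exh n :
  (\int[mu]_(t in exh2 n) (gamma_fun 2^-1 t)%:E =
   \int[mu]_(t in exhaustion n) (2 * gauss_fun t)%R%:E)%E.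
Proof.
set b := n.+2%:R : R; set a := b^-1.
have a0 : 0 < a by rewrite invr_gt0.
have ab : a <= b.
  apply: (@le_trans _ _ 1); last by rewrite ler1n.
  by rewrite invf_le1 // ler1n.
have b0 := lt_le_trans a0 ab.
have dX (t : R) : is_derive t 1 (fun t : R => t ^+ 2) (2 * t).
  by apply: is_derive_eq; rewrite /GRing.scale /= mulr1 mulr_natl.
have cX (t : R) : {for t, continuous (fun t : R => t ^+ 2)}.
  by apply: differentiable_continuous; apply/derivable1_diffP; have [] := dX t.
have dE : derive1 (fun t : R => t ^+ 2) = (fun t => 2 * t).
  by apply/funext => t; rewrite derive1E; have [_ ->] := dX t.
have cL (t : R) : {for t, continuous (fun t : R => 2 * t)}.
  exact: mulrl_continuous.
rewrite /exh2 -/b -/a (@integration_by_substitution_increasing _ (fun t => t ^+ 2) (gamma_fun 2^-1) a b) //.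
- apply: eq_integral => t; rewrite inE /exhaustion /= in_itv /= => /andP[at_ _].
  have t0 : 0 < t := lt_le_trans a0 at_.
  congr EFin; rewrite dE /gamma_fun /gauss_fun /=.
  have -> : 2^-1 - 1 = - (2^-1) :> R by field.
  change ((t ^+ 2) `^ (- (2^-1)) * expR (- t ^+ 2) * (2 * t) = 2 * expR (- t ^+ 2)).
  rewrite powRN powR12_sqrt ?sqr_ge0 // sqrtr_sqr gtr0_norm //.
  by field; rewrite gt_eqF.
- move=> x y; rewrite !in_itv /= => /andP[ax _] /andP[ay _] xy.
  have x0 := ltW (lt_le_trans a0 ax); have y0 := ltW (lt_le_trans a0 ay).
  by rewrite ltrXn2r.
- by rewrite dE => t _; exact: cL.
- by rewrite dE; apply/cvg_ex; exists (2 * a); apply: cvg_at_right_filter; exact: cL.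
- by rewrite dE; apply/cvg_ex; exists (2 * b); apply: cvg_at_left_filter; exact: cL.
- split.
  + by move=> t _; have [] := dX t.
  + by apply: cvg_at_right_filter; exact: cX.
  + by apply: cvg_at_left_filter; exact: cX.
- apply: derivable_within_continuous => t; rewrite in_itv /= => /andP[at_ _].
  have t0 : 0 < t by apply: lt_le_trans at_; rewrite exprn_gt0.
  apply: derivableM; first by apply: derivable_powR; rewrite in_itv /= t0.
  by [].
Qed.

Lemma gamma_half : gamma_int 2^-1 = (Num.sqrt pi)%:E :> \bar R.
Proof.
have c1 : (\int[mu]_(t in exhaustion n) (2 * gauss_fun t)%R%:E)%E @[n --> \oo] --> gamma_int 2^-1.
  under eq_fun do rewrite -gamma_half_exh.
  apply: exh_sqr_cvg => [n|t _]; last exact: gamma_fun_ge0.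
  by apply: measurable_gamma_fun; exact: measurable_itv.
have mgauss (D : set R) : measurable_fun D (fun t : R => 2 * gauss_fun t).
  by apply: measurable_funTS; apply: measurable_funM => //; exact: measurable_gauss_fun.
have c2 : (\int[mu]_(t in exhaustion n) (2 * gauss_fun t)%R%:E)%E @[n --> \oo] -->
  (\int[mu]_(t in [set t : R | (0 < t)%R]) (2 * gauss_fun t)%R%:E)%E.
  apply: exhaustion_cvg => [n|t _]; first by apply/measurable_EFinP.
  by rewrite lee_fin mulr_ge0 // gauss_fun_ge0.
rewrite (cvg_unique _ c1 c2) //.
have -> : [set t : R | 0 < t] = `]0, +oo[%classic.
  by apply/seteqP; split=> t /=; rewrite in_itv /= andbT.
rewrite integral_itv_obnd_cbnd; last by apply/measurable_EFinP.
under eq_integral do rewrite EFinM.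
rewrite ge0_integralZl_EFin //.
- rewrite integral0y_gauss -EFinM; congr EFin; by field.
- by move=> t _; rewrite lee_fin gauss_fun_ge0.
- by apply/measurable_EFinP; apply: measurable_funTS; exact: measurable_gauss_fun.
Qed.

End GammaHalf.

(** * Limit and duplication formulas for Gamma *)

Section Euler.
Variable R : realType.
Implicit Types (s x : R) (n : nat).
Definition gam x : R := fine (gamma_int x).
Local Notation G := gam.

Lemma fine_scale (r : R) (e : \bar R) : e \is a fin_num -> fine (r%:E * e)%E = r * fine e.
Proof. by case: e. Qed.

Lemma gamma_int_fin s n : 0 < s <= 1 -> gamma_int (s + n%:R) \is a fin_num.
Proof.
move=> /andP[s0 s1]; elim: n => [|n IH].
  rewrite addr0 ge0_fin_numE ?gamma_int_ge0 //.
  have h : (s%:E * gamma_int s <= 1%:E)%E.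
    rewrite -gamma_int_rec // [s + 1]addrC.
    apply: le_trans (gamma_int_le ltr01 _) _; first by rewrite (ltW s0).
    by rewrite gamma_int1 mule1 powR1.
  case: (gamma_int s) h => [r| |] //; first by rewrite ltry.
  by rewrite gt0_muley ?lte_fin.
by rewrite -natr1 addrA gamma_int_rec ?fin_numM // ltr_wpDr.
Qed.

Definition poch s n : R := \prod_(0 <= i < n) (s + i%:R).

Lemma pochS s n : poch s n.+1 = poch s n * (s + n%:R).
Proof. by rewrite /poch big_nat_recr. Qed.

Lemma poch_gt0 s n : 0 < s -> 0 < poch s n.
Proof. by move=> s0; apply: prodr_gt0 => i _; rewrite ltr_wpDr. Qed.

Lemma gam_shift s n : 0 < s <= 1 -> G (s + n%:R) = poch s n * G s.
Proof.
move=> s01; have /andP[s0 _] := s01; elim: n => [|n IH].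
  by rewrite addr0 /poch big_geq // mul1r.
rewrite pochS [poch s n * _]mulrC -mulrA -IH /gam -natr1 addrA.
rewrite gamma_int_rec; last by rewrite ltr_wpDr.
by rewrite (fine_scale _ (gamma_int_fin n s01)).
Qed.

Lemma gam1 : G 1 = 1.
Proof. by rewrite /gam gamma_int1. Qed.

Lemma poch1 n : poch 1 n = (n`!)%:R.
Proof.
elim: n => [|n IH]; first by rewrite /poch big_geq.
by rewrite pochS IH factS natrM mulrC nat1r.
Qed.

Lemma gam_le s t n : 0 < s <= 1 -> 0 <= t <= 1 ->
  G (s + n%:R + t) <= (s + n%:R) `^ t * G (s + n%:R).
Proof.
move=> s01 t01; have f := gamma_int_fin n s01.
have /andP[s0 _] := s01; have x0 : 0 < s + n%:R by rewrite ltr_wpDr.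
have h := gamma_int_le x0 t01.
apply: (@le_trans _ _ (fine (((s + n%:R) `^ t)%:E * gamma_int (s + n%:R)%R)%E)); last first.
  by rewrite (fine_scale _ f).
apply: (fine_le _ _ h); last exact: fin_numM.
rewrite ge0_fin_numE ?gamma_int_ge0 //; apply: le_lt_trans h _.
by case: (gamma_int _) f => // r _; exact: ltry.
Qed.

(** Reciprocal of the n-th term of Euler's limit for Gamma s. *)
Definition euler s n : R := poch s n / (n`!%:R * n%:R `^ (s - 1)).

(** The middle quantity is Gamma (s + n) / (n! n^(s - 1)). [gam_le] from n with increment s bounds
    it above; from s + n with increment 1 - s it bounds it below by (n / (s + n))^(1 - s) >= n / (s
    + n) >= 1 - 1 / n. *)
Lemma euler_bounds s n : 0 < s < 1 -> (0 < n)%N ->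
  1 - n%:R^-1 <= euler s n * G s <= 1.
Proof.
move=> /andP[s0 s1]; case: n => // n _; set N := n.+1%:R : R.
have s01 : 0 < s <= 1 by rewrite s0 ltW.
have N0 : 0 < N by rewrite ltr0n.
have f0 : 0 < (n.+1)`!%:R :> R by rewrite ltr0n fact_gt0.
have d0 : 0 < (n.+1)`!%:R * N `^ (s - 1) by rewrite mulr_gt0 ?powR_gt0.
have G1n m : G (1 + m%:R) = (m`!)%:R.
  by rewrite gam_shift ?ltr01 ?lexx // poch1 gam1 mulr1.
apply/andP; split.
- have h : (n.+1)`!%:R <= (s + N) `^ (1 - s) * (poch s n.+1 * G s).
    rewrite -gam_shift // -G1n.
    rewrite [1 + _](_ : _ = s + n.+1%:R + (1 - s)); last by ring.
    by apply: gam_le => //; rewrite subr_ge0 (ltW s1) gerBl ltW.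
  have sN : 0 < s + N by rewrite addr_gt0.
  have r0 : 0 < N / (s + N) by rewrite divr_gt0.
  have r1 : N / (s + N) <= 1 by rewrite ler_pdivrMr // mul1r lerDr ltW.
  apply: (@le_trans _ _ (N / (s + N))).
    rewrite -[leLHS](mulfK (lt0r_neq0 sN)) ler_pM2r ?invr_gt0 //.
    rewrite mulrBl mul1r mulrDr mulVf ?gt_eqF //.
    have : 0 <= N^-1 * s by apply: mulr_ge0 (ltW s0); rewrite invr_ge0 ltW.
    move=> h0; rewrite -subr_ge0 (_ : _ - _ = N^-1 * s + (1 - s)); last by ring.
    by rewrite addr_ge0 // subr_ge0 ltW.
  apply: (@le_trans _ _ ((N / (s + N)) `^ (1 - s))).
    by apply: ger1_powR; [rewrite r0 | rewrite gerBl ltW].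
  rewrite /euler mulrAC ler_pdivlMr //.
  rewrite powRM ?invr_ge0 ?(ltW N0) ?(ltW sN) //.
  have -> : (s + N)^-1 `^ (1 - s) = ((s + N) `^ (1 - s))^-1.
    by rewrite -(powR_inv1 (ltW sN)) -powRrM mulN1r powRN.
  have e : N `^ (1 - s) * N `^ (s - 1) = 1.
    by rewrite -powRD_gt0 // addrC subrKA subrr powRr0.
  rewrite [leLHS](_ : _ = (N `^ (1 - s) * N `^ (s - 1)) * (n.+1)`!%:R / (s + N) `^ (1 - s)); last by ring.
  by rewrite e mul1r ler_pdivrMr ?powR_gt0 // mulrC.
- rewrite /euler mulrAC ler_pdivrMr // mul1r -gam_shift //.
  rewrite [s + _](_ : _ = 1 + n%:R + s); last by rewrite -natr1; ring.
  apply: le_trans (gam_le n _ _) _; rewrite ?ltr01 ?lexx ?(ltW s0) ?(ltW s1) //.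
  rewrite G1n [1 + n%:R](_ : _ = N); last by rewrite nat1r.
  by rewrite -(powRB1_gt0 s N0) factS natrM -/N le_eqVlt; apply/orP; left; apply/eqP; ring.
Qed.

Lemma gam_gt0 s : 0 < s < 1 -> 0 < G s.
Proof.
move=> s01; have := @euler_bounds s 2 s01 isT => /andP[h _].
have /andP[s0 _] := s01.
have e0 : 0 < euler s 2 by rewrite divr_gt0 ?poch_gt0 // mulr_gt0 ?powR_gt0.
rewrite -(pmulr_rgt0 _ e0); apply: lt_le_trans h; lra.
Qed.

Let inv_cvg0 (f : nat -> nat) : (forall n, (n < f n)%N) ->
  (fun n => ((f n)%:R : R)^-1) @ \oo --> (0 : R).
Proof.
move=> fn; apply: (@squeeze_cvgr _ _ _ _ (cst 0) (@harmonic R)).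
- apply: nearW => n; rewrite /= invr_ge0 ler0n /= /harmonic.
  by rewrite lef_pV2 ?posrE ?ltr0n ?ler_nat // (leq_ltn_trans _ (fn n)).
- exact: cvg_cst.
- exact: cvg_harmonic.
Qed.

Lemma euler_cvg s (f : nat -> nat) : 0 < s < 1 -> (forall n, (n < f n)%N) ->
  (fun n => euler s (f n)) @ \oo --> (G s)^-1.
Proof.
move=> s01 fn; have Gs := gam_gt0 s01.
have h : (fun n => euler s (f n) * G s) @ \oo --> (1 : R).
  apply: (@squeeze_cvgr _ _ _ _ (fun n => 1 - ((f n)%:R)^-1) (cst 1)).
  - apply: nearW => n; apply: euler_bounds => //; exact: leq_ltn_trans (fn n).
  - rewrite -[X in _ --> X](subr0 (1 : R)).
    by apply: cvgB; [exact: cvg_cst | exact: inv_cvg0].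
  - exact: cvg_cst.
rewrite (_ : (fun n => _) = (fun n => euler s (f n) * G s * (G s)^-1)).
  by rewrite -[X in _ --> X](mul1r (G s)^-1); apply: cvgMl.
by apply/funext => n; rewrite mulfK // gt_eqF.
Qed.

Lemma poch_double x n : poch (2 * x) n.*2 = 4 ^+ n * poch x n * poch (x + 2^-1) n.
Proof.
elim: n => [|n IH]; first by rewrite /poch !big_geq // !mulr1.
rewrite doubleS !pochS IH -[n.*2.+1%:R]natr1 -muln2 natrM exprS; by field.
Qed.

(** Exact for every n: [poch_double] at 1 / 2 expresses (2 n)!, which cancels the factor 4^n of
    [poch_double] at x. The limit in n is Legendre's duplication formula. *)
Lemma euler_double x n : 0 < x -> (0 < n)%N ->
  euler (2 * x) n.*2 * euler 2^-1 n = 2 `^ (1 - 2 * x) * (euler x n * euler (x + 2^-1) n).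
Proof.
move=> x0 n0; have N0 : 0 < n%:R :> R by rewrite ltr0n.
have f0 : 0 < n`!%:R :> R by rewrite ltr0n fact_gt0.
have f20 : 0 < (n.*2)`!%:R :> R by rewrite ltr0n fact_gt0.
have h := poch_double 2^-1 n.
rewrite mulfV ?pnatr_eq0 // poch1 (_ : 2^-1 + 2^-1 = 1 :> R) in h; last by field.
rewrite poch1 in h.
rewrite /euler poch_double h.
have -> : n.*2%:R `^ (2 * x - 1) =
    n%:R `^ (x - 1) * n%:R `^ (x + 2^-1 - 1) * n%:R `^ (2^-1) / 2 `^ (1 - 2 * x) :> R.
  rewrite -powRN opprB -muln2 natrM powRM ?(ltW N0) //; congr (_ * _).
  by rewrite -!powRD_gt0 //; congr (_ `^ _); field.
have -> : n%:R `^ (2^-1 - 1) = (n%:R `^ 2^-1)^-1 :> R.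
  by rewrite -powRN; congr (_ `^ _); field.
have A0 : n%:R `^ (x - 1) != 0 :> R by rewrite gt_eqF // powR_gt0.
have B0 : n%:R `^ (x + 2^-1 - 1) != 0 :> R by rewrite gt_eqF // powR_gt0.
have r0 : n%:R `^ 2^-1 != 0 :> R by rewrite gt_eqF // powR_gt0.
have c0 : 2 `^ (1 - 2 * x) != 0 :> R by rewrite gt_eqF // powR_gt0.
have P0 : poch 2^-1 n != 0 by rewrite gt_eqF // poch_gt0 // invr_gt0.
have f0' : n`!%:R != 0 :> R by rewrite gt_eqF.
have p4 : 4 ^+ n != 0 :> R by rewrite expf_neq0 // pnatr_eq0.
move: A0 B0 r0 c0 P0 f0' p4; clear.
move: (n%:R `^ (x - 1)) (n%:R `^ (x + 2^-1 - 1)) (n%:R `^ 2^-1) (2 `^ (1 - 2 * x))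
  (poch 2^-1 n) (n`!%:R) (4 ^+ n) (poch x n) (poch (x + 2^-1) n) => A B r c P f e X Y.
move=> A0 B0 r0 c0 P0 f0 e0; field; rewrite A0 B0 r0 c0 P0 f0 e0 //.
Qed.

Lemma gam_half : gam 2^-1 = Num.sqrt pi.
Proof. by rewrite /gam gamma_half. Qed.

Lemma gam_duplication x : 0 < x < 2^-1 ->
  gam (2 * x) * Num.sqrt pi = 2 `^ (2 * x - 1) * (gam x * gam (x + 2^-1)).
Proof.
move=> /andP[x0 x2]; rewrite -gam_half.
have x1 : 0 < x < 1 by rewrite x0 /=; lra.
have dx1 : 0 < 2 * x < 1 by apply/andP; split; lra.
have h1 : (0 < 2^-1 :> R) && (2^-1 < 1 :> R) by apply/andP; split; lra.
have y1 : 0 < x + 2^-1 < 1 by apply/andP; split; lra.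
have c1 : (fun n => euler (2 * x) (n.+1).*2 * euler 2^-1 n.+1) @ \oo -->
    (gam (2 * x))^-1 * (gam 2^-1)^-1.
  apply: cvgM; last exact: (@euler_cvg _ (fun n => n.+1)).
  by apply: (@euler_cvg _ (fun n => (n.+1).*2)) => // n; rewrite -addnn addSn ltnS leq_addr.
have c2 : (fun n => euler (2 * x) (n.+1).*2 * euler 2^-1 n.+1) @ \oo -->
    2 `^ (1 - 2 * x) * ((gam x)^-1 * (gam (x + 2^-1))^-1).
  rewrite (_ : (fun n => _) = (fun n => 2 `^ (1 - 2 * x) * (euler x n.+1 * euler (x + 2^-1) n.+1))).
    by apply: cvgMr; apply: cvgM; exact: (@euler_cvg _ (fun n => n.+1)).
  by apply/funext => n; rewrite euler_double.
have e : (gam (2 * x))^-1 * (gam 2^-1)^-1 =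
    2 `^ (1 - 2 * x) * ((gam x)^-1 * (gam (x + 2^-1))^-1) by exact: cvg_unique _ c1 c2.
apply: invr_inj; rewrite [LHS]invfM e [RHS]invfM -powRN opprB; congr (_ * _).
by rewrite [RHS]invfM.
Qed.

(** Both sequences are Pochhammer quotients: m k = (1 - g)_k / k! and, by [conv_modelE], (m * m) k =
    (2 - 2 g)_k / k!. *)
Lemma model_euler g k : (0 < k)%N ->
  conv (model g) (model g) k / (k%:R * model g k ^+ 2) =
  euler (2 - 2 * g) k / euler (1 - g) k ^+ 2.
Proof.
move=> k0; have N0 : 0 < k%:R :> R by rewrite ltr0n.
have fE n : n`!%:R = \prod_(0 <= i < n) i.+1%:R :> R.
  elim: n => [|n IH]; first by rewrite big_geq.
  by rewrite big_nat_recr //= factS natrM IH mulrC.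
have mE : model g k = poch (1 - g) k / k`!%:R.
  rewrite fE /model /poch -prodf_div; apply: eq_bigr => i _.
  rewrite -[i.+1%:R]natr1; field.
  by rewrite natr1 pnatr_eq0.
have cE : conv (model g) (model g) k = poch (2 - 2 * g) k / k`!%:R.
  rewrite fE conv_modelE /poch -prodf_div; apply: eq_bigr => i _.
  rewrite -[i.+1%:R]natr1; field.
  by rewrite natr1 pnatr_eq0.
have f0 : k`!%:R != 0 :> R by rewrite pnatr_eq0 -lt0n fact_gt0.
rewrite /euler mE cE.
have -> : k%:R `^ (2 - 2 * g - 1) = k%:R * k%:R `^ (1 - g - 1) ^+ 2 :> R.
  rewrite -{2}(powRr1 (ltW N0)) expr2 -!powRD_gt0 //; congr (_ `^ _); ring.
have P0 : k%:R `^ (1 - g - 1) != 0 :> R by rewrite gt_eqF // powR_gt0.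
have N0' : k%:R != 0 :> R by rewrite gt_eqF.
have [->|Q0] := eqVneq (poch (1 - g) k) 0.
  by rewrite !mul0r expr0n /= mulr0 invr0 !mulr0.
move: f0 P0 N0' Q0; move: (k`!%:R : R) (k%:R : R) (k%:R `^ (1 - g - 1)) (poch (1 - g) k) (poch (2 - 2 * g) k).
move=> f N P U V f0 P0 N0' U0; field; rewrite f0 P0 N0' U0 //.
Qed.

Lemma model_cvg g : 2^-1 < g < 1 -> forall e : R, 0 < e -> exists k0, forall k, (k0 <= k)%N ->
  `|conv (model g) (model g) k / (k%:R * model g k ^+ 2) -
    gam (1 - g) ^+ 2 / gam (2 - 2 * g)| <= e.
Proof.
move=> /andP[g0 g1] e e0.
have h1 : 0 < 1 - g < 1 by apply/andP; split; lra.
have h2 : 0 < 2 - 2 * g < 1 by apply/andP; split; lra.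
have c : (fun k => euler (2 - 2 * g) k.+1 / euler (1 - g) k.+1 ^+ 2) @ \oo -->
    gam (1 - g) ^+ 2 / gam (2 - 2 * g).
  rewrite (_ : _ / _ = (gam (2 - 2 * g))^-1 * ((gam (1 - g) ^+ 2)^-1)^-1); last first.
    by rewrite invrK mulrC.
  apply: cvgM.
    exact: (@euler_cvg _ (fun n => n.+1)).
  apply: cvgV; first by rewrite invr_eq0 expf_neq0 // gt_eqF // gam_gt0.
  under eq_fun do rewrite expr2.
  by rewrite expr2 invfM; apply: cvgM; exact: (@euler_cvg _ (fun n => n.+1)).
move/cvgrPdist_le: c => /(_ e e0)[N _ hN].
exists N.+1 => -[|k] // Nk; rewrite model_euler // distrC.
exact: hN.
Qed.

End Euler.

(** * Slowly varying step functions *)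

Section StepFunctions.
Variable R : realType.

Lemma measurable_truncn (s : nat -> R) :
  measurable_fun [set z : R | 0 < z] (fun z => s (Num.truncn z)).
Proof.
move=> _ B mB.
have -> : [set z : R | 0 < z] `&` (fun z => s (Num.truncn z)) @^-1` B =
  \bigcup_(k in [set k | B (s k)]) (`]0, +oo[ `&` `[k%:R, k.+1%:R[ : set R).
  apply/seteqP; split=> [z [/= z0 Bz]|z [k /= Bk]].
    exists (Num.truncn z) => //; split; first by rewrite /= in_itv /= z0.
    by rewrite /= in_itv /= truncn_itv // ltW.
  rewrite /= !in_itv /= andbT => -[z0 zk]; split => //=.
  by rewrite (truncn_def zk).
apply: bigcup_measurable => k _.
by apply: measurableI; exact: measurable_itv.
Qed.

Lemma truncn_bounds (x z : R) : 0 < x -> 0 < z -> 2 <= x * z ->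
  x * z / 2 <= (Num.truncn (x * z))%:R <= x * z.
Proof.
move=> x0 z0 h; have xz : 0 <= x * z by rewrite mulr_ge0 // ltW.
have /andP[h1 h2] := truncn_itv xz; rewrite h1 andbT.
by rewrite -natr1 in h2; lra.
Qed.

Lemma step_telescope (u : nat -> R) (e : R) k0 m n : 0 <= e -> (0 < k0)%N ->
  (forall k, (k0 <= k)%N -> `|u k.+1 - u k| <= e / k%:R) ->
  (k0 <= m)%N -> (m <= n)%N -> `|u n - u m| <= e * (n%:R - m%:R) / m%:R.
Proof.
move=> e0 k0p hu km; move=> /subnK <-; elim: (n - m)%N => [|j IH].
  by rewrite add0n !subrr normr0 mulr0 mul0r.
have m0 : 0 < m%:R :> R by rewrite ltr0n (leq_trans k0p).
have -> : u (j.+1 + m)%N - u m = (u (j + m).+1 - u (j + m)%N) + (u (j + m)%N - u m).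
  by rewrite addSn; ring.
apply: le_trans (ler_normD _ _) _.
have h1 : `|u (j + m).+1 - u (j + m)%N| <= e / m%:R.
  apply: le_trans (hu _ _) _; first by rewrite (leq_trans km) // leq_addl.
  rewrite ler_wpM2l // lef_pV2 ?posrE ?ltr0n ?ler_nat ?leq_addl //.
  - by rewrite addn_gt0 (leq_trans k0p km) orbT.
  - by rewrite (leq_trans k0p).
apply: le_trans (lerD h1 IH) _; rewrite le_eqVlt; apply/orP; left; apply/eqP.
by rewrite !natrD -[j.+1%:R]natr1; ring.
Qed.

(** The two truncations are O(z) steps apart and each step is o(1 / z). The constant A bounds the
    ratio of the two indices in either order: 2 x if x z has the larger truncation, 2 / x
    otherwise. *)
Lemma step_diff_cvg0 (u : nat -> R) (x : R) : 0 < x ->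
  (forall e : R, 0 < e -> exists2 k0, (0 < k0)%N &
     forall k, (k0 <= k)%N -> `|u k.+1 - u k| <= e / k%:R) ->
  u (Num.truncn (x * z)) - u (Num.truncn z) @[z --> +oo] --> (0 : R).
Proof.
move=> x0 hu; apply/cvgrPdist_le => e e0.
pose A := 2 * x + 2 / x.
have A0 : 0 < A by rewrite addr_gt0 ?mulr_gt0 ?invr_gt0.
have [k0 k0p hk] := hu (e / A) (divr_gt0 e0 A0).
near=> z.
have z2 : 2 <= z by near: z; apply: nbhs_pinfty_ge; rewrite num_real.
have zx : 2 / x <= z by near: z; apply: nbhs_pinfty_ge; rewrite num_real.
have zk : 2 * k0%:R <= z by near: z; apply: nbhs_pinfty_ge; rewrite num_real.
have zkx : 2 * k0%:R / x <= z by near: z; apply: nbhs_pinfty_ge; rewrite num_real.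
have z0 : 0 < z by lra.
rewrite ler_pdivrMr // [z * x]mulrC in zx; rewrite ler_pdivrMr // [z * x]mulrC in zkx.
have := truncn_bounds x0 z0 zx; set n := Num.truncn (x * z) => /andP[n1 n2].
have := @truncn_bounds 1 z ltr01 z0; rewrite mul1r => /(_ z2).
set m := Num.truncn z => /andP[m1 m2].
have km : (k0 <= m)%N by rewrite -(ler_nat R); lra.
have kn : (k0 <= n)%N by rewrite -(ler_nat R); lra.
have m0 : 0 < m%:R :> R by rewrite ltr0n (leq_trans k0p).
have n0 : 0 < n%:R :> R by rewrite ltr0n (leq_trans k0p).
have eA : 0 <= e / A by rewrite ltW // divr_gt0.
have xV : 0 < x^-1 by rewrite invr_gt0.
rewrite sub0r normrN.
have fin r : r <= A -> e / A * r <= e.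
  by move=> rA; rewrite -mulrA ler_piMr ?(ltW e0) // mulrC ler_pdivrMr // mul1r.
have [mn|nm] := leqP m n.
  apply: le_trans (step_telescope eA k0p hk km mn) _; rewrite -mulrA; apply: fin.
  rewrite ler_pdivrMr //; apply: le_trans (_ : 2 * x * m%:R <= _).
    have : x * (z / 2) <= x * m%:R by rewrite ler_pM2l.
    lra.
  by rewrite ler_pM2r // lerDl mulr_ge0 // ltW.
rewrite distrC; apply: le_trans (step_telescope eA k0p hk kn (ltnW nm)) _.
rewrite -mulrA; apply: fin.
rewrite ler_pdivrMr //; apply: le_trans (_ : 2 / x * n%:R <= _).
  have : x^-1 * (x * z / 2) <= x^-1 * n%:R by rewrite ler_pM2l.
  rewrite !mulrA mulVf ?gt_eqF // mul1r; lra.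
by rewrite ler_pM2r // lerDr mulr_ge0 // ltW.
Unshelve. all: by end_near. Qed.

Lemma step_cvg (u : nat -> R) (l x : R) : 0 < x ->
  (forall e : R, 0 < e -> exists k0, forall k, (k0 <= k)%N -> `|u k - l| <= e) ->
  u (Num.truncn (x * z)) @[z --> +oo] --> l.
Proof.
move=> x0 hu; apply/cvgrPdist_le => e e0; have [k0 hk] := hu e e0.
near=> z; rewrite distrC; apply: hk.
have : k0%:R / x <= z by near: z; apply: nbhs_pinfty_ge; rewrite num_real.
rewrite ler_pdivrMr // mulrC => h.
by rewrite truncn_ge_nat // (le_trans _ h).
Unshelve. all: by end_near. Qed.

(** Increments are controlled for t only, and s / t -> l transfers slow variation to s. This serves
    for q, which is reached through its asymptotic ratio to the tail. *)
Lemma step_slowly_varying (s t : nat -> R) (l : R) :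
  (forall k, 0 < s k) -> (forall k, 0 < t k) -> 0 < l ->
  (forall e : R, 0 < e -> exists2 k0, (0 < k0)%N &
     forall k, (k0 <= k)%N -> `|ln (t k.+1) - ln (t k)| <= e / k%:R) ->
  (forall e : R, 0 < e -> exists k0, forall k, (k0 <= k)%N -> `|s k / t k - l| <= e) ->
  slowly_varying (fun z => s (Num.truncn z)).
Proof.
move=> s0 t0 l0 ht hs; split; first exact: measurable_truncn.
split=> // x x0.
have c1 : t (Num.truncn (x * z)) / t (Num.truncn z) @[z --> +oo] --> (1 : R).
  rewrite (_ : (fun z => _) = (fun z => expR (ln (t (Num.truncn (x * z))) -
      ln (t (Num.truncn z))))); last first.
    by apply/funext => z; rewrite expRD expRN !lnK ?posrE.
  have h : expR (ln (t (Num.truncn (x * z))) - ln (t (Num.truncn z))) @[z --> +oo]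
      --> expR (0 : R).
    apply: continuous_cvg; first exact: continuous_expR.
    exact: (@step_diff_cvg0 (fun k => ln (t k))).
  by rewrite expR0 in h.
have c2 : s (Num.truncn (x * z)) / t (Num.truncn (x * z)) @[z --> +oo] --> l.
  exact: (@step_cvg (fun k => s k / t k)).
have c3 : s (Num.truncn (z : R)) / t (Num.truncn z) @[z --> +oo] --> l.
  have := @step_cvg (fun k => s k / t k) l 1 ltr01 hs.
  by under eq_fun do rewrite mul1r.
have -> : (fun z => s (Num.truncn (x * z)) / s (Num.truncn z)) =
  (fun z => (s (Num.truncn (x * z)) / t (Num.truncn (x * z))) *
    (t (Num.truncn (x * z)) / t (Num.truncn z)) *
    (s (Num.truncn z) / t (Num.truncn z))^-1).
  apply/funext => z; field.
  by rewrite !gt_eqF.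
have -> : (1 : R) = l * 1 / l by rewrite mulr1 mulfV // gt_eqF.
by apply: cvgM; [exact: cvgM | apply: cvgV => //; rewrite gt_eqF].
Qed.

End StepFunctions.

Section Ratio.
Variable R : realType.

Lemma ln1D_lb (y : R) : 0 <= y -> y / (1 + y) <= ln (1 + y).
Proof.
move=> y0; have y1 : 0 < 1 + y by lra.
have h := @le_ln1Dx R (- (y / (1 + y))).
have e : 1 - y / (1 + y) = (1 + y)^-1 by field; rewrite gt_eqF.
rewrite -lerN2; apply: le_trans (h _).
  by rewrite e lnV ?posrE.
by rewrite ltrN2 ltr_pdivrMr // mul1r; lra.
Qed.

(** With ln (1 + y) between y / (1 + y) and y, the difference is (g - H) / k up to O(1 / k^2). *)
Lemma ln_ratio_bound (g H K k e : R) : 0 < k -> 0 <= g <= 1 -> 0 <= H -> H <= K ->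
  `|H - g| <= e ->
  `|g * ln (1 + k^-1) - ln (1 + H / k)| <= (e + (1 + K ^+ 2) / k) / k.
Proof.
move=> k0 /andP[g0 g1] H0 HK; rewrite ler_norml => /andP[e1 e2].
have kV : 0 < k^-1 by rewrite invr_gt0.
have k1 : 0 < k + 1 by lra.
have kH : 0 < k + H by lra.
have a1 : g * ln (1 + k^-1) <= g * k^-1.
  by rewrite ler_wpM2l // le_ln1Dx // (lt_trans _ kV) // ltrN10.
have a2 : g * (k^-1 - k^-1 ^+ 2) <= g * ln (1 + k^-1).
  rewrite ler_wpM2l //; apply: le_trans (ln1D_lb (ltW kV)).
  rewrite ler_pdivlMr; last by lra.
  have : 0 <= k^-1 ^+ 3 by rewrite exprn_ge0 // ltW.
  by rewrite (_ : (k^-1 - k^-1 ^+ 2) * (1 + k^-1) = k^-1 - k^-1 ^+ 3); [lra | ring].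
have Hk0 : 0 <= H / k by rewrite divr_ge0 // ltW.
have b1 : ln (1 + H / k) <= H * k^-1.
  by rewrite le_ln1Dx // (lt_le_trans _ Hk0) // ltrN10.
have b2 : H * k^-1 - H ^+ 2 * k^-1 ^+ 2 <= ln (1 + H / k).
  apply: le_trans (ln1D_lb Hk0); rewrite ler_pdivlMr; last by lra.
  have : 0 <= H ^+ 3 * k^-1 ^+ 3 by rewrite mulr_ge0 ?exprn_ge0 // ltW.
  by rewrite (_ : (H * k^-1 - H ^+ 2 * k^-1 ^+ 2) * (1 + H / k) =
    H * k^-1 - H ^+ 3 * k^-1 ^+ 3); [lra | ring].
have c1 : H ^+ 2 * k^-1 ^+ 2 <= K ^+ 2 * k^-1 ^+ 2.
  by rewrite ler_wpM2r ?sqr_ge0 // lerXn2r ?nnegrE // (le_trans H0).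
have c2 : g * k^-1 ^+ 2 <= k^-1 ^+ 2 by rewrite ler_piMl ?sqr_ge0.
have d1 : (H - g) * k^-1 <= e * k^-1 by rewrite ler_pM2r.
have d2 : - e * k^-1 <= (H - g) * k^-1 by rewrite ler_pM2r.
have c3 : 0 <= K ^+ 2 * k^-1 ^+ 2 by rewrite mulr_ge0 ?sqr_ge0.
have c4 : 0 <= k^-1 ^+ 2 by rewrite sqr_ge0.
rewrite (_ : (e + (1 + K ^+ 2) / k) / k = e * k^-1 + k^-1 ^+ 2 + K ^+ 2 * k^-1 ^+ 2); last by ring.
rewrite ler_norml; apply/andP; split; move: a1 a2 b1 b2 d1 d2; rewrite ?mulrBr ?mulrBl; lra.
Qed.

End Ratio.

(** * Regular variation *)

Ltac neq0 := repeat (apply/andP; split);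
  solve [apply: lt0r_neq0; lra | apply: ltr0_neq0; lra].

Section GammaEquation.
Variable R : realType.

(** On this range - x truncates to 0, so the definition shifts exactly once. It serves for the
    argument 1/2 - g, which lies in (-1/2, 0). *)
Lemma Gamma_recE (x : R) : x <= 0 -> -1 < x -> Gamma x = gam (x + 1) / x.
Proof.
move=> x0 x1; rewrite /Gamma (_ : Num.truncn (- x) = 0%N); last first.
  by apply/truncn0Pn; rewrite -ltNge; lra.
by rewrite big_ord_recl big_ord0 mulr1 addr0 Gamma_posE.
Qed.

Lemma Gamma_gam (x : R) : 0 < x < 1 -> Gamma x = gam x.
Proof.
move=> /andP[x0 x1]; rewrite /Gamma (_ : Num.truncn (- x) = 0%N); last first.
  by apply/truncn0Pn; rewrite -ltNge; lra.
rewrite big_ord_recl big_ord0 mulr1 addr0 Gamma_posE -/(gam _) gam_shift ?x0 ?ltW //.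
by rewrite /poch big_nat1 addr0 mulrC mulKf // gt_eqF.
Qed.

Lemma Gamma_equation (p g : R) : 0 < p -> p < 1 -> 2^-1 < g -> g < 1 ->
  (4 `^ g * Num.sqrt pi)^-1 * (Gamma (2^-1 - g) / Gamma (1 - g)) = p / (p - 1) ->
  gam (1 - g) ^+ 2 / gam (2 - 2 * g) = (1 - p) / p / (2 * g - 1).
Proof.
move=> p0 p1 g0 g1; rewrite Gamma_recE; [|lra|lra].
rewrite Gamma_gam; last by apply/andP; split; lra.
have x0 : 0 < 1 - g < 2^-1 by apply/andP; split; lra.
have := gam_duplication x0.
rewrite (_ : 2 * (1 - g) = 2 - 2 * g); last by ring.
rewrite (_ : 2^-1 - g + 1 = 1 - g + 2^-1); last by ring.
have a0 : 0 < gam (1 - g) by apply: gam_gt0; apply/andP; split; lra.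
have b0 : 0 < gam (2 - 2 * g) by apply: gam_gt0; apply/andP; split; lra.
have s0 : 0 < Num.sqrt pi :> R by rewrite sqrtr_gt0 pi_gt0.
have -> : (4 : R) `^ g = 2 `^ (2 * g).
  by rewrite powRrM (_ : 2 `^ 2 = 4 :> R) // powR_mulrn // expr2 -natrM.
have f0 : 0 < 2 `^ (2 * g) :> R by rewrite powR_gt0.
have -> : (2 : R) `^ (2 - 2 * g - 1) = 2 / 2 `^ (2 * g).
  rewrite (_ : 2 - 2 * g - 1 = 1 - 2 * g); last by ring.
  by rewrite powRD_gt0 // powRr1 // powRN.
move: (gam (1 - g)) (gam (2 - 2 * g)) (gam (1 - g + 2^-1)) a0 b0 => a b c a0 b0 dup eqn.
move: (2 `^ (2 * g)) (Num.sqrt pi) s0 f0 dup eqn => f s s0 f0 dup eqn.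
(* The equation determines c = Gamma (3/2 - g); duplication at 1 - g then determines b = Gamma (2 -
   2 g). *)
have ec : c = p / (1 - p) * (g - 2^-1) * a * f * s.
  have -> : c = ((f * s)^-1 * (c / (2^-1 - g) / a)) * (2^-1 - g) * a * f * s.
    by field; neq0.
  by rewrite eqn; field; neq0.
have eb : b = p / (1 - p) * (2 * g - 1) * a ^+ 2.
  apply: (mulIf (lt0r_neq0 s0)); by rewrite dup ec; field; neq0.
by rewrite eb; field; neq0.
Qed.

End GammaEquation.

Section Regularity.
Variables (R : realType) (rho g : R) (q Q : nat -> R).
Hypothesis S : tail_system rho q Q.
Hypothesis g0 : 0 < g.
Hypothesis g1 : g < 1.
Hypothesis hazard_lim : forall e : R, 0 < e -> exists k0, forall k, (k0 <= k)%N ->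
  `|hazard q Q k - g| <= e.

Let Qp k : 0 < Q k := ts_Q S k.
Let hz k := hazard q Q k.
Let K := q 1%N / Q 1%N.

Let hz_ge0 k : 0 <= hz k.
Proof. exact: (hazard_ge0 S). Qed.

Let hz_le k : hz k <= K.
Proof. exact: (hazard_ub S (kq_ub S)). Qed.

Let tail_ratio k : Q k = Q k.+1 * (1 + hz k.+1 / k.+1%:R) := hazard_tail_ratio S k.

(** The shift is due to Q k standing for P(LIS > k): for k >= 1, [Q k.-1] is P(LIS >= k). *)
Definition tail_factor k : R := k%:R `^ g * Q k.-1.
Definition pmf_factor k : R := k%:R `^ (g + 1) * q k.

Lemma tail_factor_gt0 k : (0 < k)%N -> 0 < tail_factor k.
Proof. by move=> k0; rewrite mulr_gt0 // powR_gt0 // ltr0n. Qed.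

Lemma pmf_factor_gt0 k : (0 < k)%N -> 0 < pmf_factor k.
Proof. by case: k => // k _; rewrite mulr_gt0 ?(ts_q S) // powR_gt0 // ltr0n. Qed.

Lemma ln_tail_factor_diff k : (0 < k)%N ->
  ln (tail_factor k.+1) - ln (tail_factor k) = g * ln (1 + k%:R^-1) - ln (1 + hz k / k%:R).
Proof.
case: k => // k _; have k0 : 0 < k.+1%:R :> R by rewrite ltr0n.
have k20 : 0 < k.+2%:R :> R by rewrite ltr0n.
have h0 : 0 < 1 + hz k.+1 / k.+1%:R by rewrite ltr_pwDl // divr_ge0 // ltW.
rewrite /tail_factor /= (tail_ratio k) !lnM ?posrE ?powR_gt0 ?mulr_gt0 // !ln_powR.
have -> : 1 + k.+1%:R^-1 = k.+2%:R / k.+1%:R :> R.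
  by rewrite -[k.+2%:R]natr1; field; rewrite nat1r pnatr_eq0.
by rewrite ln_div ?posrE //; ring.
Qed.

Lemma ln_tail_factor_small (e : R) : 0 < e -> exists2 k0, (0 < k0)%N &
  forall k, (k0 <= k)%N -> `|ln (tail_factor k.+1) - ln (tail_factor k)| <= e / k%:R.
Proof.
move=> e0; have e20 : 0 < e / 2 by rewrite divr_gt0.
have [k0 hk] := hazard_lim e20.
pose k1 := (Num.truncn (2 * (1 + K ^+ 2) / e)).+1.
exists (maxn k0 k1) => [|k]; first by rewrite leq_max /= orbT.
rewrite geq_max => /andP[h0 h1]; have kp : (0 < k)%N by apply: leq_trans h1.
have k00 : 0 < k%:R :> R by rewrite ltr0n.
rewrite ln_tail_factor_diff //.
have g01 : 0 <= g <= 1 by rewrite !ltW.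
apply: le_trans (ln_ratio_bound k00 g01 (hz_ge0 k) (hz_le k) (hk k h0)) _.
rewrite ler_pM2r ?invr_gt0 //.
have : (1 + K ^+ 2) / k%:R <= e / 2; last by move=> ?; lra.
rewrite ler_pdivrMr //; apply: le_trans (_ : e / 2 * k1%:R <= _); last first.
  by rewrite ler_pM2l // ler_nat.
have := truncnS_gt (2 * (1 + K ^+ 2) / e); rewrite -/k1 ltr_pdivrMr //.
lra.
Qed.

Lemma pmf_tail_ratio k : (0 < k)%N ->
  pmf_factor k / tail_factor k = hz k / (1 + hz k / k%:R).
Proof.
case: k => // k _; have k0 : 0 < k.+1%:R :> R by rewrite ltr0n.
have h0 : 0 < 1 + hz k.+1 / k.+1%:R by rewrite ltr_pwDl // divr_ge0 // ltW.
rewrite /pmf_factor /tail_factor powRD_gt0 // powRr1 ?ltW //= (tail_ratio k).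
have -> : q k.+1 = hz k.+1 * Q k.+1 / k.+1%:R.
  by rewrite /hz /hazard; field; rewrite nat1r pnatr_eq0 (gt_eqF (Qp _)).
have p0 : 0 < k.+1%:R `^ g :> R by rewrite powR_gt0.
have y0 := Qp k.+1.
move: (hz k.+1) (k.+1%:R `^ g) (k.+1%:R : R) (Q k.+1) k0 h0 p0 y0 => h P x y x0 h0 P0 y0.
have h1 : 0 < x + h.
  by move: h0; rewrite -(ltr_pM2r x0) mul0r mulrDl divfK ?gt_eqF // mul1r.
by field; neq0.
Qed.

Lemma pmf_tail_ratio_lim (e : R) : 0 < e -> exists k0, forall k, (k0 <= k)%N ->
  `|pmf_factor k / tail_factor k - g| <= e.
Proof.
move=> e0; have e20 : 0 < e / 2 by rewrite divr_gt0.
have [k0 hk] := hazard_lim e20.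
pose k1 := (Num.truncn (2 * K ^+ 2 / e)).+1.
exists (maxn k0 k1) => k.
rewrite geq_max => /andP[h0 h1]; have kp : (0 < k)%N by apply: leq_trans h1.
have k00 : 0 < k%:R :> R by rewrite ltr0n.
rewrite pmf_tail_ratio //.
have := hk k h0; rewrite -/(hz k) => hkg.
have c0 := hz_ge0 k; have cK := hz_le k.
have b : K ^+ 2 / k%:R <= e / 2.
  rewrite ler_pdivrMr //; apply: le_trans (_ : e / 2 * k1%:R <= _); last first.
    by rewrite ler_pM2l // ler_nat.
  by have := truncnS_gt (2 * K ^+ 2 / e); rewrite -/k1 ltr_pdivrMr //; lra.
have b1 : hz k ^+ 2 / k%:R <= K ^+ 2 / k%:R.
  by rewrite ler_pM2r ?invr_gt0 // lerXn2r ?nnegrE // (le_trans c0).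
have d0 : 0 < 1 + hz k / k%:R by rewrite ltr_pwDl // divr_ge0 // ltW.
have u1 : hz k / (1 + hz k / k%:R) <= hz k.
  by rewrite ler_pdivrMr // ler_peMr // lerDl divr_ge0 // ltW.
have u2 : hz k - hz k ^+ 2 / k%:R <= hz k / (1 + hz k / k%:R).
  rewrite ler_pdivlMr //.
  have : 0 <= hz k ^+ 3 / k%:R ^+ 2 by rewrite divr_ge0 ?exprn_ge0 // ltW.
  rewrite (_ : (hz k - hz k ^+ 2 / k%:R) * (1 + hz k / k%:R) =
    hz k - hz k ^+ 3 / k%:R ^+ 2); first by lra.
  by field; rewrite gt_eqF.
move: hkg; rewrite !ler_norml => /andP[? ?]; apply/andP; split; lra.
Qed.

End Regularity.

Theorem theorem7p1 (R : realType) (p alpha : R)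
  (hp : 0 < p < 1)
  (halpha : 2^-1 < alpha < 1)
  (heq : (4 `^ (1 / (2 * alpha)) * Num.sqrt pi)^-1 *
           (Gamma (2^-1 - 1 / (2 * alpha)) / Gamma (1 - 1 / (2 * alpha)))
         = p / (p - 1)) :
  exists phi Phi : R -> R,
    slowly_varying phi /\ slowly_varying Phi /\
    forall k : nat, (1 <= k)%N ->
      q_LIS p k = k%:R `^ (- (1 / (2 * alpha)) - 1) * phi k%:R /\
      Q_LIS p k = k%:R `^ (- (1 / (2 * alpha))) * Phi k%:R.
Proof.
have /andP[p0 p1] := hp; have /andP[a0 a1] := halpha.
have a2 : 0 < 2 * alpha by lra.
have g0 : 2^-1 < 1 / (2 * alpha) by rewrite ltr_pdivlMr //; lra.
have g1 : 1 / (2 * alpha) < 1 by rewrite ltr_pdivrMr //; lra.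
move: (1 / (2 * alpha)) g0 g1 heq => g g0 g1 heq'.
have g00 : 0 < g by lra.
have S := lis_tail_system p0 p1.
have g01 : 2^-1 < g < 1 by rewrite g0.
have hl : forall e : R, 0 < e -> exists k0, forall k, (k0 <= k)%N ->
    `|hazard (lis_pmf p) (lis_tail p) k - g| <= e.
  apply: (hazard_limit S g0 g1) => e e0.
  by rewrite -(Gamma_equation p0 p1 g0 g1 heq'); exact: model_cvg.
(* At index 0 both factors vanish with the power of 0; using index 1 instead keeps the step
   functions positive on (0, 1). *)
pose s k := tail_factor g (lis_tail p) (maxn k 1).
pose t k := pmf_factor g (lis_pmf p) (maxn k 1).
have s0 k : 0 < s k by apply: (tail_factor_gt0 g S); rewrite leq_max orbT.
have t0 k : 0 < t k by apply: (pmf_factor_gt0 g S); rewrite leq_max orbT.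
have hs (e : R) : 0 < e -> exists2 k0, (0 < k0)%N &
    forall k, (k0 <= k)%N -> `|ln (s k.+1) - ln (s k)| <= e / k%:R.
  move=> e0; have [k0 k00 hk] := ln_tail_factor_small S g00 g1 hl e0.
  exists k0 => // k kk; have k1 : (1 <= k)%N := leq_trans k00 kk.
  by rewrite /s !(maxn_idPl _) //; exact: hk.
exists (fun z => t (Num.truncn z)), (fun z => s (Num.truncn z)); split; [|split].
- apply: (step_slowly_varying t0 s0 g00 hs) => e e0.
  have [k0 hk] := pmf_tail_ratio_lim S hl e0.
  exists (maxn k0 1) => k; rewrite geq_max => /andP[h0 h1].
  by rewrite /t /s !(maxn_idPl _) //; exact: hk.
- apply: (step_slowly_varying s0 s0 ltr01 hs) => e e0; exists 0%N => k _.
  by rewrite mulfV ?gt_eqF // subrr normr0 ltW.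
move=> k k1; have kR : 0 < k%:R :> R by rewrite ltr0n.
rewrite /t /s natrK (maxn_idPl _) //.
have e1 : k%:R `^ (- g - 1) * k%:R `^ (g + 1) = 1 :> R.
  by rewrite -powRD_gt0 // (_ : - g - 1 + (g + 1) = 0) ?powRr0 //; ring.
have e2 : k%:R `^ (- g) * k%:R `^ g = 1 :> R.
  by rewrite -powRD_gt0 // addNr powRr0.
split; first by rewrite /pmf_factor mulrA e1 mul1r q_LISE.
by rewrite /tail_factor mulrA e2 mul1r -Q_LIS_S prednK.
Qed.
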